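(* Let $p>2$, and let $\varphi:(0,1]\to(0,+\infty)$ be a continuous, increasing function such that $\varphi(t)/t^\beta$ is almost decreasing for some $0<\beta<1$. Let $\mu$ be a positive Borel measure on $\mathbb{T}$, singular with respect to Lebesgue measure, which is $\varphi$-smooth, and let $S_\mu$ be the associated singular inner function. If $$\int_0^1\frac{\varphi(t)^p}{t}\,\langle\varphi\rangle(t)\,e^{\varepsilon\langle\varphi\rangle(t)^2}\,dt<\infty$$ for some $\varepsilon>0$, then there exists $\alpha>0$ such that $S_\mu^\alpha$ is cyclic in $D^p_{p-1}$.
   Context: $\mathbb{D}$ is the open unit disc, $\mathbb{T}$ the unit circle, and $|I|$ the Lebesgue measure of an arc $I\subset\mathbb{T}$. The singular inner function associated with $\mu$ is $$S_\mu(z)=\exp\left\{-\int_0^{2\pi}\frac{e^{i\theta}+z}{e^{i\theta}-z}\,d\mu(\theta)\right\},\qquad z\in\mathbb{D},$$ and $S_\mu^\alpha:=S_{\alpha\mu}$ for $\alpha>0$. A function $\psi$ on $(0,1]$ is almost decreasing if there is $c>0$ such that $\psi(x)\ge c\,\psi(y)$ for all $y>x$. The modulus of smoothness of $\mu$ is $$\omega_\mu(t)=\sup\{|\mu(I)-\mu(J)| : I,J \text{ adjacent intervals (arcs) of } \mathbb{T},\ |I|=|J|\le t\}.$$ A positive measure $\mu$ on $\mathbb{T}$ is $\varphi$-smooth if $\omega_\mu(\delta)\le C\delta\varphi(\delta)$ for some constant $C>0$ (and all $\delta\in(0,1]$). For $s\in(0,1]$, $$\langle\varphi\rangle(s)=\left(\int_s^1\frac{\varphi(t)^2}{t}\,dt\right)^{1/2}.$$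 $D^p_{p-1}$ is the space of analytic functions $f$ on $\mathbb{D}$ with $$\|f\|_{D^p_{p-1}}=|f(0)|+\left(\int_{\mathbb{D}}(1-|z|)^{p-1}|f'(z)|^p\,dA(z)\right)^{1/p}<\infty,$$ where $dA$ is area measure. A function $f\in D^p_{p-1}$ is cyclic in $D^p_{p-1}$ if there is a sequence of polynomials $(p_n)$ such that $\|p_nf-1\|_{D^p_{p-1}}\to0$. *)

(* Defs.v *)
From HB Require Import structures.
From mathcomp Require Import all_boot all_order all_algebra.
From mathcomp Require Import all_classical all_reals all_analysis.
From mathcomp Require Export complex.

Set Implicit Arguments.
Unset Strict Implicit.
Unset Printing Implicit Defensive.

Import Order.TTheory GRing.Theory Num.Theory.
Import numFieldNormedType.Exports.

Local Open Scope classical_set_scope.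
Local Open Scope ring_scope.
Local Open Scope complex_scope.

(* R[i] packed as a [numFieldType], so that it receives the topology of its
   modulus and [derivable _ z 1], [derive1] are complex differentiation. *)
Definition Cplx (R : realType) : numFieldType := R[i].

Definition modulus (R : realType) (z : Cplx R) : R := Normc.normc z.

Definition expi (R : realType) (t : R) : Cplx R := cos t +i* sin t.

Definition cexp (R : realType) (z : Cplx R) : Cplx R :=
  (expR (complex.Re z))%:C * expi (complex.Im z).

Definition cintegral (d : measure_display) (T : measurableType d)
    (R : realType) (mu : {measure set T -> \bar R}) (D : set T)
    (f : T -> Cplx R) : Cplx R :=
  (\int[mu]_(x in D) complex.Re (f x)) +i* (\int[mu]_(x in D) complex.Im (f x)).

(* The unit circle is parametrized by the angle t in [0, 2 pi[, through
   t |-> exp (i t): a finite positive Borel measure on the circle is a finite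
   Borel measure on the line carried by [0, 2 pi[. *)
Definition circle_angles (R : realType) : set (measurableTypeR R) :=
  `[0, 2 * pi[%classic.
Arguments circle_angles R : clear implicits.

Definition on_circle (R : realType)
    (mu : {measure set (measurableTypeR R) -> \bar R}) : Prop :=
  mu (~` circle_angles R) = 0%E.

Definition mutually_singular (d : measure_display) (T : measurableType d)
    (R : realType) (mu nu : {measure set T -> \bar R}) : Prop :=
  exists N : set T, [/\ measurable N, nu N = 0%E & mu (~` N) = 0%E].

(* The image on the circle of an interval of the line, so that arcs may pass
   through the point of angle 0. *)
Definition circle_arc (R : realType) (i : interval R) :
    set (measurableTypeR R) :=
  [set t | circle_angles R t /\ exists k : int, t + k%:~R * (2 * pi) \in i].

(* Two arcs of length s with a common endpoint; [BSide true x] and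
   [BSide false x] are the two ways of cutting at x, so all conventions on the
   endpoints (open, closed, half-open) are allowed. *)
Definition adjacent_arcs (R : realType) (s : R)
    (I J : set (measurableTypeR R)) : Prop :=
  exists (a : R) (b1 b2 b3 b4 : bool),
    I = circle_arc (Interval (BSide b1 a) (BSide b2 (a + s))) /\
    J = circle_arc (Interval (BSide b3 (a + s)) (BSide b4 (a + s + s))).

(* The bound s <= pi makes the two arcs non-overlapping. *)
Definition modulus_of_smoothness (R : realType)
    (mu : {measure set (measurableTypeR R) -> \bar R}) (t : R) : \bar R :=
  ereal_sup [set y | exists (s : R) (I J : set (measurableTypeR R)),
    [/\ 0 < s, s <= t, s <= pi, adjacent_arcs s I J &
        y = `| mu I - mu J |%E]].

Definition smooth_measure (R : realType) (phi : R -> R)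
    (mu : {measure set (measurableTypeR R) -> \bar R}) : Prop :=
  exists2 C : R, 0 < C &
    forall delta : R, 0 < delta -> delta <= 1 ->
      (modulus_of_smoothness mu delta <= (C * (delta * phi delta))%:E)%E.

Definition almost_decreasing (R : realType) (psi : R -> R) : Prop :=
  exists2 c : R, 0 < c &
    forall x y : R, 0 < x -> x < y -> y <= 1 -> c * psi y <= psi x.

Definition bracket (R : realType) (phi : R -> R) (s : R) : R :=
  Num.sqrt (\int[lebesgue_measure]_(t in `[s, 1]) (phi t ^+ 2 / t)).

Definition singular_inner (R : realType)
    (mu : {measure set (measurableTypeR R) -> \bar R}) (z : Cplx R) : Cplx R :=
  cexp (- cintegral mu (circle_angles R)
            (fun t => (expi t + z) / (expi t - z))).

Definition holomorphic_disc (R : realType) (f : Cplx R -> Cplx R) : Prop :=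
  forall z : Cplx R, modulus z < 1 -> derivable f z 1.

Definition planar_disc (R : realType) :
    set (measurableTypeR R * measurableTypeR R) :=
  [set w | modulus (w.1 +i* w.2) < 1].
Arguments planar_disc R : clear implicits.

Definition Dnorm (R : realType) (p : R) (f : Cplx R -> Cplx R) : \bar R :=
  ((modulus (f 0))%:E +
   (\int[lebesgue_measure \x lebesgue_measure]_(w in planar_disc R)
      ((1 - modulus (w.1 +i* w.2)) `^ (p - 1) *
       modulus (derive1 f (w.1 +i* w.2)) `^ p)%:E) `^ p^-1)%E.

Definition in_Dspace (R : realType) (p : R) (f : Cplx R -> Cplx R) : Prop :=
  holomorphic_disc f /\ (Dnorm p f < +oo)%E.

Definition cyclic_in_D (R : realType) (p : R) (f : Cplx R -> Cplx R) : Prop :=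
  in_Dspace p f /\
  exists q : nat -> {poly Cplx R},
    (fun n => Dnorm p (fun z => (q n).[z] * f z - 1)) @ \oo --> 0%E.

(* Main.v *)
Require Import Defs.
From mathcomp Require Import all_boot all_order all_algebra.
From mathcomp Require Import all_classical all_reals all_analysis.
From mathcomp Require Import measurable_realfun zify ring lra.
Import Order.TTheory GRing.Theory Num.Theory.
Import numFieldNormedType.Exports.
Local Open Scope classical_set_scope.
Local Open Scope ring_scope.

(** Write H for the Herglotz integral of mu, u >= 0 for its real part (the
    Poisson integral), and f = exp(- alpha H), so that f' = - alpha H' f. For
    r < 1 let f_r(z) = f(r z). Then f / f_r = 1 at 0, and f / f_r tends to 1 in
    the norm of D^p_(p-1) as r tends to 1; as 1 / f_r is analytic beyond the
    closed disc, it may be replaced by polynomials, and f is cyclic.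

    The derivative of f / f_r is f / f_r times alpha (r H'(r z) - H'(z)), and
    |f / f_r| <= exp(alpha u(r z)). On a fixed smaller disc everything converges
    uniformly, so the point is to bound the integral near the circle uniformly
    in r. This is done on dyadic boxes 1 - |z| ~ 2^-n, arg z in a dyadic arc I of
    length 2 pi / 2^n, with two estimates.

    - |H'(z)| is at most a multiple of 2^n phi(2^-n)
      ([modulus_dherglotz_le]). The kernel of H' has a periodic primitive, so it
      only sees how the mean density of mu varies from one scale to the next,
      which the smoothness of mu controls ([oscillating_kernel_le]); the
      growth condition on phi sums the scales.
    - u(z) is at most a multiple of mu(I) / |I|, up to a constant
      ([Re_herglotz_le]).

    The ratios mu(I) / |I| form a dyadic martingale whose n-th increment is at
    most a multiple of phi(2^-n). Azuma's argument ([exp_density_sum_le]) bounds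
    the mean of exp(lam mu(I) / |I|) over the arcs of level n by
    exp(c lam^2 sum_(k < n) phi(2^-k)^2) up to a constant, and the sum in the
    exponent is at most twice the square of the bracket of phi at 2^-n, up to a
    constant ([bracket_sqr_ge]). Since each box lies in a square of area
    comparable to 4^-n ([integral_disc_le]), the integral near the circle is at
    most a tail of the series of the phi(2^-n)^p exp(c alpha^2 <phi>(2^-n)^2).
    For alpha small the integral hypothesis makes this series converge
    ([summable_of_integral]).

    The polynomials are (1 + P / n)^n, up to a constant, with P a Taylor
    polynomial of alpha (H(r z) - H(0)): they satisfy the same bounds as 1 / f_r
    ([approximate_inverse]). *)

(** * The modulus and the circle *)

Section Complex.
Local Open Scope complex_scope.
Context {R : realType}.
Implicit Types (z w v : Cplx R) (t x : R).
Notation Re := complex.Re.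
Notation Im := complex.Im.

Lemma modulus_ge0 z : 0 <= modulus z.
Proof. by case: z => a b; exact: sqrtr_ge0. Qed.

Lemma modulusM z w : modulus (z * w) = modulus z * modulus w.
Proof. exact: Normc.normcM. Qed.

Lemma modulusV z : modulus z^-1 = (modulus z)^-1.
Proof. exact: Normc.normcV. Qed.

Lemma modulusD z w : modulus (z + w) <= modulus z + modulus w.
Proof. exact: le_normcD. Qed.

Lemma modulusN z : modulus (- z) = modulus z.
Proof. exact: normcN. Qed.

Lemma modulusB z w : modulus (z - w) <= modulus z + modulus w.
Proof. by rewrite -(modulusN w); exact: modulusD. Qed.

Lemma modulusC z w : modulus (z - w) = modulus (w - z).
Proof. by rewrite -modulusN opprB. Qed.

Lemma modulus0 : modulus (0 : Cplx R) = 0.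
Proof. exact: Normc.normc0. Qed.

Lemma modulus1 : modulus (1 : Cplx R) = 1.
Proof. exact: Normc.normc1. Qed.

Lemma modulus_eq0 z : (modulus z == 0) = (z == 0).
Proof.
apply/eqP/eqP => [|->]; [exact: Normc.eq0_normc | exact: modulus0].
Qed.

Lemma modulus_gt0 z : (0 < modulus z) = (z != 0).
Proof. by rewrite lt_def modulus_ge0 andbT modulus_eq0. Qed.

Lemma modulusX z n : modulus (z ^+ n) = modulus z ^+ n.
Proof.
by elim: n => [|n IH]; rewrite ?expr0 ?modulus1// !exprS modulusM IH.
Qed.

Lemma modulusE z : modulus z = Num.sqrt (Re z ^+ 2 + Im z ^+ 2).
Proof. by case: z. Qed.

Lemma sqr_modulus z : modulus z ^+ 2 = Re z ^+ 2 + Im z ^+ 2.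
Proof. by rewrite modulusE sqr_sqrtr// addr_ge0// sqr_ge0. Qed.

Lemma ler_Re_modulus z : `|Re z| <= modulus z.
Proof.
by rewrite modulusE -sqrtr_sqr ler_sqrt ?addr_ge0 ?sqr_ge0// lerDl sqr_ge0.
Qed.

Lemma ler_Im_modulus z : `|Im z| <= modulus z.
Proof.
by rewrite modulusE -sqrtr_sqr ler_sqrt ?addr_ge0 ?sqr_ge0// lerDr sqr_ge0.
Qed.

Lemma ler_modulus_ReIm z : modulus z <= `|Re z| + `|Im z|.
Proof.
rewrite -(@ler_pXn2r _ 2) ?nnegrE ?modulus_ge0 ?addr_ge0// sqr_modulus.
rewrite -[Re z ^+ 2]real_normK ?num_real// -[Im z ^+ 2]real_normK ?num_real//.
rewrite sqrrD; set a := `|_|; set b := `|_|.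
have : 0 <= a * b by rewrite /a /b mulr_ge0.
by rewrite mulr2n; lra.
Qed.

Lemma norm_modulus z : `|z| = (modulus z)%:C.
Proof. by []. Qed.

Lemma modulus_real x : modulus (x%:C : Cplx R) = `|x|.
Proof. by rewrite modulusE/= expr0n/= addr0 sqrtr_sqr. Qed.

Lemma modulus_nat n : modulus (n%:R : Cplx R) = n%:R.
Proof.
have -> : (n%:R : Cplx R) = (n%:R : R)%:C by rewrite rmorph_nat.
by rewrite modulus_real ger0_norm.
Qed.

Lemma modulus_i : modulus ('i%C : Cplx R) = 1.
Proof. by rewrite modulusE/= expr0n/= add0r expr1n sqrtr1. Qed.

Lemma modulus_expi t : modulus (expi t) = 1.
Proof. by rewrite modulusE/= cos2Dsin2 sqrtr1. Qed.

Lemma expi_neq0 t : expi t != 0.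
Proof. by rewrite -modulus_gt0 modulus_expi. Qed.

Lemma expiD t x : expi (t + x) = expi t * expi x.
Proof.
rewrite /expi cosD sinD; apply/eqP; rewrite eq_complex/=.
by apply/andP; split; apply/eqP; ring.
Qed.

Lemma expi_period t (k : int) : expi (t + k%:~R * (2 * pi)) = expi t.
Proof.
have p x : expi (x + 2 * pi) = expi x.
  by rewrite /expi mulrC mulr_natr cosD2pi sinD2pi.
have h n x : expi (x + n%:R * (2 * pi)) = expi x.
  elim: n x => [|n IH] x; first by rewrite mul0r addr0.
  by rewrite -natr1 mulrDl mul1r addrA p IH.
case: k => n; first exact: h.
by rewrite NegzE mulrNz mulNr -[LHS](h n.+1) subrK.
Qed.

End Complex.

(** * Elementary estimates and complex derivatives *)

Section Elementary.
Local Open Scope complex_scope.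
Context {R : realType}.
Implicit Types (x y : R).

Lemma lipschitz_of_derivative (f df : R -> R) (K : R) :
  (forall x, is_derive x 1 f (df x)) -> (forall x, `|df x| <= K) ->
  forall x y, `|f x - f y| <= K * `|x - y|.
Proof.
move=> fdf dfK.
have key a b : a < b -> `|f b - f a| <= K * `|b - a|.
  move=> ab; have [] := @MVT R f df a b ab (fun x _ => fdf x).
    apply: continuous_subspaceT => z; apply: differentiable_continuous.
    by apply/derivable1_diffP; have [] := fdf z.
  by move=> c _ ->; rewrite normrM ler_wpM2r.
move=> x y; case: (ltgtP x y) => [xy|yx|->].
- by rewrite distrC [X in _ * X]distrC key.
- exact: key.
- by rewrite !subrr normr0 mulr0.
Qed.

Lemma norm_cos_le1 x : `|cos x| <= 1.
Proof. by rewrite ler_norml cos_geN1 cos_le1. Qed.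

Lemma norm_sin_le1 x : `|sin x| <= 1.
Proof. by rewrite ler_norml sin_geN1 sin_le1. Qed.

Lemma lipschitz_sin x y : `|sin x - sin y| <= `|x - y|.
Proof.
rewrite -[leRHS]mul1r; apply: (@lipschitz_of_derivative _ cos).
exact: norm_cos_le1.
Qed.

Lemma lipschitz_cos x y : `|cos x - cos y| <= `|x - y|.
Proof.
rewrite -[leRHS]mul1r; apply: (@lipschitz_of_derivative _ (fun x => - sin x)).
by move=> z; rewrite normrN; exact: norm_sin_le1.
Qed.

Lemma norm_cos_sub1 x : `|cos x - 1| <= x ^+ 2.
Proof.
have -> : cos x - 1 = - (2 * sin (x / 2) ^+ 2).
  have := cosD (x / 2) (x / 2); rewrite -splitr => ->.
  by have := cos2Dsin2 (x / 2); rewrite !expr2; lra.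
rewrite normrN ger0_norm; last by rewrite pmulr_rge0// sqr_ge0.
have := lipschitz_sin (x / 2) 0; rewrite sin0 !subr0 => h.
have : sin (x / 2) ^+ 2 <= (x / 2) ^+ 2.
  rewrite -[sin _ ^+ 2]real_normK ?num_real// -[leRHS]real_normK ?num_real//.
  by rewrite lerXn2r// nnegrE.
by have := sqr_ge0 x; rewrite !expr2; lra.
Qed.

Lemma norm_sin_subx x : `|sin x - x| <= x ^+ 2.
Proof.
pose f y := sin y - y; pose df y : R := cos y - 1.
have fdf y : is_derive y 1 f (df y) by apply: is_deriveB.
have f0 : f 0 = 0 by rewrite /f sin0 subr0.
have key a b : a <= b -> (a = 0 \/ b = 0) -> `|f b - f a| <= (b - a) ^+ 2.
  move=> ab h; have [|c] := @MVT_segment R f df a b ab (fun x _ => fdf x).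
    apply: continuous_subspaceT => z; apply: differentiable_continuous.
    by apply/derivable1_diffP; have [] := fdf z.
  rewrite in_itv/= => /andP[ac cb] ->; rewrite normrM expr2 (@ger0_norm _ (b - a)) ?subr_ge0//.
  rewrite ler_wpM2r ?subr_ge0// /df -cos0 (le_trans (lipschitz_cos _ _))// subr0.
  by rewrite ler_norml; case: h => h; apply/andP; split; lra.
have [x0|x0] := leP 0 x.
  by have := key 0 x x0 (or_introl erefl); rewrite f0 !subr0.
by have := key x 0 (ltW x0) (or_intror erefl); rewrite f0 !sub0r normrN sqrrN.
Qed.

Lemma norm_expR_sub1x x : `|x| <= 2^-1 -> `|expR x - 1 - x| <= 2 * x ^+ 2.
Proof.
rewrite ler_norml => /andP[x1 x2].
have h1 := expR_ge1Dx x; have h2 := expR_ge1Dx (- x).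
have e0 : 0 < expR x by exact: expR_gt0.
have : expR x * expR (- x) = 1 by rewrite -expRD subrr expR0.
move=> e1; rewrite ger0_norm; last by lra.
have : expR x * (1 - x) <= 1 by rewrite -[leRHS]e1; apply: ler_wpM2l; [exact: ltW|exact: h2].
move=> e2; suff : (expR x - 1 - x) * (1 - x) <= x ^+ 2 by nra.
by rewrite !mulrBl expr2; lra.
Qed.

End Elementary.

Section QuadraticDerivative.
Local Open Scope complex_scope.
Context {R : realType}.
Implicit Types (z w d : Cplx R) (f g : Cplx R -> Cplx R).

(** Derivatives with a quadratic remainder: the functions differentiated
    below all have one, and sums, products and compositions are treated by finite estimates, with
    no limits. *)
Definition qderiv f z d := exists2 e : R, 0 < e & exists C : R,
  forall h, modulus h < e -> modulus (f (z + h) - f z - d * h) <= C * modulus h ^+ 2.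

Lemma qderiv_is_derive f z d : qderiv f z d -> is_derive z 1 f d.
Proof.
move=> [e e0 [C fC]].
have cv : (fun h => h^-1 *: ((f \o shift z) (h *: (1 : Cplx R)) - f z)) @ 0^' --> d.
  apply/cvgrPdist_le => /= eps eps0.
  have [r r0 er] : exists2 r : R, 0 < r & eps = r%:C.
    exists (complex.Re eps); last first.
      by case: eps eps0 => a b; rewrite ltcE/= => /andP[/eqP -> _].
    by case: eps eps0 => a b; rewrite ltcE/= => /andP[_].
  pose del := Num.min e (r / (`|C| + 1)).
  have del0 : 0 < del.
    by rewrite lt_min e0 divr_gt0// ltr_wpDl.
  have : \forall h \near (0 : Cplx R)^', `|h| < del%:C.
    by apply: dnbhs0_lt; rewrite ltcR.
  move=> hd; near=> h.
  have hdel : modulus h < del.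
    by rewrite -ltcR -norm_modulus; near: h.
have h0 : h != 0 by near: h; exact: withinT.
  rewrite er norm_modulus lecR /= /shift/=.
  have -> : d - h^-1 *: (f (h *: 1 + z) - f z) = - (h^-1 * (f (z + h) - f z - d * h)).
    by rewrite /GRing.scale/= mulr1 (addrC h); field.
  rewrite modulusN modulusM modulusV.
  have hm : 0 < modulus h by rewrite modulus_gt0.
  rewrite ler_pdivrMl//.
  move: hdel; rewrite lt_min => /andP[he hr].
  apply: (le_trans (fC _ he)).
  have : modulus h * (`|C| + 1) < r by rewrite -ltr_pdivlMr// ltr_wpDl.
  have := ler_norm C; set m := modulus h; set c := `|C|; move: hm; rewrite -/m => hm h1 h2.
  by rewrite expr2 mulrCA ler_pM2l//; nra.
by split; [apply/cvg_ex; exists d|exact: cvg_lim].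
Unshelve. all: by end_near.
Qed.

Lemma qderiv_cst a z : qderiv (fun=> a) z 0.
Proof.
by exists 1 => //; exists 0 => h _; rewrite subrr mul0r subr0 modulus0 mul0r.
Qed.

Lemma qderiv_id z : qderiv id z 1.
Proof.
by exists 1 => //; exists 0 => h _; rewrite mul1r (addrC z) addrK subrr modulus0 mul0r.
Qed.

Lemma qderivD f g z a b :
  qderiv f z a -> qderiv g z b -> qderiv (fun z => f z + g z) z (a + b).
Proof.
move=> [e e0 [C fC]] [e' e'0 [C' gC]].
exists (Num.min e e'); first by rewrite lt_min e0.
exists (C + C') => h; rewrite lt_min => /andP[h1 h2].
have -> : f (z + h) + g (z + h) - (f z + g z) - (a + b) * h =
  (f (z + h) - f z - a * h) + (g (z + h) - g z - b * h) by ring.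
by rewrite mulrDl (le_trans (modulusD _ _))// lerD// ?fC// gC.
Qed.

(** Controls the cross terms in products and compositions. *)
Lemma qderiv_lipschitz f z a : qderiv f z a ->
  exists2 e : R, 0 < e & exists2 K : R, 0 <= K &
  forall h, modulus h < e -> modulus (f (z + h) - f z) <= K * modulus h.
Proof.
move=> [e e0 [C fC]]; exists (Num.min e 1); first by rewrite lt_min e0 ltr01.
exists (`|C| + modulus a); first by rewrite addr_ge0// modulus_ge0.
move=> h; rewrite lt_min => /andP[h1 h2].
rewrite -(subrK (a * h) (_ - f z)) mulrDl (le_trans (modulusD _ _))// lerD ?modulusM//.
apply: (le_trans (fC _ h1)).
apply: (@le_trans _ _ (`|C| * modulus h ^+ 2)).
  by rewrite ler_wpM2r ?sqr_ge0// ler_norm.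
by rewrite expr2 ler_wpM2l// ler_piMr ?modulus_ge0// ltW.
Qed.

Lemma qderivM f g z a b :
  qderiv f z a -> qderiv g z b ->
  qderiv (fun z => f z * g z) z (a * g z + f z * b).
Proof.
move=> fa gb; have [e1 e10 [C fC]] := fa; have [e2 e20 [C' gC]] := gb.
have [e3 e30 [K K0 fK]] := qderiv_lipschitz _ _ _ fa.
have [e4 e40 [K' K'0 gK]] := qderiv_lipschitz _ _ _ gb.
exists (Num.min (Num.min e1 e2) (Num.min e3 e4)).
  by rewrite !lt_min e10 e20 e30 e40.
exists (C * modulus (g z) + modulus (f z) * C' + K * K') => h.
rewrite !lt_min => /andP[/andP[h1 h2] /andP[h3 h4]].
have -> : f (z + h) * g (z + h) - f z * g z - (a * g z + f z * b) * h =
  (f (z + h) - f z - a * h) * g z + f z * (g (z + h) - g z - b * h)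
  + (f (z + h) - f z) * (g (z + h) - g z) by ring.
rewrite [leRHS]mulrDl [X in _ <= X + _]mulrDl.
apply: (le_trans (modulusD _ _)); apply: lerD.
  apply: (le_trans (modulusD _ _)); apply: lerD; rewrite modulusM.
    by rewrite mulrAC ler_wpM2r ?modulus_ge0// fC.
  by rewrite -mulrA ler_wpM2l ?modulus_ge0// gC.
rewrite modulusM expr2 mulrACA.
by apply: ler_pM; rewrite ?modulus_ge0 ?fK ?gK.
Qed.

Lemma qderiv_comp f g z a b :
  qderiv f z a -> qderiv g (f z) b -> qderiv (fun z => g (f z)) z (b * a).
Proof.
move=> fa gb; have [e1 e10 [C fC]] := fa; have [e2 e20 [C' gC]] := gb.
have [e3 e30 [K K0 fK]] := qderiv_lipschitz _ _ _ fa.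
exists (Num.min (Num.min e1 e3) (e2 / (K + 1))).
  by rewrite !lt_min e10 e30 divr_gt0// ltr_wpDl.
exists (`|C'| * K ^+ 2 + modulus b * C) => h.
rewrite !lt_min => /andP[/andP[h1 h3] h2].
pose k := f (z + h) - f z.
have fk : f (z + h) = f z + k by rewrite /k; ring.
have kK : modulus k <= K * modulus h by exact: fK.
have ke : modulus k < e2.
  apply: (le_lt_trans kK); move: h2; rewrite ltr_pdivlMr ?ltr_wpDl//.
  by have := modulus_ge0 h; nra.
rewrite fk.
have -> : g (f z + k) - g (f z) - b * a * h =
  (g (f z + k) - g (f z) - b * k) + b * (f (z + h) - f z - a * h).
  by rewrite -/k; ring.
rewrite mulrDl; apply: (le_trans (modulusD _ _)); apply: lerD.
  apply: (le_trans (gC _ ke)); rewrite -mulrA -exprMn.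
  apply: (@le_trans _ _ (`|C'| * modulus k ^+ 2)).
    by rewrite ler_wpM2r ?sqr_ge0// ler_norm.
  by rewrite ler_wpM2l// lerXn2r// ?nnegrE ?modulus_ge0// mulr_ge0 ?modulus_ge0.
by rewrite modulusM -mulrA ler_wpM2l ?modulus_ge0// fC.
Qed.

Lemma qderiv_poly (p : {poly Cplx R}) z : qderiv (horner p) z p^`().[z].
Proof.
elim/poly_ind: p => [|p c IH].
  have -> : horner (0 : {poly Cplx R}) = fun=> 0 by apply/funext => x; rewrite horner0.
  by rewrite deriv0 horner0; exact: qderiv_cst.
have -> : horner (p * 'X + c%:P) = fun x => p.[x] * x + c.
  by apply/funext => x; rewrite !hornerE.
have -> : (p * 'X + c%:P)^`().[z] = (p^`().[z] * z + p.[z] * 1) + 0.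
  by rewrite derivD derivM derivX derivC addr0 !hornerE.
apply: qderivD; last exact: qderiv_cst.
by apply: qderivM => //; exact: qderiv_id.
Qed.

Lemma cexpD z w : cexp (z + w) = cexp z * cexp w.
Proof.
case: z => a b; case: w => c d.
by rewrite /cexp /= expRD expiD rmorphM/=; ring.
Qed.

Lemma cexp0 : cexp (0 : Cplx R) = 1.
Proof. by rewrite /cexp/= expR0 /expi cos0 sin0 mul1r. Qed.

Lemma modulus_cexp z : modulus (cexp z) = expR (complex.Re z).
Proof. by rewrite /cexp modulusM modulus_expi mulr1 modulus_real ger0_norm ?expR_ge0. Qed.

Lemma modulus_expi_sub1 (t : R) : modulus (expi t - 1 - 'i%C * t%:C) <= 2 * t ^+ 2.
Proof.
have -> : expi t - 1 - 'i%C * t%:C = ((cos t - 1) +i* (sin t - t) : Cplx R).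
  by apply/eqP; rewrite eq_complex/=; apply/andP; split; apply/eqP; ring.
rewrite (le_trans (ler_modulus_ReIm _))//=.
by have := norm_cos_sub1 t; have := norm_sin_subx t; lra.
Qed.

Lemma modulus_expiB (s t : R) : modulus (expi s - expi t) <= 2 * `|s - t|.
Proof.
rewrite (le_trans (ler_modulus_ReIm _))// /expi /=.
by have := lipschitz_cos s t; have := lipschitz_sin s t; lra.
Qed.

Lemma qderiv_cexp0 : qderiv (@cexp R) 0 1.
Proof.
exists 2^-1 => //; exists 9 => h hm; rewrite add0r cexp0 mul1r.
have [a [b [ha hb hE]]] : exists a b, [/\ `|a| <= modulus h, `|b| <= modulus h & h = a +i* b].
  case: h {hm} => a b; exists a, b; split => //.
  - exact: (ler_Re_modulus (a +i* b)).
  - exact: (ler_Im_modulus (a +i* b)).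
have -> : cexp h - 1 - h = (expR a - 1 - a)%:C * expi b
    + (1 + a%:C) * (expi b - 1 - 'i%C * b%:C) + a%:C * ('i%C * b%:C).
  have hE' : h = a%:C + 'i%C * b%:C by rewrite hE; simpc.
  have -> : cexp h = (expR a)%:C * expi b by rewrite hE.
  by rewrite hE' !rmorphB/= rmorph1; ring.
have a2 : `|a| <= 2^-1 by lra.
have h1 := norm_expR_sub1x _ a2; have h2 := modulus_expi_sub1 b.
apply: (le_trans (modulusD _ _)).
apply: (@le_trans _ _ (2 * a ^+ 2 + (1 + `|a|) * (2 * b ^+ 2) + `|a| * `|b|)).
  apply: lerD; last by rewrite !modulusM modulus_i !modulus_real mul1r.
  apply: (le_trans (modulusD _ _)); apply: lerD.
    by rewrite modulusM modulus_expi mulr1 modulus_real.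
  rewrite modulusM ler_pM// ?modulus_ge0//.
  by rewrite (le_trans (modulusD _ _))// modulus1 modulus_real.
rewrite -[a ^+ 2]real_normK ?num_real// -[b ^+ 2]real_normK ?num_real//.
move: ha hb hm; set x := `|a|; set y := `|b|; set m := modulus h => ha hb hm.
have x0 : 0 <= x by rewrite /x.
have y0 : 0 <= y by rewrite /y.
have xx : x ^+ 2 <= m ^+ 2 by rewrite !expr2; nra.
have yy : y ^+ 2 <= m ^+ 2 by rewrite !expr2; nra.
have xy : x * y <= m ^+ 2 by rewrite !expr2; nra.
have := sqr_ge0 y; nra.
Qed.

Lemma qderiv_cexp z : qderiv (@cexp R) z (cexp z).
Proof.
have [e e0 [C hC]] := qderiv_cexp0; exists e => //; exists (modulus (cexp z) * C) => h he.
rewrite cexpD -[X in _ - X - _]mulr1 -!mulrBr modulusM -mulrA ler_wpM2l ?modulus_ge0//.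
by have := hC h he; rewrite add0r cexp0 mul1r.
Qed.

End QuadraticDerivative.

(** * Integrals of complex kernels *)

Section CIntegral.
Local Open Scope complex_scope.
Context {R : realType}.
Variable mu : {finite_measure set (measurableTypeR R) -> \bar R}.
Implicit Types (f g : R -> Cplx R) (D : set (measurableTypeR R)).
Notation Re := complex.Re.
Notation Im := complex.Im.

(** Continuity is asked of the real and imaginary parts since the complex
    integral is defined through them. With boundedness it gives integrability
    against any finite measure. *)
Definition bcont f :=
  [/\ continuous (fun t => Re (f t)), continuous (fun t => Im (f t)) &
      exists B : R, forall t, modulus (f t) <= B].

Lemma integrable_bounded_continuous D (h : R -> R) (B : R) : measurable D ->
  continuous h -> (forall t, `|h t| <= B) -> mu.-integrable D (EFin \o h).
Proof.
move=> mD hc hB; apply: measurable_bounded_integrable => //.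
- by rewrite ltey_eq fin_num_measure.
- by apply: measurable_funTS; exact: continuous_measurable_fun.
- exists B; split; first exact: num_real.
  by move=> M BM t Dt; exact: le_trans (hB t) (ltW BM).
Qed.

Lemma bcont_integrable_Re D f : measurable D -> bcont f ->
  mu.-integrable D (EFin \o (fun t => Re (f t))).
Proof.
move=> mD [cR _ [B fB]]; apply: (@integrable_bounded_continuous _ _ B) => // t.
by rewrite (le_trans (ler_Re_modulus _)).
Qed.

Lemma bcont_integrable_Im D f : measurable D -> bcont f ->
  mu.-integrable D (EFin \o (fun t => Im (f t))).
Proof.
move=> mD [_ cI [B fB]]; apply: (@integrable_bounded_continuous _ _ B) => // t.
by rewrite (le_trans (ler_Im_modulus _)).
Qed.

Lemma bcont_cst (a : Cplx R) : bcont (fun=> a).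
Proof. by split; [exact: cst_continuous|exact: cst_continuous|exists (modulus a)]. Qed.

Lemma bcont_expi : bcont (@expi R).
Proof.
split; [exact: continuous_cos|exact: continuous_sin|exists 1 => t].
by rewrite modulus_expi.
Qed.

Lemma bcontD f g : bcont f -> bcont g -> bcont (fun t => f t + g t).
Proof.
move=> [fR fI [B fB]] [gR gI [B' gB]]; split.
- have -> : (fun t => Re (f t + g t)) = (fun t => Re (f t) + Re (g t)).
    by apply/funext => t; rewrite raddfD.
  by move=> t; apply: cvgD; [exact: fR|exact: gR].
- have -> : (fun t => Im (f t + g t)) = (fun t => Im (f t) + Im (g t)).
    by apply/funext => t; rewrite raddfD.
  by move=> t; apply: cvgD; [exact: fI|exact: gI].
- by exists (B + B') => t; rewrite (le_trans (modulusD _ _))// lerD.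
Qed.

Lemma bcontM f g : bcont f -> bcont g -> bcont (fun t => f t * g t).
Proof.
move=> [fR fI [B fB]] [gR gI [B' gB]]; split.
- have -> : (fun t => Re (f t * g t)) =
     (fun t => Re (f t) * Re (g t) - Im (f t) * Im (g t)).
    by apply/funext => t; case: (f t) => a b; case: (g t).
  by move=> t; apply: cvgB; apply: cvgM;
    [exact: fR|exact: gR|exact: fI|exact: gI].
- have -> : (fun t => Im (f t * g t)) =
     (fun t => Re (f t) * Im (g t) + Im (f t) * Re (g t)).
    by apply/funext => t; case: (f t) => a b; case: (g t).
  by move=> t; apply: cvgD; apply: cvgM;
    [exact: fR|exact: gI|exact: fI|exact: gR].
- exists (B * B') => t; rewrite modulusM ler_pM ?modulus_ge0//.
Qed.

Lemma bcontN f : bcont f -> bcont (fun t => - f t).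
Proof.
move=> fb; have -> : (fun t => - f t) = (fun t => (-1) * f t).
  by apply/funext => t; rewrite mulN1r.
by apply: bcontM => //; exact: bcont_cst.
Qed.

Lemma bcontB f g : bcont f -> bcont g -> bcont (fun t => f t - g t).
Proof. by move=> fb gb; apply: bcontD => //; exact: bcontN. Qed.

Lemma bcontX f n : bcont f -> bcont (fun t => f t ^+ n).
Proof.
move=> fb; elim: n => [|n IH].
  by have := bcont_cst 1; congr bcont; apply/funext => t; rewrite expr0.
have -> : (fun t => f t ^+ n.+1) = (fun t => f t * f t ^+ n).
  by apply/funext => t; rewrite exprS.
exact: bcontM.
Qed.

Lemma bcontV f (c : R) : 0 < c -> (forall t, c <= modulus (f t)) -> bcont f ->
  bcont (fun t => (f t)^-1).
Proof.
move=> c0 cf [fR fI [B fB]].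
have n0 t : Re (f t) ^+ 2 + Im (f t) ^+ 2 != 0.
  by rewrite -sqr_modulus gt_eqF// exprn_gt0// (lt_le_trans c0).
have nc : continuous (fun t => (Re (f t) ^+ 2 + Im (f t) ^+ 2)^-1).
  move=> t; apply: cvgV => //; apply: cvgD; apply: cvgM;
  by [exact: fR|exact: fI].
split.
- have -> : (fun t => Re (f t)^-1) =
     (fun t => Re (f t) * (Re (f t) ^+ 2 + Im (f t) ^+ 2)^-1).
    by apply/funext => t; case: (f t).
  by move=> t; apply: cvgM; [exact: fR|exact: nc].
- have -> : (fun t => Im (f t)^-1) =
     (fun t => - (Im (f t) * (Re (f t) ^+ 2 + Im (f t) ^+ 2)^-1)).
    by apply/funext => t; case: (f t) => a b.
  by move=> t; apply: cvgN; apply: cvgM; [exact: fI|exact: nc].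
- exists c^-1 => t; rewrite modulusV lef_pV2// posrE.
  exact: lt_le_trans c0 _.
Qed.

Lemma cintegralD D f g : measurable D -> bcont f -> bcont g ->
  cintegral mu D (fun t => f t + g t) = cintegral mu D f + cintegral mu D g.
Proof.
move=> mD fb gb; rewrite /cintegral; apply/eqP; rewrite eq_complex/=.
apply/andP; split; apply/eqP.
- under eq_Rintegral do rewrite raddfD/=.
  by rewrite RintegralD//; exact: bcont_integrable_Re.
- under eq_Rintegral do rewrite raddfD/=.
  by rewrite RintegralD//; exact: bcont_integrable_Im.
Qed.

Lemma cintegralZ D f (a : Cplx R) : measurable D -> bcont f ->
  cintegral mu D (fun t => a * f t) = a * cintegral mu D f.
Proof.
move=> mD fb; have iR := bcont_integrable_Re _ _ mD fb.
have iI := bcont_integrable_Im _ _ mD fb.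
have [cR cI [B fB]] := fb.
have hI c : mu.-integrable D (EFin \o (fun t => c * Im (f t))).
  apply: (@integrable_bounded_continuous _ _ (`|c| * B)) => // t.
    by apply: cvgM; [exact: cst_continuous|exact: cI].
  by rewrite normrM ler_wpM2l// (le_trans (ler_Im_modulus _)).
have hR c : mu.-integrable D (EFin \o (fun t => c * Re (f t))).
  apply: (@integrable_bounded_continuous _ _ (`|c| * B)) => // t.
    by apply: cvgM; [exact: cst_continuous|exact: cR].
  by rewrite normrM ler_wpM2l// (le_trans (ler_Re_modulus _)).
case: a => a b; rewrite /cintegral; apply/eqP; rewrite eq_complex/=.
apply/andP; split; apply/eqP.
- rewrite -!RintegralZl// -RintegralB//; apply: eq_Rintegral => t _.
  by case: (f t).
- rewrite -!RintegralZl// -RintegralD//; apply: eq_Rintegral => t _.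
  by case: (f t).
Qed.

Lemma cintegralB D f g : measurable D -> bcont f -> bcont g ->
  cintegral mu D (fun t => f t - g t) = cintegral mu D f - cintegral mu D g.
Proof.
move=> mD fb gb; rewrite cintegralD//; last exact: bcontN.
congr (_ + _); rewrite -mulN1r -cintegralZ//; congr cintegral.
by apply/funext => t; rewrite mulN1r.
Qed.

Lemma cintegral_cst D (a : Cplx R) : measurable D ->
  cintegral mu D (fun=> a) = a * (fine (mu D))%:C.
Proof.
move=> mD; case: a => a b; rewrite /cintegral/= !Rintegral_cst//.
by apply/eqP; rewrite eq_complex/= !mulr0 subr0 add0r !eqxx.
Qed.

Lemma cintegral_sum D (n : nat) (F : nat -> R -> Cplx R) : measurable D ->
  (forall k, bcont (F k)) ->
  bcont (fun t => \sum_(k < n) F k t) /\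
  cintegral mu D (fun t => \sum_(k < n) F k t) = \sum_(k < n) cintegral mu D (F k).
Proof.
move=> mD Fb; elim: n => [|n [IHb IH]].
  have -> : (fun t => \sum_(k < 0) F k t) = fun=> 0.
    by apply/funext => t; rewrite big_ord0.
  by split; [exact: bcont_cst|rewrite cintegral_cst// mul0r big_ord0].
have -> : (fun t => \sum_(k < n.+1) F k t) = (fun t => \sum_(k < n) F k t + F n t).
  by apply/funext => t; rewrite big_ord_recr.
by split; [exact: bcontD|rewrite cintegralD// IH big_ord_recr].
Qed.

Lemma norm_Rintegral_le D (h : R -> R) (B : R) : measurable D ->
  continuous h -> (exists B', forall t, `|h t| <= B') ->
  (forall t, D t -> `|h t| <= B) ->
  `|\int[mu]_(t in D) h t| <= B * fine (mu D).
Proof.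
move=> mD hc [B' hB'] hB.
have hi : mu.-integrable D (EFin \o h) by exact: (@integrable_bounded_continuous _ _ B').
apply: (le_trans (le_normr_Rintegral mD hi)).
rewrite -Rintegral_cst//; apply: le_Rintegral => //.
  apply: (@integrable_bounded_continuous _ _ B') => // t.
    apply: continuous_comp; [exact: hc|exact: norm_continuous].
  by rewrite normr_id.
by apply: (@integrable_bounded_continuous _ _ `|B|) => // t; exact: cst_continuous.
Qed.

Lemma modulus_cintegral_le D f (B : R) : measurable D -> bcont f ->
  (forall t, D t -> modulus (f t) <= B) ->
  modulus (cintegral mu D f) <= 2 * B * fine (mu D).
Proof.
move=> mD [cR cI [B' fB']] fB.
rewrite (le_trans (ler_modulus_ReIm _))// /cintegral/= -mulrA mulrDl mul1r.
apply: lerD; apply: norm_Rintegral_le => //.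
- by exists B' => t; rewrite (le_trans (ler_Re_modulus _)).
- by move=> t Dt; rewrite (le_trans (ler_Re_modulus _))// fB.
- by exists B' => t; rewrite (le_trans (ler_Im_modulus _)).
- by move=> t Dt; rewrite (le_trans (ler_Im_modulus _))// fB.
Qed.

End CIntegral.

(** * Masses of arcs *)

Section Arcs.
Context {R : realType}.
Variable mu : {finite_measure set (measurableTypeR R) -> \bar R}.
Implicit Types (a b c t : R).

(** The endpoints are lifts to the line, so that an arc may wrap around the
    angle 0; half-open arcs are cut without overlap. *)
Definition arc a b : set (measurableTypeR R) := circle_arc `[a, b[%R.

Definition arc_mass a b : R := fine (mu (arc a b)).

Definition mass : R := fine (mu (circle_angles R)).

Lemma measurable_circle_angles : measurable (circle_angles R).
Proof. exact: measurable_itv. Qed.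

Lemma arcP a b t : arc a b t <->
  circle_angles R t /\ exists k : int, a <= t + k%:~R * (2 * pi) < b.
Proof.
split=> -[Ct [k tk]]; split => //; exists k.
  by move: tk; rewrite in_itv.
by rewrite in_itv.
Qed.

Lemma measurable_arc a b : measurable (arc a b).
Proof.
have -> : arc a b = circle_angles R `&` \bigcup_(k in @setT int)
    (`[a - k%:~R * (2 * pi), b - k%:~R * (2 * pi)[%classic : set (measurableTypeR R)).
  apply/seteqP; split => t.
    move=> /arcP[Ct [k tk]]; split => //; exists k => //=.
    by rewrite in_itv/= lerBlDr ltrBrDr.
  move=> [Ct [k _]] /=; rewrite in_itv/= lerBlDr ltrBrDr => tk.
  by apply/arcP; split => //; exists k.
apply: measurableI; first exact: measurable_circle_angles.
apply: countable_bigcupT_measurable; first exact: countableP.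
by move=> k; exact: measurable_itv.
Qed.

Lemma arc_mass_ge0 a b : 0 <= arc_mass a b.
Proof. by rewrite fine_ge0. Qed.

Lemma mass_ge0 : 0 <= mass.
Proof. by rewrite fine_ge0. Qed.

Lemma arc_massE a b : mu (arc a b) = (arc_mass a b)%:E.
Proof. by rewrite /arc_mass fineK// fin_num_measure//; exact: measurable_arc. Qed.

Lemma arc_mass_le a b : arc_mass a b <= mass.
Proof.
rewrite fine_le// ?fin_num_measure//; try exact: measurable_arc;
  try exact: measurable_circle_angles.
apply: le_measure; rewrite ?inE//; first exact: measurable_arc.
  exact: measurable_circle_angles.
by move=> t [].
Qed.

Lemma arc_disjoint a b c : c <= a + 2 * pi -> [disjoint arc a b & arc b c].
Proof.
move=> ca; apply/disj_setPS => t [/arcP[_ [k /andP[h1 h2]]] /arcP[_ [l /andP[h3 h4]]]].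
have hp := pi_gt0 R.
have kl : (k - l)%:~R = k%:~R - l%:~R :> R by rewrite rmorphB.
have [lk|kl'] := leP l k.
  have : (l%:~R : R) <= k%:~R by rewrite ler_int.
  by nra.
have : (k + 1)%:~R <= (l%:~R : R) by rewrite ler_int lezD1.
by rewrite rmorphD/= => ?; nra.
Qed.

Lemma arc_split a b c : a <= b -> b <= c -> arc a c = arc a b `|` arc b c.
Proof.
move=> ab bc; apply/seteqP; split => t.
  move=> /arcP[Ct [k /andP[h1 h2]]].
  have [h|h] := ltP (t + k%:~R * (2 * pi)) b.
    by left; apply/arcP; split => //; exists k; rewrite h1.
  by right; apply/arcP; split => //; exists k; rewrite h.
move=> [] /arcP[Ct [k /andP[h1 h2]]]; apply/arcP; split => //; exists k.
  by rewrite h1 (lt_le_trans h2).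
by rewrite h2 (le_trans ab).
Qed.

Lemma arc_massD a b c : a <= b -> b <= c -> c <= a + 2 * pi ->
  arc_mass a c = arc_mass a b + arc_mass b c.
Proof.
move=> ab bc ca; apply: EFin_inj; rewrite EFinD -!arc_massE (arc_split a b c)//.
rewrite measureU//; [exact: measurable_arc|exact: measurable_arc|].
exact/disj_set2P/arc_disjoint.
Qed.

Lemma arc_full a : arc a (a + 2 * pi) = circle_angles R.
Proof.
apply/seteqP; split => t; first by case.
move=> Ct; apply/arcP; split => //.
have hp : 0 < 2 * pi :> R by rewrite mulr_gt0// pi_gt0.
exists (- Num.floor ((t - a) / (2 * pi))).
set k := Num.floor _.
have k1 : k%:~R * (2 * pi) <= t - a by rewrite -ler_pdivlMr// ge_floor.
have k2 : t - a < (k + 1)%:~R * (2 * pi) by rewrite -ltr_pdivrMr// floorD1_gt.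
move: k2; rewrite rmorphD/= mulrDl mul1r rmorphN/= mulNr => k2.
by apply/andP; split; lra.
Qed.

End Arcs.

(** * Quadrature against a smooth measure *)

Section Chord.
Context {R : realType}.

(** If |g| is largest at m, then m is the midpoint of two grid points, one
    of which is 0 or N, where g vanishes. Hence 2 |g m| <= |g m| + e. *)
Lemma chord_bound (g : nat -> R) (N : nat) (e : R) :
  g 0%N = 0 -> g N = 0 ->
  (forall i d, (i + d + d <= N)%N -> `|g i + g (i + d + d)%N - 2 * g (i + d)%N| <= e) ->
  forall j, (j <= N)%N -> `|g j| <= e.
Proof.
move=> g0 gN gd.
have [m _ mmax] := @arg_maxP _ _ 'I_N.+1 ord0 xpredT (fun i : 'I_N.+1 => `|g i|) isT.
suff me : `|g m| <= e.
  move=> j jN; apply: le_trans me; exact: (mmax (Ordinal (jN : (j < N.+1)%N)) isT).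
have [mN|mN] := leqP (m + m) N.
  have := gd 0%N m; rewrite add0n => /(_ mN); rewrite g0 add0r => h.
  have h2 : `|g (m + m)%N| <= `|g m|.
    exact: (mmax (Ordinal (mN : (m + m < N.+1)%N)) isT).
  have : `|2 * g m| <= `|g (m + m)%N| + `|g (m + m)%N - 2 * g m|.
    rewrite -[X in `|X| <= _](subKr (g (m + m)%N)); exact: ler_normB.
  by rewrite normrM (@ger0_norm _ 2)//; lra.
have mN' : (m <= N)%N by rewrite -ltnS.
pose i := (m + m - N)%N; pose d := (N - m)%N.
have e1 : (i + d = m)%N by rewrite /i /d; lia.
have e2 : (i + d + d = N)%N by rewrite /i /d; lia.
have := gd i d; rewrite e2 e1 leqnn gN addr0 => /(_ isT) h.
have iN : (i <= N)%N by rewrite -e2 -addnA leq_addr.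
have h2 : `|g i| <= `|g m| by exact: (mmax (Ordinal (iN : (i < N.+1)%N)) isT).
have : `|2 * g m| <= `|g i| + `|g i - 2 * g m|.
  rewrite -[X in `|X| <= _](subKr (g i)); exact: ler_normB.
by rewrite normrM (@ger0_norm _ 2)//; lra.
Qed.

Lemma le_of_harmonic (x y B : R) :
  (forall n : nat, (0 < n)%N -> x <= y + B / n%:R) -> x <= y.
Proof.
move=> h; apply/ler_addgt0Pr => e e0.
pose n := (Num.trunc (`|B| / e)).+1.
have n0 : (0 < n)%N by [].
apply: (le_trans (h n n0)); rewrite lerD2l ler_pdivrMr ?ltr0n//.
rewrite mulrC -ler_pdivrMr// (le_trans _ (ltW (truncnS_gt _)))//.
by rewrite ler_pM2r ?invr_gt0// ler_norm.
Qed.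

Lemma sum_by_parts (k g : nat -> R) n :
  \sum_(j < n) k j * (g j.+1 - g j) =
  k n * g n - k 0%N * g 0%N - \sum_(j < n) (k j.+1 - k j) * g j.+1.
Proof.
elim: n => [|n IH]; first by rewrite !big_ord0 subrr subr0.
by rewrite !big_ord_recr/= IH; ring.
Qed.

End Chord.

Section Quadrature.
Context {R : realType}.
Variable mu : {finite_measure set (measurableTypeR R) -> \bar R}.
Local Notation m := (arc_mass mu).
Implicit Types (a L : R) (kap Psi : R -> R).

Definition periodic2pi kap := forall t (k : int), kap (t + k%:~R * (2 * pi)) = kap t.

Definition circle_kernel kap :=
  [/\ periodic2pi kap, continuous kap & exists B, forall t, `|kap t| <= B].

Lemma arc_mass_xx a : m a a = 0.
Proof.
have := @arc_massD _ mu a a a (lexx a) (lexx a).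
have : a <= a + 2 * pi by rewrite lerDl mulr_ge0// pi_ge0.
by move=> h /(_ h); lra.
Qed.

Lemma Rintegral_arcD kap a b c : circle_kernel kap ->
  a <= b -> b <= c -> c <= a + 2 * pi ->
  \int[mu]_(t in arc a c) kap t =
  \int[mu]_(t in arc a b) kap t + \int[mu]_(t in arc b c) kap t.
Proof.
move=> [_ kc [B kB]] ab bc ca; rewrite (arc_split _ _ _ ab bc) Rintegral_setU//.
- exact: measurable_arc.
- exact: measurable_arc.
- apply: (@integrable_bounded_continuous _ _ _ _ B) => //.
  by apply: measurableU; exact: measurable_arc.
- exact: arc_disjoint.
Qed.

Lemma Rintegral_arc_point kap a b (c e : R) : circle_kernel kap ->
  (forall t, a <= t < b -> `|kap t - c| <= e) ->
  `|\int[mu]_(t in arc a b) kap t - c * m a b| <= e * m a b.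
Proof.
move=> [kp kc [B kB]] ke.
have mA := @measurable_arc R a b.
rewrite -Rintegral_cst// -RintegralB//; last 2 first.
- exact: (@integrable_bounded_continuous _ _ _ _ B).
- apply: (@integrable_bounded_continuous _ _ _ _ `|c|) => // t.
  exact: cst_continuous.
apply: norm_Rintegral_le => //.
- by move=> t; apply: cvgB; [exact: kc|exact: cvg_cst].
- exists (B + `|c|) => t; rewrite (le_trans (ler_normB _ _))// lerD2r//.
- by move=> t /arcP[_ [k tk]]; rewrite -(kp t k); exact: ke.
Qed.

(** The distribution function of mu on the interval stays within e of its
    chord, by [chord_bound] on a fine grid. Summation by parts moves this
    difference onto the increments of the kernel, whose total is at most
    Lam * L; the chord contributes the mean density times the integral of the
    kernel, that is, the variation of Psi. *)
Lemma smooth_quadrature kap Psi a L (Lam e : R) : circle_kernel kap ->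
  0 < L -> L <= 2 * pi -> 0 <= Lam -> 
  (forall s t, a <= s <= a + L -> a <= t <= a + L ->
     `|kap t - kap s| <= Lam * `|t - s|) ->
  (forall s t, a <= s <= a + L -> a <= t <= a + L ->
     `|Psi t - Psi s - kap s * (t - s)| <= Lam * (t - s) ^+ 2) ->
  (forall s d, a <= s -> 0 < d -> s + d + d <= a + L ->
     `|m s (s + d) - m (s + d) (s + d + d)| <= e) ->
  `|\int[mu]_(t in arc a (a + L)) kap t - m a (a + L) / L * (Psi (a + L) - Psi a)|
    <= Lam * L * e.
Proof.
move=> ck L0 L2pi Lam0 kLip kPsi smooth.
set M := m a (a + L).
have M0 : 0 <= M by exact: arc_mass_ge0.
apply: (@le_of_harmonic _ _ _ (2 * Lam * M * L)) => N N0.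
pose h := L / N%:R.
have N0R : 0 < N%:R :> R by rewrite ltr0n.
have h0 : 0 < h by rewrite divr_gt0.
have hN : N%:R * h = L by rewrite /h mulrCA divff ?mulr1// gt_eqF.
pose t (j : nat) := a + j%:R * h.
have t0 : t 0%N = a by rewrite /t mul0r addr0.
have tN : t N = a + L by rewrite /t hN.
have tS j : t j.+1 = t j + h by rewrite /t -natr1 mulrDl mul1r addrA.
have dt j : t j.+1 - t j = h by rewrite tS addrC addKr.
have tle i j : (i <= j)%N -> t i <= t j.
  by move=> ij; rewrite /t lerD2l ler_pM2r// ler_nat.
have tin j : (j <= N)%N -> a <= t j <= a + L.
  by move=> jN; rewrite -{1}t0 -tN !tle.
have tpi j : (j <= N)%N -> t j <= a + 2 * pi.
  by move=> /tin/andP[_ h1]; rewrite (le_trans h1)// lerD2l.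
pose F j := m a (t j).
have mF i j : (i <= j)%N -> (j <= N)%N -> m (t i) (t j) = F j - F i.
  move=> ij jN; rewrite /F (@arc_massD _ mu a (t i) (t j)) ?tle ?tpi//.
    by rewrite addrAC subrr add0r.
  by have /andP[] := tin _ (leq_trans ij jN).
(* The distribution function on the grid, minus its chord. *)
pose g j := F j - j%:R / N%:R * M.
have F0 : F 0%N = 0 by rewrite /F t0 arc_mass_xx.
have FN : F N = M by rewrite /F tN.
have g0 : g 0%N = 0 by rewrite /g F0 !mul0r subrr.
have gN : g N = 0 by rewrite /g FN divff ?gt_eqF// mul1r subrr.
have ge j : (j <= N)%N -> `|g j| <= e.
  apply: chord_bound => // i d idN.
  have [->|d0] := posnP d.
    rewrite !addn0.
    have -> : g i + g i - 2 * g i = 0 by ring.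
    rewrite normr0; apply: le_trans (smooth a (L / 2) _ _ _) => //.
    - by rewrite divr_gt0.
    - by rewrite -addrA -splitr.
  have iN : (i + d <= N)%N by rewrite (leq_trans _ idN)// leq_addr.
  have ad k : t (k + d)%N = t k + d%:R * h by rewrite /t natrD mulrDl addrA.
  have := smooth (t i) (d%:R * h); rewrite -!ad.
  have /andP[-> _] := tin i (leq_trans (leq_addr d i) iN).
  have /andP[_ ->] := tin _ idN.
  rewrite mulr_gt0 ?ltr0n// => /(_ isT isT isT).
  rewrite !mF ?leq_addr// distrC.
  congr (`|_| <= _); rewrite /g !natrD.
  by ring.
have step : forall n, (n <= N)%N ->
  `|\int[mu]_(x in arc a (t n)) kap x - \sum_(j < n) kap (t j) * (F j.+1 - F j)|
     <= Lam * h * F n.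
  elim=> [_|n IH nN].
    rewrite big_ord0 subr0 F0 mulr0 t0.
    have := @Rintegral_arc_point kap a a 0 `|kap a| ck.
    rewrite arc_mass_xx mul0r subr0 mulr0; apply => x /andP[h1 h2].
    by have := le_lt_trans h1 h2; rewrite ltxx.
  rewrite big_ord_recr/= (@Rintegral_arcD kap a (t n) (t n.+1))//; last first.
  - exact: tpi.
  - exact: tle.
  - by have /andP[] := tin n (ltnW nN).
  have := @Rintegral_arc_point kap (t n) (t n.+1) (kap (t n)) (Lam * h) ck.
  rewrite mF// => hn.
  have {}hn := hn _; have {}IH := IH (ltnW nN).
  have -> : Lam * h * F n.+1 = Lam * h * F n + Lam * h * (F n.+1 - F n) by ring.
  rewrite opprD addrACA (le_trans (ler_normD _ _))// lerD// hn// => x /andP[x1 x2].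
  apply: (le_trans (kLip _ _ _ _)).
  - exact: tin (ltnW nN).
  - have /andP[b1 _] := tin _ (ltnW nN); have /andP[_ b2] := tin _ nN.
    by rewrite (le_trans b1 x1) (le_trans (ltW x2) b2).
  - by rewrite ler_wpM2l// ger0_norm ?subr_ge0// lerBlDr addrC -tS ltW.
have {}step := step N (leqnn N); rewrite FN tN in step.
have S1 : `|\sum_(j < N) kap (t j) * (g j.+1 - g j)| <= Lam * L * e.
  rewrite (sum_by_parts (fun j => kap (t j))) g0 gN !mulr0 subrr sub0r normrN.
  apply: (le_trans (ler_norm_sum _ _ _)).
  apply: (@le_trans _ _ (\sum_(j < N) Lam * h * e)).
    apply: ler_sum => j _; rewrite normrM; apply: ler_pM => //; last exact: ge.
    have := kLip (t j) (t j.+1) (tin _ (ltnW (ltn_ord j))) (tin _ (ltn_ord j)).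
    by rewrite dt (ger0_norm (ltW h0)).
  rewrite sumr_const card_ord -mulr_natl mulrA; rewrite le_eqVlt; apply/orP; left; apply/eqP.
  by rewrite -hN; ring.
have S2 : `|\sum_(j < N) kap (t j) * h - (Psi (a + L) - Psi a)| <= Lam * L * h.
  have -> : Psi (a + L) - Psi a = \sum_(j < N) (Psi (t j.+1) - Psi (t j)).
    by rewrite -(big_mkord xpredT (fun j => Psi (t j.+1) - Psi (t j))) telescope_sumr// t0 tN.
  rewrite -sumrB; apply: (le_trans (ler_norm_sum _ _ _)).
  apply: (@le_trans _ _ (\sum_(j < N) Lam * h ^+ 2)).
    apply: ler_sum => j _; rewrite distrC.
    have := kPsi (t j) (t j.+1) (tin _ (ltnW (ltn_ord j))) (tin _ (ltn_ord j)).
    by rewrite dt.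
  rewrite sumr_const card_ord -mulr_natl; rewrite le_eqVlt; apply/orP; left; apply/eqP.
  by rewrite -hN; ring.
have S3 : \sum_(j < N) kap (t j) * (F j.+1 - F j) =
   \sum_(j < N) kap (t j) * (g j.+1 - g j) + M / L * \sum_(j < N) kap (t j) * h.
  rewrite big_distrr/= -big_split/=; apply: eq_bigr => j _.
  rewrite /g -natr1 /h; field.
  by rewrite !gt_eqF.
set I := (\int[mu]_(x in _) _) in step *.
set A := (\sum_(j < N) _) in step S3.
set P := Psi (a + L) - Psi a in S2 *.
set B := (\sum_(j < N) _) in S1 S3.
set C := (\sum_(j < N) _) in S2 S3.
have ML : `|M / L * (C - P)| <= M * Lam * h.
  rewrite normrM ger0_norm ?divr_ge0 ?(ltW L0)//.
  have := S2; rewrite -(ler_pM2l (_ : 0 < L^-1)) ?invr_gt0// => hh.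
  have -> : M / L * `|C - P| = M * (L^-1 * `|C - P|) by ring.
  rewrite -mulrA ler_wpM2l// (le_trans hh)// le_eqVlt; apply/orP; left; apply/eqP.
  by field; rewrite gt_eqF.
have -> : I - M / L * P = (I - A) + B + M / L * (C - P) by rewrite S3; ring.
have -> : 2 * Lam * M * L / N%:R = Lam * h * M + M * Lam * h.
  by rewrite /h; field; rewrite gt_eqF.
apply: (le_trans (ler_normD _ _)); rewrite addrA; apply: lerD => //.
by apply: (le_trans (ler_normD _ _)); rewrite addrC; exact: lerD.
Qed.

End Quadrature.

(** * Multiscale kernel estimates *)

Section Scales.
Context {R : realType}.

Definition half_width (k : nat) : R := pi / 2 ^+ k.

Lemma half_width_gt0 k : 0 < half_width k.
Proof. by rewrite divr_gt0 ?pi_gt0// exprn_gt0. Qed.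

Lemma half_widthS k : half_width k = 2 * half_width k.+1.
Proof.
rewrite /half_width exprS; field.
by rewrite expf_neq0//.
Qed.

Lemma half_width_le k n : (k <= n)%N -> half_width n <= half_width k.
Proof.
move=> kn; rewrite /half_width ler_pM2l ?pi_gt0// lef_pV2 ?posrE ?exprn_gt0//.
by rewrite ler_weXn2l// ler1n.
Qed.

Lemma half_width_le_pi k : half_width k <= pi.
Proof. by have := half_width_le 0 k (leq0n k); rewrite /half_width expr0 divr1. Qed.

Lemma pi_lt4 : pi < 4 :> R.
Proof. by have /andP[_] := @pihalf_02 R; lra. Qed.

End Scales.

Section DyadicSmoothness.
Context {R : realType}.
Variable mu : {finite_measure set (measurableTypeR R) -> \bar R}.
Local Notation m := (arc_mass mu).
Local Notation l := (@half_width R).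

(** Smoothness read at the scales 2^-n. As l 0 = pi, level 0 allows any two
    adjacent arcs of equal length that do not overlap. *)
Definition dyadic_smooth (a : nat -> R) (C : R) :=
  forall n x s, 0 < s -> s <= l n -> `|m x (x + s) - m (x + s) (x + s + s)| <= C * a n / 2 ^+ n.

(** With b = 2^(beta - 1), what the growth condition on phi says of
    a n = phi(2^-n): the 2^k a k grow geometrically, so that their sum is
    controlled by the last one. *)
Definition slow_growth (a : nat -> R) (D b : R) :=
  forall k n, (k <= n)%N -> a k * 2 ^+ k <= D * b ^+ (n - k) * (2 ^+ n * a n).

(** The points at distance comparable to 2^-k from x, except at the last
    level, where the whole central arc is taken. *)
Definition in_shell (x : R) (n k : nat) (s : R) :=
  `|s - x| <= l k /\ (k = n \/ l k.+1 <= `|s - x|).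

Lemma in_shell_central x n s : x - l n <= s <= x + l n -> in_shell x n n s.
Proof.
by move=> /andP[s1 s2]; split; [rewrite ler_norml; apply/andP; split; lra|left].
Qed.

Lemma in_shell_right x n k s : x + l k.+1 <= s <= x + l k -> in_shell x n k s.
Proof.
have l0 := half_width_gt0 (R := R) k.+1.
by move=> /andP[s1 s2]; split; last right; rewrite ger0_norm; lra.
Qed.

Lemma in_shell_left x n k s : x - l k <= s <= x - l k.+1 -> in_shell x n k s.
Proof.
have l0 := half_width_gt0 (R := R) k.+1.
by move=> /andP[s1 s2]; split; last right; rewrite ler0_norm; lra.
Qed.

Lemma Rintegral_shells kap x k : circle_kernel kap ->
  \int[mu]_(t in arc (x - l k) (x + l k)) kap t =
  \int[mu]_(t in arc (x - l k) (x - l k.+1)) kap t +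
  \int[mu]_(t in arc (x - l k.+1) (x + l k.+1)) kap t +
  \int[mu]_(t in arc (x + l k.+1) (x + l k)) kap t.
Proof.
move=> ck; have l0 := half_width_gt0 (R := R) k.+1.
have lk := half_widthS (R := R) k; have lkpi := half_width_le_pi (R := R) k.
rewrite (Rintegral_arcD _ _ (x - l k) (x + l k.+1) (x + l k) ck); try lra.
by rewrite (Rintegral_arcD _ _ (x - l k) (x - l k.+1) (x + l k.+1) ck)//; lra.
Qed.

Variables (a : nat -> R) (C : R).
Hypothesis a_gt0 : forall n, 0 < a n.
Hypothesis C_gt0 : 0 < C.
Hypothesis smooth : dyadic_smooth a C.

Lemma sum_geometric_le (b : R) n : 0 < b -> b < 1 -> \sum_(i < n) b ^+ i <= (1 - b)^-1.
Proof.
move=> b0 b1; have h : (\sum_(i < n) b ^+ i) * (1 - b) = 1 - b ^+ n.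
  elim: n => [|n IH]; first by rewrite big_ord0 mul0r expr0 subrr.
  by rewrite big_ord_recr/= mulrDl IH exprS; ring.
rewrite -(ler_pM2r (_ : 0 < 1 - b)) ?subr_gt0// h mulVf; last by rewrite gt_eqF ?subr_gt0.
by rewrite gerBl exprn_ge0// ltW.
Qed.

(** Consecutive quarters of a centred arc are adjacent arcs of equal length,
    so smoothness compares their masses. *)
Lemma quarter_masses x k :
  let l1 := l k.+1 in let w := C * a k / 2 ^+ k in
  [/\ `|m (x - l k) (x - l1) - m (x - l1) x| <= w,
      `|m (x - l1) x - m x (x + l1)| <= w,
      `|m x (x + l1) - m (x + l1) (x + l k)| <= w &
      [/\ m (x - l1) (x + l1) = m (x - l1) x + m x (x + l1) &
      m (x - l k) (x + l k) = m (x - l k) (x - l1) + m (x - l1) x + m x (x + l1) + m (x + l1) (x + l k)]].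
Proof.
move=> l1 w; have lk : l k = 2 * l1 by exact: half_widthS.
have l10 : 0 < l1 by exact: half_width_gt0.
have l1k : l1 <= l k by rewrite lk; lra.
have lpi := half_width_le_pi (R := R) k.
have := smooth k (x - l k) l1 l10 l1k.
have -> : x - l k + l1 = x - l1 by rewrite lk; ring.
have -> : x - l1 + l1 = x by ring.
move=> h1.
have := smooth k (x - l1) l1 l10 l1k.
have -> : x - l1 + l1 = x by ring.
move=> h2.
have := smooth k x l1 l10 l1k.
have -> : x + l1 + l1 = x + l k by rewrite lk; ring.
move=> h3; split => //.
have D := @arc_massD _ mu; split.
  by apply: D; lra.
rewrite (D (x - l k) (x + l1) (x + l k)); try lra.
rewrite (D (x - l k) x (x + l1)); try lra.
by rewrite (D (x - l k) (x - l1) x); lra.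
Qed.

Section KernelEstimate.
Variables (D b : R).
Hypothesis D_gt0 : 0 < D.
Hypothesis b_gt0 : 0 < b.
Hypothesis b_lt1 : b < 1.
Hypothesis growth : slow_growth a D b.

(** On the centred arc of half width l k, the integral of kap is compared
    with the mean density times the variation of Psi. Going from k.+1 to k adds
    a shell on each side and costs a multiple of B * C * a k * 2 ^+ k, by
    [smooth_quadrature] and [quarter_masses]. On the full circle the variation
    of Psi is zero, and [slow_growth] sums the costs. *)
Lemma oscillating_kernel_le (x : R) n (kap Psi : R -> R) (B : R) : 0 < B ->
  circle_kernel kap -> Psi (x + pi) = Psi (x - pi) ->
  (forall k s t, (k <= n)%N -> in_shell x n k s -> in_shell x n k t ->
    `|kap t - kap s| <= B * 8 ^+ k * `|t - s| /\
    `|Psi t - Psi s - kap s * (t - s)| <= B * 8 ^+ k * (t - s) ^+ 2) ->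
  (forall k, (k <= n)%N -> `|Psi (x + l k)| <= B * 2 ^+ k /\ `|Psi (x - l k)| <= B * 2 ^+ k) ->
  `|\int[mu]_(t in circle_angles R) kap t| <= 15 * C * D / (1 - b) * (B * (2 ^+ n * a n)).
Proof.
move=> B0 ck Psipi shell ends.
pose sig k := m (x - l k) (x + l k) / (2 * l k).
(* E k is the error of the comparison at level k. *)
pose E k := \int[mu]_(t in arc (x - l k) (x + l k)) kap t - sig k * (Psi (x + l k) - Psi (x - l k)).
have base : `|E n| <= 15 * C * B * (a n * 2 ^+ n).
  have ln0 := half_width_gt0 (R := R) n; have lnpi := half_width_le_pi (R := R) n.
  have := @smooth_quadrature _ mu kap Psi (x - l n) (2 * l n) (B * 8 ^+ n) (C * a n / 2 ^+ n) ck.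
  have -> : x - l n + 2 * l n = x + l n by ring.
  move=> h; apply: (le_trans (h _ _ _ _ _ _)).
  - by rewrite mulr_gt0.
  - by rewrite ler_pM2l.
  - by rewrite mulr_ge0 ?exprn_ge0// ltW.
  - move=> s t sin tin.
    by have [] := shell n s t (leqnn n) (in_shell_central _ _ _ sin) (in_shell_central _ _ _ tin).
  - move=> s t sin tin.
    by have [] := shell n s t (leqnn n) (in_shell_central _ _ _ sin) (in_shell_central _ _ _ tin).
  - by move=> s d s1 d0 s2; apply: smooth => //; lra.
  have -> : B * 8 ^+ n * (2 * l n) * (C * a n / 2 ^+ n) = (2 * pi) * (C * B * (a n * 2 ^+ n)).
    rewrite /half_width (_ : 8 = 2 * 2 * 2); last by ring.
    by rewrite !exprMn; move: (pi : R) => P; field; rewrite expf_neq0.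
  have -> : 15 * C * B * (a n * 2 ^+ n) = 15 * (C * B * (a n * 2 ^+ n)) by ring.
  rewrite ler_pM2r; first by have := pi_lt4 (R := R); lra.
  by rewrite !mulr_gt0// exprn_gt0.
have step k : (k < n)%N -> `|E k| <= `|E k.+1| + 15 * C * B * (a k * 2 ^+ k).
  move=> kn; set l1 := l k.+1; pose w := C * a k / 2 ^+ k.
  have lk : l k = 2 * l1 by exact: half_widthS.
  have l10 : 0 < l1 by exact: half_width_gt0.
  have lkpi := half_width_le_pi (R := R) k.
  have [q1 q2 q3 [q4 q5]] := quarter_masses x k.
  rewrite -/l1 -/w in q1 q2 q3 q4 q5.
  have w0 : 0 < w by rewrite divr_gt0 ?exprn_gt0// mulr_gt0.
  pose Lam := B * 8 ^+ k.
  have Lam0 : 0 <= Lam by rewrite mulr_ge0 ?exprn_ge0// ltW.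
  have quadR : `|\int[mu]_(t in arc (x + l1) (x + l k)) kap t -
      m (x + l1) (x + l k) / l1 * (Psi (x + l k) - Psi (x + l1))| <= Lam * l1 * w.
    have := @smooth_quadrature _ mu kap Psi (x + l1) l1 Lam w ck.
    have -> : x + l1 + l1 = x + l k by rewrite lk; ring.
    apply => //; first by lra.
    - move=> s t sin tin.
      by have [] := shell k s t (ltnW kn) (in_shell_right _ _ _ _ sin) (in_shell_right _ _ _ _ tin).
    - move=> s t sin tin.
      by have [] := shell k s t (ltnW kn) (in_shell_right _ _ _ _ sin) (in_shell_right _ _ _ _ tin).
    - by move=> s d s1 d0 s2; apply: smooth => //; lra.
  have quadL : `|\int[mu]_(t in arc (x - l k) (x - l1)) kap t -
      m (x - l k) (x - l1) / l1 * (Psi (x - l1) - Psi (x - l k))| <= Lam * l1 * w.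
    have := @smooth_quadrature _ mu kap Psi (x - l k) l1 Lam w ck.
    have -> : x - l k + l1 = x - l1 by rewrite lk; ring.
    apply => //; first by lra.
    - move=> s t sin tin.
      by have [] := shell k s t (ltnW kn) (in_shell_left _ _ _ _ sin) (in_shell_left _ _ _ _ tin).
    - move=> s t sin tin.
      by have [] := shell k s t (ltnW kn) (in_shell_left _ _ _ _ sin) (in_shell_left _ _ _ _ tin).
    - by move=> s d s1 d0 s2; apply: smooth => //; lra.
  have [P1 P2] := ends k (ltnW kn); have [P3 P4] := ends k.+1 kn.
  rewrite -/l1 exprS in P3 P4.
  set beta := B * 2 ^+ k in P1 P2.
  have {}P3 : `|Psi (x + l1)| <= 2 * beta by rewrite (le_trans P3)// /beta mulrCA.
  have {}P4 : `|Psi (x - l1)| <= 2 * beta by rewrite (le_trans P4)// /beta mulrCA.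
  have beta0 : 0 < beta by rewrite mulr_gt0// exprn_gt0.
  pose lf := m (x - l k) (x - l1); pose lh := m (x - l1) x.
  pose rh := m x (x + l1); pose r := m (x + l1) (x + l k).
  rewrite -/lf -/lh -/rh -/r in q1 q2 q3 q4 q5 quadR quadL.
  have sk : sig k = (lf + lh + rh + r) / (4 * l1).
    by rewrite /sig q5 lk mulrA; congr (_ / (_ * _)); ring.
  have sk1 : sig k.+1 = (lh + rh) / (2 * l1) by rewrite /sig -/l1 q4.
  have D1 : `|(r / l1 - sig k) * (Psi (x + l k) - Psi (x + l1))| <= w / l1 * (9 / 2 * beta).
    have -> : w / l1 * (9 / 2 * beta) = (w / l1 * (3 / 2)) * (3 * beta) by field; rewrite gt_eqF.
    rewrite normrM; apply: ler_pM => //; last first.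
      by rewrite (le_trans (ler_normB _ _))//; lra.
    have -> : r / l1 - sig k = (3 * r - lf - lh - rh) / 4 / l1.
      by rewrite sk; field; rewrite gt_eqF.
    rewrite normrM [`|l1^-1|]gtr0_norm ?invr_gt0// mulrAC ler_pM2r ?invr_gt0//.
    by move: q1 q2 q3; rewrite !ler_norml; lra.
  have D2 : `|(lf / l1 - sig k) * (Psi (x - l1) - Psi (x - l k))| <= w / l1 * (9 / 2 * beta).
    have -> : w / l1 * (9 / 2 * beta) = (w / l1 * (3 / 2)) * (3 * beta) by field; rewrite gt_eqF.
    rewrite normrM; apply: ler_pM => //; last first.
      by rewrite (le_trans (ler_normB _ _))//; lra.
    have -> : lf / l1 - sig k = (3 * lf - r - lh - rh) / 4 / l1.
      by rewrite sk; field; rewrite gt_eqF.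
    rewrite normrM [`|l1^-1|]gtr0_norm ?invr_gt0// mulrAC ler_pM2r ?invr_gt0//.
    by move: q1 q2 q3; rewrite !ler_norml; lra.
  have D3 : `|(sig k.+1 - sig k) * (Psi (x + l1) - Psi (x - l1))| <= w / l1 * (2 * beta).
    have -> : w / l1 * (2 * beta) = (w / l1 * (1 / 2)) * (4 * beta) by field; rewrite gt_eqF.
    rewrite normrM; apply: ler_pM => //; last first.
      by rewrite (le_trans (ler_normB _ _))//; lra.
    have -> : sig k.+1 - sig k = (lh + rh - lf - r) / 4 / l1.
      by rewrite sk sk1; field; rewrite gt_eqF.
    rewrite normrM [`|l1^-1|]gtr0_norm ?invr_gt0// mulrAC ler_pM2r ?invr_gt0//.
    by move: q1 q2 q3; rewrite !ler_norml; lra.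
  have wl : w / l1 <= C * a k.
    have -> : w / l1 = 2 / pi * (C * a k).
      have pn : pi != 0 :> R by rewrite gt_eqF ?pi_gt0.
      rewrite /w /l1 /half_width exprS; move: (pi : R) pn => P pn; field.
      by rewrite pn expf_neq0.
    rewrite ler_piMl//; first by rewrite mulr_ge0// ltW.
    by rewrite ler_pdivrMr ?pi_gt0// mul1r pi_ge2.
  have quadE : Lam * l1 * w <= 2 * (C * a k * beta).
    have -> : Lam * l1 * w = pi / 2 * (C * a k * beta).
      rewrite /Lam /l1 /w /beta /half_width exprS (_ : 8 = 2 * 2 * 2); last by ring.
      by rewrite !exprMn; move: (pi : R) => P; field; rewrite expf_neq0.
    rewrite ler_pM2r; first by have := pi_lt4 (R := R); lra.
    by rewrite !mulr_gt0.
  have -> : E k = (\int[mu]_(t in arc (x + l1) (x + l k)) kap t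
        - r / l1 * (Psi (x + l k) - Psi (x + l1)))
      + (\int[mu]_(t in arc (x - l k) (x - l1)) kap t
        - lf / l1 * (Psi (x - l1) - Psi (x - l k)))
      + ((r / l1 - sig k) * (Psi (x + l k) - Psi (x + l1))
      + (lf / l1 - sig k) * (Psi (x - l1) - Psi (x - l k))
      + (sig k.+1 - sig k) * (Psi (x + l1) - Psi (x - l1)))
      + E k.+1.
    by rewrite /E (Rintegral_shells _ _ _ ck) -/l1; ring.
  have wb : w / l1 * beta <= C * a k * beta by rewrite ler_pM2r.
  have -> : 15 * C * B * (a k * 2 ^+ k) = 15 * (C * a k * beta) by rewrite /beta; ring.
  move: quadR quadL D1 D2 D3.
  set t1 := _ - r / l1 * _; set t2 := _ - lf / l1 * _; set t3 := (r / l1 - _) * _.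
  set t4 := (lf / l1 - _) * _; set t5 := (sig k.+1 - _) * _ => *.
  rewrite (le_trans (ler_normD _ _))// addrC lerD2l.
  rewrite (le_trans (ler_normD _ _))// (le_trans (lerD (ler_normD _ _) (ler_normD _ _)))//.
  have := ler_normD t3 t4; lra.
have total d : (d <= n)%N -> `|E (n - d)%N| <= 15 * C * B * \sum_(i < d.+1) (a (n - i)%N * 2 ^+ (n - i)).
  elim: d => [_|d IH dn]; first by rewrite big_ord_recr big_ord0/= add0r subn0.
  rewrite big_ord_recr/= mulrDr.
  have e1 : (n - d.+1).+1 = (n - d)%N by lia.
  have := step (n - d.+1)%N; rewrite e1 => h; apply: (le_trans (h _)); first by lia.
  by rewrite lerD2r IH// ltnW.
have := total n (leqnn n); rewrite subnn.
have -> : E 0%N = \int[mu]_(t in circle_angles R) kap t.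
  rewrite /E /half_width expr0 divr1 Psipi subrr mulr0 subr0.
  have -> : x + pi = x - pi + 2 * pi by ring.
  by rewrite arc_full.
move=> h; apply: (le_trans h).
have -> : 15 * C * D / (1 - b) * (B * (2 ^+ n * a n)) = 15 * C * B * (D * (1 - b)^-1 * (2 ^+ n * a n)).
  by field; rewrite gt_eqF ?subr_gt0.
rewrite ler_pM2l ?mulr_gt0//.
apply: (@le_trans _ _ (\sum_(i < n.+1) D * b ^+ i * (2 ^+ n * a n))).
  apply: ler_sum => i _; have ni : (n - i <= n)%N by rewrite leq_subr.
  by have := growth _ _ ni; rewrite subKn// -ltnS.
rewrite -big_distrl/= -big_distrr/= ler_pM2r ?mulr_gt0 ?exprn_gt0//.
by rewrite ler_pM2l// sum_geometric_le.
Qed.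

End KernelEstimate.

Hypothesis a_le0 : forall n, a n <= a 0%N.

(** The integral over the shell of level k is at most B * 4 ^+ k / 2 ^+ n
    times the mass of the centred arc of level k. The densities of consecutive
    centred arcs differ by at most 2 * C * a k, so level k contributes 2^(k - n)
    times the sum of the density at level n and a term linear in n - k. *)
Lemma positive_kernel_le (x : R) n (kap : R -> R) (B : R) : 0 < B ->
  circle_kernel kap -> (forall t, 0 <= kap t) ->
  (forall k s, (k <= n)%N -> in_shell x n k s -> kap s <= B * 4 ^+ k / 2 ^+ n) ->
  \int[mu]_(t in circle_angles R) kap t <=
    2 * B * (2 ^+ n * m (x - l n) (x + l n)) + 4 * B * C * a 0%N.
Proof.
move=> B0 ck k0 shell.
have bound c d (e : R) : (forall t, c <= t < d -> kap t <= e) ->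
    \int[mu]_(t in arc c d) kap t <= e * m c d.
  move=> h; have := @Rintegral_arc_point _ mu kap c d 0 e ck.
  rewrite mul0r subr0 => h2; apply: le_trans (ler_norm _) (h2 _) => t tcd.
  by rewrite subr0 ger0_norm// h.
pose Y k := 2 ^+ k * m (x - l k) (x + l k).
have YS k : Y k <= Y k.+1 + 2 * C * a 0%N.
  have [q1 q2 q3 [q4 q5]] := quarter_masses x k.
  rewrite /Y q4 q5 exprS.
  set w := C * a k / 2 ^+ k in q1 q2 q3 *.
  have e : 2 ^+ k * w = C * a k by rewrite /w; field; rewrite expf_neq0.
  have wa : C * a k <= C * a 0%N by rewrite ler_pM2l.
  have p0 : 0 < 2 ^+ k :> R by rewrite exprn_gt0.
  set lh := m _ x; set rh := m x _.
  apply: (@le_trans _ _ (2 * 2 ^+ k * (lh + rh) + 2 ^+ k * (2 * w))); last first.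
    by rewrite lerD2l mulrCA e; lra.
  have -> : 2 * 2 ^+ k * (lh + rh) + 2 ^+ k * (2 * w) = 2 ^+ k * (2 * (lh + rh) + 2 * w) by ring.
  rewrite ler_pM2l//.
  by move: q1 q2 q3; rewrite -/lh -/rh !ler_norml; lra.
have Yd d : (d <= n)%N -> Y (n - d)%N <= Y n + d%:R * (2 * C * a 0%N).
  elim: d => [_|d IH dn]; first by rewrite subn0 mul0r addr0.
  have e1 : (n - d.+1).+1 = (n - d)%N by lia.
  have := YS (n - d.+1)%N; rewrite e1 => h; apply: (le_trans h).
  have -> : Y n + d.+1%:R * (2 * C * a 0%N) = Y n + d%:R * (2 * C * a 0%N) + 2 * C * a 0%N.
    by rewrite -(natr1 d); ring.
  by rewrite lerD2r IH// ltnW.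
pose q d : R := (2 ^+ d)^-1.
have q0 d : 0 < q d by rewrite invr_gt0 exprn_gt0.
have qS d : q d = 2 * q d.+1 by rewrite /q exprS; field; rewrite expf_neq0.
have shellY k : (k <= n)%N ->
    B * 4 ^+ k / 2 ^+ n * m (x - l k) (x + l k) = B * q (n - k)%N * Y k.
  move=> kn; rewrite /q /Y -{1}(subnK kn) exprD (_ : 4 = 2 * 2); last by ring.
  by rewrite exprMn; field; rewrite !expf_neq0.
(* The coefficients are the partial sums of 2^-i and of i 2^-i. *)
have total d : (d <= n)%N -> \int[mu]_(t in arc (x - l (n - d)%N) (x + l (n - d)%N)) kap t
   <= B * ((2 - q d) * Y n + 2 * C * a 0%N * (2 - (d%:R + 2) * q d)).
  elim: d => [_|d IH dn].
    rewrite subn0 /q expr0 invr1 mulr1 add0r subrr mulr0 addr0.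
    have -> : (2 - 1) * Y n = Y n by ring.
    apply: (@le_trans _ _ (B * 4 ^+ n / 2 ^+ n * m (x - l n) (x + l n))).
      apply: bound => t /andP[t1 t2]; apply: shell => //.
      by apply: in_shell_central; rewrite t1 ltW.
    by rewrite shellY// subnn /q expr0 invr1 mulr1.
  have {}IH := IH (ltnW dn).
  set k := (n - d.+1)%N.
  have e1 : (n - d)%N = k.+1 by rewrite /k; lia.
  have kn : (k < n)%N by rewrite /k; lia.
  rewrite e1 in IH.
  have lk := half_widthS (R := R) k; have l10 := half_width_gt0 (R := R) k.+1.
  have lkpi := half_width_le_pi (R := R) k.
  rewrite (Rintegral_shells _ _ _ ck).
  have bR : \int[mu]_(t in arc (x + l k.+1) (x + l k)) kap t <=
     B * 4 ^+ k / 2 ^+ n * m (x + l k.+1) (x + l k).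
    apply: bound => t /andP[t1 t2]; apply: shell; first exact: ltnW.
    by apply: in_shell_right; rewrite t1 ltW.
  have bL : \int[mu]_(t in arc (x - l k) (x - l k.+1)) kap t <=
     B * 4 ^+ k / 2 ^+ n * m (x - l k) (x - l k.+1).
    apply: bound => t /andP[t1 t2]; apply: shell; first exact: ltnW.
    by apply: in_shell_left; rewrite t1 ltW.
  have bb : B * 4 ^+ k / 2 ^+ n * m (x - l k) (x - l k.+1) +
      B * 4 ^+ k / 2 ^+ n * m (x + l k.+1) (x + l k) <= B * q d.+1 * Y k.
    have -> : d.+1 = (n - k)%N by rewrite /k; lia.
    rewrite -shellY ?(ltnW kn)// -mulrDr ler_wpM2l//.
      by rewrite divr_ge0 ?exprn_ge0// mulr_ge0 ?exprn_ge0// ltW.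
    have [_ _ _ [_ ->]] := quarter_masses x k.
    by have := arc_mass_ge0 mu (x - l k.+1) x; have := arc_mass_ge0 mu x (x + l k.+1); lra.
  have yk : B * q d.+1 * Y k <= B * q d.+1 * (Y n + d.+1%:R * (2 * C * a 0%N)).
    by rewrite ler_pM2l ?mulr_gt0// Yd.
  have -> : B * ((2 - q d.+1) * Y n + 2 * C * a 0%N * (2 - (d.+1%:R + 2) * q d.+1)) =
    B * ((2 - q d) * Y n + 2 * C * a 0%N * (2 - (d%:R + 2) * q d)) +
    B * q d.+1 * (Y n + d.+1%:R * (2 * C * a 0%N)).
    by rewrite (qS d) -(natr1 d); ring.
  lra.
have := total n (leqnn n); rewrite subnn.
rewrite {1 2}/half_width expr0 divr1.
have -> : x + pi = x - pi + 2 * pi by ring.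
rewrite arc_full => h; apply: (le_trans h).
have Y0 : 0 <= Y n by rewrite mulr_ge0 ?exprn_ge0// arc_mass_ge0.
have ca : 0 < C * a 0%N by rewrite mulr_gt0.
have -> : 2 * B * Y n + 4 * B * C * a 0%N = B * (2 * Y n + 2 * C * a 0%N * 2) by ring.
rewrite ler_pM2l// lerD//.
  by rewrite ler_wpM2r// gerBl ltW.
by rewrite -!mulrA !ler_pM2l// gerBl mulr_ge0// ltW.
Qed.

End DyadicSmoothness.

(** * The Herglotz integral near the circle *)

Section Kernels.
Local Open Scope complex_scope.
Context {R : realType}.
Implicit Types (z w : Cplx R) (s t x : R).
Notation Re := complex.Re.
Notation Im := complex.Im.
Local Notation l := (@half_width R).

Definition herglotz_kernel z t : Cplx R := (expi t + z) / (expi t - z).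
Definition dherglotz_kernel z t : Cplx R := 2 * expi t / (expi t - z) ^+ 2.

Lemma modulus_expi_sub_ge z t : 1 - modulus z <= modulus (expi t - z).
Proof.
rewrite lerBlDr -(modulus_expi t) -{1}(subrK z (expi t)); exact: modulusD.
Qed.

Lemma expi_sub_neq0 z t : modulus z < 1 -> expi t - z != 0.
Proof.
move=> z1; rewrite -modulus_gt0; apply: lt_le_trans (modulus_expi_sub_ge z t).
by rewrite subr_gt0.
Qed.

Lemma bcont_inv_expi_sub z : modulus z < 1 -> bcont (fun t => (expi t - z)^-1).
Proof.
move=> z1; apply: (bcontV _ (1 - modulus z)).
- by rewrite subr_gt0.
- exact: modulus_expi_sub_ge.
- by apply: bcontB; [exact: bcont_expi|exact: bcont_cst].
Qed.

Lemma bcont_herglotz_kernel z : modulus z < 1 -> bcont (herglotz_kernel z).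
Proof.
move=> z1; apply: bcontM; last exact: bcont_inv_expi_sub.
by apply: bcontD; [exact: bcont_expi|exact: bcont_cst].
Qed.

Lemma bcont_dherglotz_kernel z : modulus z < 1 -> bcont (dherglotz_kernel z).
Proof.
move=> z1; have -> : dherglotz_kernel z = fun t => 2 * expi t * (expi t - z)^-1 ^+ 2.
  by apply/funext => t; rewrite /dherglotz_kernel exprVn.
apply: bcontM; last by apply: bcontX; exact: bcont_inv_expi_sub.
by apply: bcontM; [exact: bcont_cst|exact: bcont_expi].
Qed.

(** Doubling t multiplies |exp(i t) - 1| by |exp(i t) + 1| <= 2, so each
    halving, starting from t = pi, loses at most a factor 2. *)
Lemma modulus_expi_half_width k : 2 / 2 ^+ k <= modulus (expi (l k) - 1).
Proof.
elim: k => [|k IH].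
  rewrite /half_width expr0 !divr1 /expi cospi sinpi.
  have -> : ((-1) +i* 0 - 1 : Cplx R) = (- 2)%:C.
    by apply/eqP; rewrite eq_complex/= subr0 eqxx andbT; apply/eqP; ring.
  by rewrite modulus_real normrN ger0_norm.
have h : expi (l k) - 1 = (expi (l k.+1) - 1) * (expi (l k.+1) + 1).
  by rewrite half_widthS mulr_natl mulr2n expiD; ring.
have h2 : modulus (expi (l k.+1) + 1) <= 2.
  by rewrite (le_trans (modulusD _ _))// modulus_expi modulus1.
have : modulus (expi (l k) - 1) <= modulus (expi (l k.+1) - 1) * 2.
  by rewrite h modulusM ler_wpM2l ?modulus_ge0.
move=> h3; have := le_trans IH h3.
rewrite -ler_pdivrMr// exprS => h4; apply: le_trans h4.
by rewrite le_eqVlt; apply/orP; left; apply/eqP; field; rewrite expf_neq0.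
Qed.

Lemma sqr_modulus_expi_sub1 t : modulus (expi t - 1) ^+ 2 = 2 - 2 * cos t.
Proof.
rewrite sqr_modulus /expi/= subr0; have := cos2Dsin2 t; rewrite !expr2; lra.
Qed.

Lemma modulus_expi_sub1_ge t k : l k <= `|t| -> `|t| <= pi ->
  2 / 2 ^+ k <= modulus (expi t - 1).
Proof.
move=> lt tpi; apply: (le_trans (modulus_expi_half_width k)).
rewrite -(@ler_pXn2r _ 2) ?nnegrE ?modulus_ge0// !sqr_modulus_expi_sub1.
have -> : cos t = cos `|t| by case: (ger0P t) => // _; rewrite cosN.
rewrite lerD2l lerN2 ler_pM2l// leNgt; apply/negP.
have l0 := half_width_gt0 (R := R) k.
rewrite ltr_cos ?in_itv/= ?normr_ge0 ?tpi//.
  by rewrite ltNge lt.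
by rewrite (ltW l0) half_width_le_pi.
Qed.

(** The triangle inequality through expi x: |z - expi x| is at most 20 times
    the distance from z to the circle, hence at most 20 |expi s - z|. *)
Lemma shell_distance z x n k s : (k <= n)%N -> in_shell x n k s ->
  (2 ^+ n.+1)^-1 <= 1 - modulus z -> modulus (z - expi x) <= 10 / 2 ^+ n ->
  (21 * 2 ^+ k)^-1 <= modulus (expi s - z).
Proof.
move=> kn [s1 s2] z1 zx.
have d1 := le_trans z1 (modulus_expi_sub_ge z s).
have p0 j : 0 < 2 ^+ j :> R by rewrite exprn_gt0.
case: s2 => [->|s2].
  apply: le_trans d1; rewrite exprS lef_pV2 ?posrE ?mulr_gt0// ler_pM2r//.
  by rewrite ler_nat.
have h : 2 / 2 ^+ k.+1 <= modulus (expi s - expi x).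
  have -> : expi s - expi x = expi x * (expi (s - x) - 1).
    by rewrite mulrBr mulr1 -expiD [x + _]addrC subrK.
  rewrite modulusM modulus_expi mul1r modulus_expi_sub1_ge//.
  by rewrite (le_trans s1)// half_width_le_pi.
have h2 : modulus (expi s - expi x) <= modulus (expi s - z) + modulus (z - expi x).
  by rewrite -{1}(subrK z (expi s)) -addrA; exact: modulusD.
have d2 : 10 / 2 ^+ n <= 20 * modulus (expi s - z).
  apply: le_trans (_ : 20 * (2 ^+ n.+1)^-1 <= _); last by rewrite ler_pM2l.
  by rewrite exprS le_eqVlt; apply/orP; left; apply/eqP; field; rewrite expf_neq0.
have h3 : 2 / 2 ^+ k.+1 <= 21 * modulus (expi s - z) by lra.
rewrite invfM -ler_pdivlMl ?invr_gt0// invrK; apply: le_trans h3.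
by rewrite exprS le_eqVlt; apply/orP; left; apply/eqP; field; rewrite expf_neq0.
Qed.

Lemma dherglotz_kernelB z s t (d : R) : modulus z < 1 -> 0 < d ->
  d <= modulus (expi s - z) -> d <= modulus (expi t - z) ->
  modulus (dherglotz_kernel z t - dherglotz_kernel z s) <= 8 / d ^+ 3 * `|t - s|.
Proof.
move=> z1 d0 ds dt.
set u := expi s - z in ds *; set v := expi t - z in dt *.
have u0 : u != 0 by exact: expi_sub_neq0.
have v0 : v != 0 by exact: expi_sub_neq0.
have -> : dherglotz_kernel z t - dherglotz_kernel z s =
    - (2 * (expi t - expi s)) * (expi t / (u * v ^+ 2) + z / (u ^+ 2 * v)).
  rewrite /dherglotz_kernel -/u -/v.
  have -> : expi t = v + z by rewrite /v subrK.
  have -> : expi s = u + z by rewrite /u subrK.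
  by field; rewrite u0 v0.
have mu0 : 0 < modulus u by rewrite (lt_le_trans d0).
have mv0 : 0 < modulus v by rewrite (lt_le_trans d0).
rewrite modulusM modulusN modulusM modulus_nat.
have b1 : modulus (expi t / (u * v ^+ 2)) <= (d ^+ 3)^-1.
  rewrite modulusM modulus_expi mul1r modulusV modulusM modulusX.
  rewrite lef_pV2 ?posrE ?mulr_gt0 ?exprn_gt0// exprS.
  by rewrite ler_pM ?exprn_ge0 ?(ltW d0)// lerXn2r// ?nnegrE ltW.
have b2 : modulus (z / (u ^+ 2 * v)) <= (d ^+ 3)^-1.
  rewrite modulusM modulusV modulusM modulusX.
  apply: (@le_trans _ _ (1 * (modulus u ^+ 2 * modulus v)^-1)).
    by rewrite ler_wpM2r ?invr_ge0 ?mulr_ge0 ?exprn_ge0 ?modulus_ge0// ltW.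
  rewrite mul1r lef_pV2 ?posrE ?mulr_gt0 ?exprn_gt0// exprSr.
  by rewrite ler_pM ?exprn_ge0 ?(ltW d0)// lerXn2r// ?nnegrE ltW.
have b3 := modulus_expiB t s.
apply: (@le_trans _ _ (2 * (2 * `|t - s|) * (2 * (d ^+ 3)^-1))).
  apply: ler_pM; rewrite ?mulr_ge0 ?modulus_ge0//; first by rewrite ler_pM2l.
  rewrite (le_trans (modulusD _ _))//; lra.
by rewrite le_eqVlt; apply/orP; left; apply/eqP; field; rewrite gt_eqF.
Qed.

(** As a function of t, 2 i / (exp(i t) - z) has derivative
    2 exp(i t) / (exp(i t) - z)^2. *)
Definition primitive_kernel z t : Cplx R := 2 * 'i%C / (expi t - z).

Lemma primitive_kernel_taylor z s t (d : R) : modulus z < 1 -> 0 < d -> d <= 1 ->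
  d <= modulus (expi s - z) -> d <= modulus (expi t - z) ->
  modulus (primitive_kernel z t - primitive_kernel z s -
    dherglotz_kernel z s * (t - s)%:C) <= 8 / d ^+ 3 * (t - s) ^+ 2.
Proof.
move=> z1 d0 d1 ds dt.
set e := t - s; pose rho := expi e - 1 - 'i%C * e%:C.
have rho2 : modulus rho <= 2 * e ^+ 2 by exact: modulus_expi_sub1.
have tE : expi t = expi s * expi e by rewrite -expiD /e addrC subrK.
have eE : expi e = 1 + 'i%C * e%:C + rho by rewrite /rho; ring.
have ii : 'i%C * 'i%C = -1 :> Cplx R by rewrite -expr2 sqr_i.
set u := expi s - z in ds *; set v := expi t - z in dt *.
have u0 : u != 0 by exact: expi_sub_neq0.
have v0 : v != 0 by exact: expi_sub_neq0.
have -> : primitive_kernel z t - primitive_kernel z s - dherglotz_kernel z s * e%:C =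
   - (2 * expi s * e%:C * (expi t - expi s) / (u ^+ 2 * v)) - 2 * 'i%C * expi s * rho / (u * v).
  have -> : expi t - expi s = v - u by rewrite /u /v; ring.
  have r : 'i%C * expi s * rho = 'i%C * (v - u) + expi s * e%:C.
    have -> : v - u = expi s * ('i%C * e%:C + rho) by rewrite /u /v tE eE; ring.
    transitivity ('i%C * expi s * rho + ('i%C * 'i%C + 1) * (expi s * e%:C)); last by ring.
    by rewrite ii addNr mul0r addr0.
  have -> : 2 * 'i%C * expi s * rho = 2 * ('i%C * (v - u) + expi s * e%:C).
    by rewrite -r; ring.
  rewrite /primitive_kernel /dherglotz_kernel -/u -/v.
  by field; rewrite u0 v0.
have mu0 : 0 < modulus u by rewrite (lt_le_trans d0).
have mv0 : 0 < modulus v by rewrite (lt_le_trans d0).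
have d3 : 0 < d ^+ 3 by rewrite exprn_gt0.
have b1 : modulus ((u ^+ 2 * v)^-1) <= (d ^+ 3)^-1.
  rewrite modulusV modulusM modulusX.
  rewrite lef_pV2 ?posrE ?mulr_gt0 ?exprn_gt0// exprSr.
  by rewrite ler_pM ?exprn_ge0 ?(ltW d0)// lerXn2r// ?nnegrE ltW.
have b2 : modulus ((u * v)^-1) <= (d ^+ 3)^-1.
  rewrite modulusV modulusM lef_pV2 ?posrE ?mulr_gt0// exprS.
  apply: ler_pM; rewrite ?exprn_ge0 ?(ltW d0)//.
  apply: le_trans dt; rewrite expr2 ler_piMr// ltW//.
have b3 := modulus_expiB t s; rewrite -/e in b3.
apply: (le_trans (modulusB _ _)); rewrite modulusN.
have -> : 8 / d ^+ 3 * e ^+ 2 = 2 * `|e| * (2 * `|e|) * (d ^+ 3)^-1 + 2 * (2 * e ^+ 2) * (d ^+ 3)^-1.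
  by rewrite -[e ^+ 2]real_normK ?num_real//; field; rewrite gt_eqF.
apply: lerD.
  rewrite !modulusM modulus_nat modulus_expi modulus_real mulr1.
  by apply: ler_pM => //; rewrite ?mulr_ge0 ?modulus_ge0// ler_wpM2l// mulr_ge0.
rewrite !modulusM modulus_nat modulus_expi modulus_i !mulr1.
by apply: ler_pM => //; rewrite ?mulr_ge0 ?modulus_ge0// ler_pM2l.
Qed.

Lemma Re_herglotz_kernel z t :
  Re (herglotz_kernel z t) = (1 - modulus z ^+ 2) / modulus (expi t - z) ^+ 2.
Proof.
have := cos2Dsin2 t; rewrite /herglotz_kernel !sqr_modulus /expi.
case: z => c d /=; set a := cos t; set b := sin t; set n := (_ + _)^-1 => ab.
by rewrite mulrN opprK !mulrA -mulrDl -ab /n; congr (_ / _); ring.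
Qed.

End Kernels.

Section Herglotz.
Local Open Scope complex_scope.
Context {R : realType}.
Variable mu : {finite_measure set (measurableTypeR R) -> \bar R}.
Local Notation m := (arc_mass mu).
Local Notation l := (@half_width R).
Notation Re := complex.Re.
Notation Im := complex.Im.
Implicit Types (z : Cplx R) (x : R).

Definition herglotz z := cintegral mu (circle_angles R) (herglotz_kernel z).
Definition dherglotz z := cintegral mu (circle_angles R) (dherglotz_kernel z).

Lemma circle_kernel_Re (f : R -> Cplx R) : bcont f ->
  (forall t (k : int), f (t + k%:~R * (2 * pi)) = f t) -> circle_kernel (fun t => Re (f t)).
Proof.
move=> [fR _ [B fB]] fp; split => //; first by move=> t k; rewrite fp.
by exists B => t; rewrite (le_trans (ler_Re_modulus _)).
Qed.

Lemma circle_kernel_Im (f : R -> Cplx R) : bcont f ->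
  (forall t (k : int), f (t + k%:~R * (2 * pi)) = f t) -> circle_kernel (fun t => Im (f t)).
Proof.
move=> [_ fI [B fB]] fp; split => //; first by move=> t k; rewrite fp.
by exists B => t; rewrite (le_trans (ler_Im_modulus _)).
Qed.

Lemma Re_herglotz_ge0 z : modulus z < 1 -> 0 <= Re (herglotz z).
Proof.
move=> z1; apply: Rintegral_ge0 => t _; rewrite Re_herglotz_kernel.
by rewrite divr_ge0 ?sqr_ge0// subr_ge0 exprn_ile1// ?modulus_ge0// ltW.
Qed.

Variables (a : nat -> R) (C D b : R).
Hypothesis a_gt0 : forall n, 0 < a n.
Hypothesis C_gt0 : 0 < C.
Hypothesis smooth : dyadic_smooth mu a C.
Hypothesis D_gt0 : 0 < D.
Hypothesis b_gt0 : 0 < b.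
Hypothesis b_lt1 : b < 1.
Hypothesis growth : slow_growth a D b.
Hypothesis a_le0 : forall n, a n <= a 0%N.

(** The kernel of H' has a periodic primitive, of order 2^k at distance 2^-k
    from z, while the kernel has a Lipschitz constant of order 8^k there. *)
Lemma modulus_dherglotz_le z x n : modulus z < 1 ->
  (2 ^+ n.+1)^-1 <= 1 - modulus z -> modulus (z - expi x) <= 10 / 2 ^+ n ->
  modulus (dherglotz z) <= 2 * (15 * C * D / (1 - b) * (8 * 21 ^+ 3)) * (2 ^+ n * a n).
Proof.
move=> z1 zn zx; set B : R := 8 * 21 ^+ 3.
have B0 : 0 < B by rewrite mulr_gt0// exprn_gt0.
have key (f : {additive Cplx R -> R}) : (forall w, `|f w| <= modulus w) ->
    (forall w (r : R), f (w * r%:C) = f w * r) ->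
    circle_kernel (fun t => f (dherglotz_kernel z t)) ->
    `|\int[mu]_(t in circle_angles R) f (dherglotz_kernel z t)|
      <= 15 * C * D / (1 - b) * (B * (2 ^+ n * a n)).
  move=> fle flin fk.
  apply: (oscillating_kernel_le mu a C _ _ _ D b _ _ _ _ x n _ (fun t => f (primitive_kernel z t)) B) => //.
  - have -> : x + pi = x - pi + 1%:~R * (2 * pi) by ring.
    by rewrite /primitive_kernel expi_period.
  - move=> k s t kn ss st.
    have ds := shell_distance z x n k s kn ss zn zx.
    have dt := shell_distance z x n k t kn st zn zx.
    have d0 : 0 < (21 * 2 ^+ k)^-1 :> R by rewrite invr_gt0 mulr_gt0// exprn_gt0.
    have d1 : (21 * 2 ^+ k)^-1 <= 1 :> R.
      rewrite invf_le1 ?mulr_gt0 ?exprn_gt0//.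
      by have := @exprn_ege1 R k 2; rewrite ler1n => /(_ isT); lra.
    have e : 8 / (21 * 2 ^+ k)^-1 ^+ 3 = B * 8 ^+ k :> R.
      rewrite exprVn invrK /B exprMn -exprM mulnC exprM mulrA; congr (_ * _ ^+ _).
      by ring.
    split.
      rewrite -raddfB (le_trans (fle _))// -e; exact: dherglotz_kernelB.
    rewrite -flin -!raddfB (le_trans (fle _))// -e; exact: primitive_kernel_taylor.
  - move=> k kn; have lk0 := half_width_gt0 (R := R) k.
    have lkk := half_width_le (R := R) _ _ (leqnSn k).
    have e2 (s : R) : `|s - x| = l k -> `|f (primitive_kernel z s)| <= B * 2 ^+ k.
      move=> sx; have ss : in_shell x n k s.
        by split; rewrite sx//; right.
      have ds := shell_distance z x n k s kn ss zn zx.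
      have d0 : 0 < (21 * 2 ^+ k)^-1 :> R by rewrite invr_gt0 mulr_gt0// exprn_gt0.
      rewrite (le_trans (fle _))// /primitive_kernel !modulusM modulus_nat modulus_i mulr1 modulusV.
      apply: (@le_trans _ _ (2 * (21 * 2 ^+ k))).
        by rewrite ler_pM2l// -[leRHS]invrK lef_pV2 ?posrE// (lt_le_trans d0).
      rewrite mulrA ler_pM2r ?exprn_gt0// /B !exprS expr0; lra.
    split; apply: e2.
      by rewrite addrAC subrr add0r ger0_norm ?ltW.
    by rewrite addrAC subrr add0r normrN ger0_norm ?ltW.
have bk := bcont_dherglotz_kernel z z1.
have pk t (k : int) : dherglotz_kernel z (t + k%:~R * (2 * pi)) = dherglotz_kernel z t.
  by rewrite /dherglotz_kernel expi_period.
have h1 := key (@complex.Re R) (@ler_Re_modulus R) _ (circle_kernel_Re _ bk pk).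
have h2 := key (@complex.Im R) (@ler_Im_modulus R) _ (circle_kernel_Im _ bk pk).
apply: (le_trans (ler_modulus_ReIm _)).
have -> : 2 * (15 * C * D / (1 - b) * B) * (2 ^+ n * a n) =
  15 * C * D / (1 - b) * (B * (2 ^+ n * a n)) + 15 * C * D / (1 - b) * (B * (2 ^+ n * a n)).
  by ring.
apply: lerD; [apply: h1|apply: h2].
- by case=> p q r /=; rewrite mulr0 subr0.
- by case=> p q r /=; rewrite mulr0 add0r.
Qed.

(** The real part of the kernel is the Poisson kernel, of size 4^k / 2^n on
    the shell of level k. *)
Lemma Re_herglotz_le z x n : modulus z < 1 ->
  (2 ^+ n.+1)^-1 <= 1 - modulus z -> modulus (z - expi x) <= 10 / 2 ^+ n ->
  Re (herglotz z) <= 2 * (20 * 21 ^+ 2) * (2 ^+ n * m (x - l n) (x + l n))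
     + 4 * (20 * 21 ^+ 2) * C * a 0%N.
Proof.
move=> z1 zn zx; set B : R := 20 * 21 ^+ 2.
have B0 : 0 < B by rewrite mulr_gt0// exprn_gt0.
have bk := bcont_herglotz_kernel z z1.
have pk t (k : int) : herglotz_kernel z (t + k%:~R * (2 * pi)) = herglotz_kernel z t.
  by rewrite /herglotz_kernel expi_period.
apply: (positive_kernel_le mu a C _ _ _ _ x n _ B) => //.
- exact: circle_kernel_Re.
- move=> t; rewrite Re_herglotz_kernel divr_ge0 ?sqr_ge0// subr_ge0.
  by rewrite exprn_ile1// ?modulus_ge0// ltW.
- move=> k s kn ss; rewrite Re_herglotz_kernel.
  have ds := shell_distance z x n k s kn ss zn zx.
  have d0 : 0 < (21 * 2 ^+ k)^-1 :> R by rewrite invr_gt0 mulr_gt0// exprn_gt0.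
  have z2 : 1 - modulus z ^+ 2 <= 20 / 2 ^+ n.
    have : 1 - modulus z <= modulus (z - expi x).
      by rewrite modulusC modulus_expi_sub_ge.
    have := modulus_ge0 z; move: zx; set q := (2 ^+ n)^-1; rewrite expr2; nra.
  have -> : B * 4 ^+ k / 2 ^+ n = 20 / 2 ^+ n * (21 * 2 ^+ k) ^+ 2.
    rewrite /B (_ : 4 = 2 * 2); last by ring.
    by rewrite !exprMn; field; rewrite expf_neq0.
  apply: ler_pM => //.
  - by rewrite subr_ge0 exprn_ile1// ?modulus_ge0// ltW.
  - by rewrite invr_ge0 sqr_ge0.
  - have q0 := lt_le_trans d0 ds.
    rewrite -[leRHS]invrK lef_pV2 ?posrE ?invr_gt0 ?exprn_gt0 ?mulr_gt0 ?exprn_gt0//.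
    by rewrite -exprVn lerXn2r// nnegrE ?modulus_ge0// ltW.
Qed.

End Herglotz.

(** * Dyadic form of the hypotheses *)

Section MonotoneIntegral.
Context d (T : measurableType d) (R : realType).
Variable mu : {measure set T -> \bar R}.
Import HBNNSimple.
Local Open Scope ereal_scope.

(** The integral of a nonnegative function is a supremum over the simple
    functions below it, hence monotone for arbitrary functions. The integrands
    met below are only compared with explicit step functions. *)
Lemma ge0_le_integral_dominated (D : set T) (f g : T -> \bar R) :
  (forall x, D x -> 0 <= f x) -> (forall x, D x -> f x <= g x) ->
  \int[mu]_(x in D) f x <= \int[mu]_(x in D) g x.
Proof.
move=> f0 fg.
have g0 x : D x -> 0 <= g x by move=> Dx; rewrite (le_trans (f0 x Dx))// fg.
rewrite !ge0_integralE//; apply: ereal_sup_le => _ [h hf <-].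
apply/set_mem; rewrite inE; exists h => // x /=; apply: (le_trans (hf x)).
by rewrite !patchE; case: ifPn => // /set_mem; exact: fg.
Qed.

End MonotoneIntegral.

Section DyadicIntegral.
Context {R : realType}.
Implicit Types (g : R -> R) (c : nat -> R).

Definition dyadic_itv (k : nat) : set (measurableTypeR R) :=
  `[(2 ^+ k.+1)^-1, (2 ^+ k)^-1[%classic.

Lemma lebesgue_dyadic_itv k :
  lebesgue_measure (dyadic_itv k) = ((2 ^+ k.+1)^-1)%:E :> \bar R.
Proof.
rewrite /dyadic_itv lebesgue_measure_itv/= lte_fin ltf_pV2 ?posrE ?exprn_gt0//.
rewrite ltr_eXn2l ?ltr1n// leqnn -EFinB; congr EFin.
by rewrite exprS; field; rewrite expf_neq0.
Qed.

Lemma dyadic_itv_disjoint j k t : dyadic_itv j t -> dyadic_itv k t -> j = k.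
Proof.
wlog jk : j k / (j <= k)%N.
  by move=> h; case: (leqP j k) => [|/ltnW] jk tj tk; [exact: h|exact/esym/h].
rewrite /dyadic_itv/= !in_itv/= => /andP[h1 h2] /andP[h3 h4].
apply/eqP; rewrite eqn_leq jk/= leqNgt; apply/negP => kj.
have : (2 ^+ k)^-1 <= (2 ^+ j.+1)^-1 :> R.
  by rewrite lef_pV2 ?posrE ?exprn_gt0// ler_weXn2l// ler1n.
by move=> h; have := lt_le_trans (le_lt_trans h1 h4) h; rewrite ltxx.
Qed.

(** The intervals are disjoint, so the step function with value c k on the
    k-th one lies below g. *)
Lemma dyadic_sum_le_integral (D : set (measurableTypeR R)) g c n :
  measurable D -> (forall t, D t -> 0 <= g t) -> (forall k, 0 <= c k) ->
  (forall k, (k < n)%N -> dyadic_itv k `<=` D) ->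
  (forall k t, (k < n)%N -> dyadic_itv k t -> c k <= g t) ->
  ((\sum_(k < n) c k / 2 ^+ k.+1)%:E <= \int[lebesgue_measure]_(t in D) (g t)%:E)%E.
Proof.
move=> mD g0 c0 kD cg.
have mJ k : measurable (dyadic_itv k : set (measurableTypeR R)) by exact: measurable_itv.
have mind k : measurable_fun D (fun t : measurableTypeR R => (c k * \1_(dyadic_itv k) t)%:E).
  apply/measurable_EFinP; apply: measurable_funM; first exact: measurable_cst.
  exact: measurable_indic.
have E : (\int[lebesgue_measure]_(t in D) (\sum_(k <- index_iota 0 n) (c k * \1_(dyadic_itv k) t)%:E) =
    (\sum_(k < n) c k / 2 ^+ k.+1)%:E)%E.
  rewrite ge0_integral_sum//; last by move=> k t _; rewrite lee_fin mulr_ge0.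
  rewrite big_mkord -sumEFin; apply: eq_bigr => k _.
  under eq_integral do rewrite EFinM.
  rewrite ge0_integralZl_EFin//; last by apply/measurable_EFinP; exact: measurable_indic.
  rewrite integral_indic// setIidl; last by apply: kD.
  by rewrite [X in (_ * X)%E](lebesgue_dyadic_itv k) EFinM.
rewrite -E; apply: ge0_le_integral_dominated => t Dt.
  by apply: sume_ge0 => k _; rewrite lee_fin mulr_ge0.
rewrite big_mkord sumEFin lee_fin.
have [[k kn tk]|no] := pselect (exists2 k, (k < n)%N & dyadic_itv k t).
  rewrite (bigD1 (Ordinal kn))//= big1 ?addr0.
    by rewrite indicE mem_set// mulr1; exact: cg tk.
  move=> j jk; rewrite indicE memNset ?mulr0// => tj.
  by move: jk; rewrite -val_eqE/= (dyadic_itv_disjoint _ _ _ tj tk) eqxx.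
rewrite big1 ?g0// => j _; rewrite indicE memNset ?mulr0// => tj.
by apply: no; exists j.
Qed.

End DyadicIntegral.

Section FromHypotheses.
Context {R : realType}.
Variables (phi : R -> R).
Hypothesis phi_pos : forall t : R, 0 < t -> t <= 1 -> 0 < phi t.
Hypothesis phi_incr : forall x y : R, 0 < x -> x <= y -> y <= 1 -> phi x <= phi y.

Definition dyadic_value (n : nat) : R := phi (2 ^+ n)^-1.
Local Notation a := dyadic_value.

Lemma dyadic_pt_gt0 n : 0 < (2 ^+ n)^-1 :> R.
Proof. by rewrite invr_gt0 exprn_gt0. Qed.

Lemma dyadic_pt_le1 n : (2 ^+ n)^-1 <= 1 :> R.
Proof. by rewrite invf_le1 ?exprn_gt0// exprn_ege1// ler1n. Qed.

Lemma dyadic_pt_le j k : (j <= k)%N -> (2 ^+ k)^-1 <= (2 ^+ j)^-1 :> R.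
Proof. by move=> jk; rewrite lef_pV2 ?posrE ?exprn_gt0// ler_weXn2l// ler1n. Qed.

Lemma dyadic_value_gt0 n : 0 < a n.
Proof. by apply: phi_pos; [exact: dyadic_pt_gt0|exact: dyadic_pt_le1]. Qed.

Lemma dyadic_value_le j k : (j <= k)%N -> a k <= a j.
Proof.
move=> jk; apply: phi_incr; [exact: dyadic_pt_gt0|exact: dyadic_pt_le|exact: dyadic_pt_le1].
Qed.

Lemma slow_growth_dyadic_value :
  (exists beta : R, 0 < beta < 1 /\ almost_decreasing (fun t : R => phi t / t `^ beta)) ->
  exists D b : R, [/\ 0 < D, 0 < b, b < 1 & slow_growth a D b].
Proof.
move=> [beta [/andP[beta0 beta1] [c c0 dec]]].
(* The summand 1 is for k = n, where almost decrease says nothing. *)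
exists (1 + c^-1), (2 `^ (beta - 1)).
have ci0 : 0 < c^-1 by rewrite invr_gt0.
have b0 : 0 < 2 `^ (beta - 1) :> R by rewrite powR_gt0.
split => //; first by rewrite addr_gt0.
  rewrite /powR pnatr_eq0/= -[ltRHS]expR0 ltr_expR nmulr_rlt0 ?subr_lt0//.
  by rewrite ln_gt0// ltr1n.
move=> k n kn.
have [<-|kn'] := eqVneq k n.
  rewrite subnn expr0 mulr1 mulrC ler_peMl//; last by lra.
  by rewrite mulr_ge0 ?exprn_ge0// ltW// dyadic_value_gt0.
have {}kn' : (k < n)%N by rewrite ltn_neqAle kn'.
have := dec (2 ^+ n)^-1 (2 ^+ k)^-1 (dyadic_pt_gt0 n).
rewrite ltf_pV2 ?posrE ?exprn_gt0// ltr_eXn2l ?ltr1n// kn' dyadic_pt_le1.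
move=> /(_ isT isT); rewrite -/(a n) -/(a k).
have pw j : ((2 ^+ j)^-1) `^ beta = ((2 `^ beta) ^+ j)^-1 :> R.
  have -> : (2 ^+ j)^-1 = 2 `^ (- j%:R) :> R by rewrite powR_invn.
  rewrite -powRrM mulNr powRN; congr (_^-1).
  by rewrite mulrC powRrM powR_mulrn// powR_ge0.
rewrite !pw !invrK => h.
set q := 2 `^ beta in h *.
have q0 : 0 < q by rewrite powR_gt0.
have qE : 2 `^ (beta - 1) = q / 2 :> R by rewrite powRB ?powRr1// pnatr_eq0 implybT.
have h2 : a k <= c^-1 * (a n * q ^+ (n - k)).
  rewrite ler_pdivlMl// -(ler_pM2r (_ : 0 < q ^+ k)) ?exprn_gt0//.
  by rewrite -[leLHS]mulrA -[leRHS]mulrA -exprD subnK// ltnW.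
have e : (q / 2) ^+ (n - k) * 2 ^+ n = q ^+ (n - k) * 2 ^+ k.
  have -> : 2 ^+ n = 2 ^+ (n - k) * 2 ^+ k :> R by rewrite -exprD subnK.
  by rewrite exprMn exprVn; field; rewrite expf_neq0.
rewrite qE.
have -> : (1 + c^-1) * (q / 2) ^+ (n - k) * (2 ^+ n * a n) =
   (1 + c^-1) * (a n * q ^+ (n - k)) * 2 ^+ k.
  by rewrite -!mulrA; congr (_ * _); rewrite [LHS]mulrA e; ring.
rewrite ler_pM2r ?exprn_gt0// (le_trans h2)// ler_pM2r; first by lra.
by rewrite mulr_gt0 ?exprn_gt0 ?dyadic_value_gt0.
Qed.

(** Since pi < 4, arcs of length at most pi / 2^n have length at most
    2^-(n - 2), an admissible scale when n >= 2; there [slow_growth] compares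
    phi(2^-(n - 2)) with phi(2^-n). The levels 0 and 1 cost the total mass. *)
Lemma dyadic_smooth_of_smooth (mu : {finite_measure set (measurableTypeR R) -> \bar R}) (D b : R) :
  0 < D -> 0 < b -> b < 1 -> slow_growth a D b -> smooth_measure phi mu ->
  exists2 C : R, 0 < C & dyadic_smooth mu a C.
Proof.
move=> D0 b0 b1 growth [C C0 smooth].
have a1 := dyadic_value_gt0 1.
have m0 := mass_ge0 mu.
exists (16 * C * D + 2 * mass mu / a 1%N).
  by rewrite ltr_wpDr ?mulr_gt0// divr_ge0 ?(ltW a1)// mulr_ge0.
move=> n x s s0 sn.
have an := dyadic_value_gt0 n.
have p0 : 0 < 2 ^+ n :> R by rewrite exprn_gt0.
have spi : s <= pi by rewrite (le_trans sn)// half_width_le_pi.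
have [n2|n2] := ltnP n 2.
  apply: (@le_trans _ _ (mass mu)).
    have h1 := arc_mass_ge0 mu x (x + s); have h2 := arc_mass_le mu x (x + s).
    have h3 := arc_mass_ge0 mu (x + s) (x + s + s).
    have h4 := arc_mass_le mu (x + s) (x + s + s).
    by rewrite ler_norml; lra.
  apply: (@le_trans _ _ (2 * mass mu / a 1%N * a n / 2 ^+ n)).
    have an1 : a 1%N <= a n by apply: dyadic_value_le; rewrite -ltnS.
    have p2 : 2 ^+ n <= 2 :> R.
      by rewrite -[leRHS]expr1 ler_weXn2l// ?ler1n// -ltnS.
    rewrite ler_pdivlMr// mulrAC ler_pdivlMr// -mulrA -[leRHS]mulrA mulrCA ler_wpM2l//.
    by rewrite ler_pM// ltW.
  rewrite ler_pM2r ?invr_gt0// ler_pM2r// lerDr.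
  by rewrite !mulr_ge0// ltW.
have [j nj] : exists j, n = j.+2 by exists (n - 2)%N; rewrite -addn2 subnK.
have delta : s <= (2 ^+ j)^-1.
  apply: (le_trans sn); rewrite /half_width nj !exprS.
  have := pi_lt4 (R := R); have := dyadic_pt_gt0 j; set q := (2 ^+ j)^-1 => q0 pi4.
  have -> : pi / (2 * (2 * 2 ^+ j)) = pi / 4 * q.
    by rewrite /q; move: (pi : R) => P; field; rewrite expf_neq0.
  by rewrite ler_piMl ?(ltW q0)//; lra.
have := smooth _ (dyadic_pt_gt0 j) (dyadic_pt_le1 j).
have sup : (`| mu (arc x (x + s)) - mu (arc (x + s) (x + s + s))| <=
   modulus_of_smoothness mu (2 ^+ j)^-1)%E.
  apply: ereal_sup_ubound => /=; exists s, (arc x (x + s)), (arc (x + s) (x + s + s)).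
  by split => //; exists x, true, true, true, true.
move=> /(le_trans sup); rewrite !arc_massE -EFinB /= lee_fin => h.
apply: (le_trans h); rewrite -/(a j).
have jn : (j <= n)%N by rewrite nj -addn2 leq_addr.
have g := growth j n jn.
have {}g : a j <= 4 * D * a n.
  rewrite -(ler_pM2r (_ : 0 < 2 ^+ j)) ?exprn_gt0// (le_trans g)//.
  have -> : 4 * D * a n * 2 ^+ j = D * 1 * (2 ^+ n * a n).
    have -> : 2 ^+ n = 4 * 2 ^+ j :> R by rewrite nj !exprS; ring.
    by ring.
  rewrite ler_pM2r; last by rewrite mulr_gt0 ?exprn_gt0.
  by rewrite ler_pM2l// exprn_ile1// ltW.
apply: (@le_trans _ _ (C * ((2 ^+ j)^-1 * (4 * D * a n)))).
  by rewrite ler_pM2l// ler_pM2l// dyadic_pt_gt0.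
have -> : C * ((2 ^+ j)^-1 * (4 * D * a n)) = 16 * C * D * a n / 2 ^+ n.
  have -> : 2 ^+ n = 4 * 2 ^+ j :> R by rewrite nj !exprS; ring.
  by field; rewrite expf_neq0.
rewrite ler_pM2r ?invr_gt0// ler_pM2r// lerDl.
by rewrite divr_ge0 ?(ltW a1)// mulr_ge0.
Qed.

Definition bracket_sum (n : nat) : R := \sum_(i < n) a i.+1 ^+ 2.

Lemma bracket_sum_ge0 n : 0 <= bracket_sum n.
Proof. by apply: sumr_ge0 => i _; rewrite sqr_ge0. Qed.

(** On the k-th dyadic interval, of length 2^-(k + 1), phi(s)^2 / s is at
    least a k.+1 ^+ 2 * 2 ^+ k because phi is nondecreasing. *)
Lemma bracket_sqr_ge n t : 0 < t -> t <= (2 ^+ n)^-1 ->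
  bracket_sum n / 2 <= bracket phi t ^+ 2.
Proof.
move=> t0 tn.
have t1 : t <= 1 by rewrite (le_trans tn)// dyadic_pt_le1.
have g0 s : `[t, 1]%classic s -> 0 <= phi s ^+ 2 / s.
  by rewrite /= in_itv/= => /andP[ts _]; rewrite divr_ge0 ?sqr_ge0// (le_trans (ltW t0)).
rewrite /bracket sqr_sqrtr; last by apply: Rintegral_ge0.
have fin : (\int[lebesgue_measure]_(s in `[t, 1%R]) (phi s ^+ 2 / s)%:E < +oo)%E.
  apply: (@le_lt_trans _ _ (\int[lebesgue_measure]_(s in `[t, 1%R]) (cst (phi 1 ^+ 2 / t)%:E s))%E).
    apply: ge0_le_integral_dominated => s st; first by rewrite lee_fin g0.
    rewrite lee_fin; move: st; rewrite /= in_itv/= => /andP[ts s1].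
    have s0 : 0 < s by rewrite (lt_le_trans t0).
    apply: ler_pM; rewrite ?sqr_ge0 ?invr_ge0 ?(ltW s0)//.
      by rewrite lerXn2r// ?nnegrE ?phi_incr// ltW// phi_pos.
    by rewrite lef_pV2.
  rewrite integral_cst//= lebesgue_measure_itv/=.
  by case: ifP => _; rewrite -?EFinB -?EFinM ?mule0 ltry.
rewrite /Rintegral -lee_fin fineK; last first.
  by rewrite ge0_fin_numE// integral_ge0// => s /g0; rewrite lee_fin.
have := @dyadic_sum_le_integral R `[t, 1]%classic (fun s => phi s ^+ 2 / s)
  (fun k => a k.+1 ^+ 2 * 2 ^+ k) n.
have -> : \sum_(k < n) a k.+1 ^+ 2 * 2 ^+ k / 2 ^+ k.+1 = bracket_sum n / 2.
  rewrite /bracket_sum big_distrl/=; apply: eq_bigr => k _.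
  by rewrite [2 ^+ _.+1]exprS; field; rewrite expf_neq0.
apply => //.
- by move=> k; rewrite mulr_ge0 ?sqr_ge0 ?exprn_ge0.
- move=> k kn s; rewrite /dyadic_itv /= !in_itv/= => /andP[h1 h2].
  rewrite (le_trans tn)/=; last by rewrite (le_trans _ h1)// dyadic_pt_le.
  by rewrite (le_trans (ltW h2))// dyadic_pt_le1.
- move=> k s kn; rewrite /dyadic_itv /= in_itv/= => /andP[h1 h2].
  have s0 : 0 < s by rewrite (lt_le_trans (dyadic_pt_gt0 k.+1)).
  have s1 : s <= 1 by rewrite (le_trans (ltW h2))// dyadic_pt_le1.
  apply: ler_pM; rewrite ?sqr_ge0 ?exprn_ge0//.
    rewrite lerXn2r// ?nnegrE; [exact: ltW (dyadic_value_gt0 _)|exact: ltW (phi_pos _ _ _)|].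
    by apply: phi_incr => //; exact: dyadic_pt_gt0.
  by rewrite -[leLHS]invrK lef_pV2 ?posrE// ?dyadic_pt_gt0// ltW.
Qed.

(** On the k-th dyadic interval, k >= 1, the integrand is at least
    2^k a_(k+1)^p (a_1 / 2) exp(eps / 2 * bracket_sum k), by [bracket_sqr_ge]
    and the monotonicity of phi. *)
Lemma summable_of_integral (p eps : R) : 0 < p -> 0 < eps ->
  (\int[lebesgue_measure]_(t in `]0%R, 1%R])
        (phi t `^ p / t * bracket phi t *
         expR (eps * bracket phi t ^+ 2))%:E < +oo)%E ->
  exists V : R, forall n, \sum_(k < n) a k.+1 `^ p * expR (eps / 2 * bracket_sum k) <= V.
Proof.
move=> p0 eps0 fin.
set F := fun t : R => phi t `^ p / t * bracket phi t * expR (eps * bracket phi t ^+ 2) in fin.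
have F0 t : `]0, 1]%classic t -> 0 <= F t.
  rewrite /= in_itv/= => /andP[t0 t1].
  by rewrite !mulr_ge0 ?powR_ge0 ?invr_ge0 ?(ltW t0) ?expR_ge0// sqrtr_ge0.
have a1 := dyadic_value_gt0 1.
pose I := fine (\int[lebesgue_measure]_(t in `]0%R, 1%R]) (F t)%:E)%E.
have IE : (\int[lebesgue_measure]_(t in `]0%R, 1%R]) (F t)%:E)%E = I%:E.
  by rewrite fineK// ge0_fin_numE// integral_ge0// => s /F0; rewrite lee_fin.
pose W k := a k.+1 `^ p * expR (eps / 2 * bracket_sum k).
have W0 k : 0 <= W k by rewrite mulr_ge0 ?powR_ge0 ?expR_ge0.
(* On the interval of index 0 the bracket has no positive lower bound, so its
   term is left out here and added at the end. *)
pose c k := if k is 0%N then 0 else W k * 2 ^+ k * (a 1%N / 2).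
have c0 k : 0 <= c k.
  case: k => //= k; apply: mulr_ge0; last by rewrite divr_ge0// ltW.
  by apply: mulr_ge0; [exact: W0|exact: exprn_ge0].
have key n : (\sum_(k < n) c k / 2 ^+ k.+1) <= I.
  rewrite -lee_fin -IE.
  apply: dyadic_sum_le_integral => //.
  - move=> k kn s; rewrite /dyadic_itv /= !in_itv/= => /andP[h1 h2].
    by rewrite (lt_le_trans (dyadic_pt_gt0 k.+1) h1)/= (le_trans (ltW h2))// dyadic_pt_le1.
  move=> k s kn; rewrite /dyadic_itv /= in_itv/= => /andP[h1 h2].
  have s0 : 0 < s by rewrite (lt_le_trans (dyadic_pt_gt0 k.+1)).
  have s1 : s <= 1 by rewrite (le_trans (ltW h2))// dyadic_pt_le1.
  case: k kn h1 h2 => [|k] kn h1 h2.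
    by rewrite F0//= in_itv/= s0 s1.
  have hb := bracket_sqr_ge k.+1 s s0 (ltW h2).
  have hb1 : a 1%N / 2 <= bracket phi s.
    have hb2 : a 1%N ^+ 2 / 2 <= bracket phi s ^+ 2.
      apply: le_trans hb; rewrite ler_pM2r// /bracket_sum big_ord_recl lerDl.
      by apply: sumr_ge0 => i _; rewrite sqr_ge0.
    have b0 : 0 <= bracket phi s by exact: sqrtr_ge0.
    rewrite -(@ler_pXn2r _ 2) ?nnegrE ?divr_ge0 ?(ltW a1)//.
    apply: le_trans hb2; rewrite expr2; have := sqr_ge0 (a 1%N); rewrite expr2; lra.
  have -> : c k.+1 = a k.+2 `^ p * 2 ^+ k.+1 * (a 1%N / 2) * expR (eps / 2 * bracket_sum k.+1).
    by rewrite /c /W; ring.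
  apply: ler_pM; rewrite ?mulr_ge0 ?powR_ge0 ?exprn_ge0 ?invr_ge0 ?expR_ge0 ?(ltW a1)//.
    apply: ler_pM; rewrite ?mulr_ge0 ?powR_ge0 ?exprn_ge0 ?invr_ge0 ?(ltW a1)//.
    apply: ler_pM; rewrite ?powR_ge0 ?exprn_ge0//.
      apply: ge0_ler_powR; rewrite ?nnegrE ?(ltW p0)//.
      - exact: ltW (dyadic_value_gt0 _).
      - exact: ltW (phi_pos _ _ _).
      - by apply: phi_incr => //; exact: dyadic_pt_gt0.
    by rewrite -[leLHS]invrK lef_pV2 ?posrE// ?dyadic_pt_gt0// ltW.
  by rewrite ler_expR -mulrA ler_pM2l// mulrC.
exists (W 0%N + 4 / a 1%N * I) => n.
have I0 : 0 <= I by have := key 0%N; rewrite big_ord0.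
case: n => [|n].
  by rewrite big_ord0 addr_ge0// mulr_ge0// divr_ge0// ltW.
rewrite big_ord_recl lerD2l.
have := key n.+1; rewrite big_ord_recl mul0r add0r => h.
rewrite -ler_pdivrMl; last by rewrite divr_gt0.
apply: le_trans h; rewrite big_distrr/=; apply: ler_sum => k _.
rewrite -/(W _) /bump add1n le_eqVlt; apply/orP; left; apply/eqP.
by rewrite -/(W k.+1) !exprS; field; rewrite !gt_eqF ?exprn_gt0.
Qed.

End FromHypotheses.

(** * Exponential moments of the dyadic densities *)

Section CoshBound.
Context {R : realType}.

(** exp y + exp(- y) = 2 + (exp(y / 2) - exp(- y / 2))^2, and the difference
    is at most 2 y when 0 <= y <= 1. For y > 1 both exponentials are at most
    exp(2 y^2). *)
Lemma cosh_le_gaussian (y : R) : expR y + expR (- y) <= 2 * expR (2 * y ^+ 2).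
Proof.
wlog y0 : y / 0 <= y.
  move=> h; case: (lerP 0 y) => [|/ltW yn]; first exact: h.
  by rewrite addrC -{2}(opprK y) -(sqrrN y); apply: h; rewrite oppr_ge0.
have [y1|y1] := leP y 1; last first.
  have : expR (- y) <= expR (2 * y ^+ 2) by rewrite ler_expR expr2; nra.
  have : expR y <= expR (2 * y ^+ 2) by rewrite ler_expR expr2; nra.
  lra.
pose t := y / 2.
have t1 : `|t| <= 2^-1 by rewrite ger0_norm /t; lra.
have t1' : `|- t| <= 2^-1 by rewrite normrN.
have := norm_expR_sub1x _ t1; have := norm_expR_sub1x _ t1'.
rewrite sqrrN !ler_norml => /andP[l1 l2] /andP[l3 l4].
set u := expR t in l3 l4; set v := expR (- t) in l1 l2.
have uv : u * v = 1 by rewrite -expRD subrr expR0.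
have yt : expR y = u ^+ 2 by rewrite expr2 -expRD /t -splitr.
have yt' : expR (- y) = v ^+ 2 by rewrite expr2 -expRD /t -mulNr -splitr.
have d1 : u - v <= 2 * y.
  have : t ^+ 2 <= t / 2 by rewrite expr2 /t; nra.
  rewrite /t in l1 l2 l3 l4 *; lra.
have d2 : 0 <= u - v by rewrite subr_ge0 ler_expR /t; lra.
have : (u - v) ^+ 2 <= (2 * y) ^+ 2 by rewrite lerXn2r// nnegrE mulr_ge0.
have := expR_ge1Dx (2 * y ^+ 2); rewrite yt yt' sqrrB uv exprMn; lra.
Qed.

End CoshBound.

Section DyadicMartingale.
Context {R : realType}.
Variable mu : {finite_measure set (measurableTypeR R) -> \bar R}.
Local Notation m := (arc_mass mu).
Local Notation l := (@half_width R).
Variables (a : nat -> R) (C : R).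
Hypothesis a_gt0 : forall n, 0 < a n.
Hypothesis C_gt0 : 0 < C.
Hypothesis smooth : dyadic_smooth mu a C.

Definition node (n j : nat) : R := (2 * j%:R + 1) * l n.

(** 2 pi times the mean density of mu on the j-th dyadic arc of level n; a
    martingale in n, for the uniform measure on the circle. *)
Definition density (n j : nat) : R := 2 ^+ n * m (node n j - l n) (node n j + l n).

Lemma density0 : density 0 0 = mass mu.
Proof.
rewrite /density /node expr0 mul1r mulr0 add0r mul1r /half_width expr0 divr1.
by rewrite /arc_mass -[pi + pi](_ : pi - pi + 2 * pi = _) ?arc_full//; ring.
Qed.

(** The densities of the children are d + x and d - x, with |x| <= C * a n by
    smoothness. *)
Lemma density_children n j (lam : R) :
  expR (lam * density n.+1 (2 * j)) + expR (lam * density n.+1 (2 * j).+1) <=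
  expR (lam * density n j) * (2 * expR (2 * (lam * (C * a n)) ^+ 2)).
Proof.
set x := node n j - l n; set s := l n.
have s0 : 0 < s by exact: half_width_gt0.
have spi : s <= pi := half_width_le_pi n.
have ls : s = 2 * l n.+1 := half_widthS n.
have e1 : density n.+1 (2 * j) = 2 ^+ n.+1 * m x (x + s).
  by rewrite /density; congr (_ * m _ _); rewrite /x /s /node (half_widthS n) natrM; ring.
have e2 : density n.+1 (2 * j).+1 = 2 ^+ n.+1 * m (x + s) (x + s + s).
  by rewrite /density; congr (_ * m _ _); rewrite /x /s /node (half_widthS n) -(natr1 (2 * j)) natrM; ring.
have e3 : density n j = 2 ^+ n * (m x (x + s) + m (x + s) (x + s + s)).
  rewrite /density -(@arc_massD _ mu); try lra.
  by congr (_ * m _ _); rewrite /x /s; ring.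
have := smooth n x s s0 (lexx _).
set u := m x _ in e1 e3 *; set v := m _ (x + s + s) in e2 e3 * => uv.
rewrite e1 e2 e3 exprS.
pose del := lam * (2 ^+ n * (u - v)).
have -> : lam * (2 * 2 ^+ n * u) = lam * (2 ^+ n * (u + v)) + del by rewrite /del; ring.
have -> : lam * (2 * 2 ^+ n * v) = lam * (2 ^+ n * (u + v)) - del by rewrite /del; ring.
rewrite !expRD -mulrDr ler_pM2l ?expR_gt0//.
apply: (le_trans (cosh_le_gaussian _)).
rewrite ler_pM2l// ler_expR ler_pM2l//.
rewrite -[leLHS]real_normK ?num_real// -[leRHS]real_normK ?num_real//.
rewrite lerXn2r ?nnegrE// /del !normrM ler_wpM2l//.
have p0 : 0 < 2 ^+ n :> R by rewrite exprn_gt0.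
rewrite (gtr0_norm p0) (gtr0_norm C_gt0) (gtr0_norm (a_gt0 n)).
by rewrite mulrC -ler_pdivlMr.
Qed.

Lemma sum_pairs (f : nat -> R) N :
  \sum_(j < 2 * N) f j = \sum_(j < N) (f (2 * j)%N + f (2 * j).+1).
Proof.
elim: N => [|N IH]; first by rewrite muln0 !big_ord0.
have -> : (2 * N.+1 = (2 * N).+2)%N by lia.
by rewrite !big_ord_recr/= IH addrA.
Qed.

(** Azuma's argument: [density_children] multiplies the sum by at most
    2 exp(2 (lam C a n)^2) at each level. *)
Lemma exp_density_sum_le (lam : R) n : 
  \sum_(j < 2 ^ n) expR (lam * density n j) <=
  2 ^+ n * expR (lam * mass mu + 2 * (lam * C) ^+ 2 * \sum_(k < n) a k ^+ 2).
Proof.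
elim: n => [|n IH].
  by rewrite big_ord_recl !big_ord0 !addr0 expr0 mul1r mulr0 addr0 density0.
rewrite expnS (sum_pairs (fun j => expR (lam * density n.+1 j))).
apply: (@le_trans _ _ (\sum_(j < 2 ^ n) expR (lam * density n j) *
    (2 * expR (2 * (lam * (C * a n)) ^+ 2)))).
  by apply: ler_sum => j _; exact: density_children.
rewrite -big_distrl/=.
apply: (@le_trans _ _ (2 ^+ n * expR (lam * mass mu + 2 * (lam * C) ^+ 2 * \sum_(k < n) a k ^+ 2)
   * (2 * expR (2 * (lam * (C * a n)) ^+ 2)))).
  by rewrite ler_pM2r// mulr_gt0// expR_gt0.
rewrite big_ord_recr/= mulrDr addrA [in leRHS]expRD [2 ^+ n.+1]exprS.
rewrite le_eqVlt; apply/orP; left; apply/eqP.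
have -> : 2 * (lam * C) ^+ 2 * a n ^+ 2 = 2 * (lam * (C * a n)) ^+ 2 by ring.
by ring.
Qed.

(** Each arc of level k has 2 ^ (n - k) descendants at level n. A dilated
    point r z only sees the density of an ancestor of the arc of z. *)
Lemma exp_ancestor_density_sum_le (lam : R) k n : (k <= n)%N ->
  \sum_(j < 2 ^ n) expR (lam * density k (j %/ 2 ^ (n - k))) <=
  2 ^+ n * expR (lam * mass mu + 2 * (lam * C) ^+ 2 * \sum_(i < n) a i ^+ 2).
Proof.
move=> kn; have -> : n = (k + (n - k))%N by rewrite subnKC.
set d := (n - k)%N; rewrite addKn.
have -> : \sum_(j < 2 ^ (k + d)) expR (lam * density k (j %/ 2 ^ d)) =
    2 ^+ d * \sum_(j < 2 ^ k) expR (lam * density k j).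
  elim: d {kn} => [|d IH].
    rewrite addn0 expr0 mul1r; apply: eq_bigr => j _; by rewrite expn0 divn1.
  rewrite addnS expnS (sum_pairs (fun j => expR (lam * density k (j %/ 2 ^ d.+1)))).
  rewrite exprS -mulrA -IH mulrC -[2]/(1 + 1) mulrDr mulr1 -big_split/=.
  apply: eq_bigr => j _.
  have e1 : (2 * j %/ 2 ^ d.+1 = j %/ 2 ^ d)%N by rewrite expnS divnMl.
  have e2 : ((2 * j).+1 %/ 2 ^ d.+1 = j %/ 2 ^ d)%N.
    by rewrite expnS divnMA -addn1 [(2 * j)%N]mulnC divnMDl// addn0.
  by rewrite e1 e2.
set E2 := expR _.
have -> : 2 ^+ (k + d) * E2 = 2 ^+ d * (2 ^+ k * E2) by rewrite exprD; ring.
rewrite ler_pM2l ?exprn_gt0//; apply: (le_trans (exp_density_sum_le lam k)).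
rewrite ler_pM2l ?exprn_gt0// /E2.
rewrite ler_expR lerD2l; apply: ler_wpM2l; first by rewrite pmulr_rge0// sqr_ge0.
elim: d {E2} => [|d IH]; first by rewrite addn0.
by rewrite addnS big_ord_recr/= (le_trans IH)// lerDl sqr_ge0.
Qed.

End DyadicMartingale.

(** * Covering the disc by squares *)

Section Covering.
Local Open Scope complex_scope.
Context {R : realType}.
Implicit Types (z : Cplx R) (t rho : R).
Local Notation l := (@half_width R).

Lemma polar_form z : exists2 t : R, 0 <= t < 2 * pi & z = (modulus z)%:C * expi t.
Proof.
have hp := pi_gt0 R.
have [z0|z0] := eqVneq (modulus z) 0.
  exists 0; first by rewrite lexx mulr_gt0.
  by apply/eqP; rewrite z0 mul0r -modulus_eq0 z0.
set r := modulus z in z0 *.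
have r0 : 0 < r by rewrite lt_def z0 modulus_ge0.
have sq := sqr_modulus z; rewrite -/r in sq.
have := ler_Re_modulus z; rewrite -/r.
case: z @r z0 r0 sq => p q r z0 r0 /= sq pr.
pose c := p / r.
have c1 : -1 <= c <= 1.
  move: pr; rewrite ler_norml /c => /andP[h1 h2].
  by rewrite ler_pdivlMr// ler_pdivrMr// mul1r mulN1r h1 h2.
have [/andP[s0 s1] cs] := acos_def c1.
have pE : p = r * cos (acos c) by rewrite cs /c mulrCA divff ?mulr1.
have sE : (r * sin (acos c)) ^+ 2 = q ^+ 2.
  have h := cos2Dsin2 (acos c).
  have -> : q ^+ 2 = r ^+ 2 - p ^+ 2 by rewrite sq; ring.
  rewrite pE !exprMn.
  have -> : sin (acos c) ^+ 2 = 1 - cos (acos c) ^+ 2 by rewrite -h; ring.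
  by ring.
have sn0 : 0 <= r * sin (acos c) by rewrite mulr_ge0 ?(ltW r0)// sin_ge0_pi// s0.
have [q0|q0] := leP 0 q.
  exists (acos c); first by rewrite s0/=; lra.
  have qE : r * sin (acos c) = q by apply/eqP; rewrite -(eqrXn2 (n := 2))// sE.
  apply/eqP; rewrite eq_complex/= !mul0r subr0 addr0 -pE qE !eqxx//.
have qE : r * sin (acos c) = - q.
  by apply/eqP; rewrite -(eqrXn2 (n := 2)) ?sqrrN ?sE// oppr_ge0 ltW.
have sp : 0 < acos c.
  rewrite lt_def s0 andbT; apply/eqP => h; move: qE; rewrite h sin0 mulr0; lra.
exists (2 * pi - acos c); first by lra.
have cE : cos (2 * pi - acos c) = cos (acos c).
  by rewrite addrC mulr_natl cosD2pi cosN.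
have siE : sin (2 * pi - acos c) = - sin (acos c).
  by rewrite addrC mulr_natl sinD2pi sinN.
apply/eqP; rewrite eq_complex/= !mul0r subr0 addr0 cE siE -pE mulrN qE opprK !eqxx//.
Qed.

(** A polar Whitney box, with the argument of the point recorded. *)
Definition located (z : Cplx R) (n j : nat) (t : R) :=
  [/\ (j < 2 ^ n)%N, (2 ^+ n.+1)^-1 <= 1 - modulus z, 1 - modulus z <= (2 ^+ n)^-1,
      z = (modulus z)%:C * expi t & 2 * j%:R * l n <= t < 2 * j.+1%:R * l n].

Lemma half_width_pow n : 2 ^+ n * l n = pi.
Proof. by rewrite /half_width mulrCA divff ?mulr1// expf_neq0. Qed.

Lemma locate z : modulus z < 1 -> exists n j t, located z n j t.
Proof.
move=> z1; set e := 1 - modulus z.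
have e0 : 0 < e by rewrite subr_gt0.
have e1 : e <= 1 by rewrite gerBl modulus_ge0.
have ex : exists n, (2 ^+ n.+1)^-1 <= e.
  exists (Num.trunc e^-1); rewrite -[leRHS]invrK lef_pV2 ?posrE ?exprn_gt0 ?invr_gt0//.
  rewrite (le_trans (ltW (truncnS_gt _)))// -natrX ler_nat ltnW// ltn_expl//.
pose n := ex_minn ex.
have [n1 n2] : (2 ^+ n.+1)^-1 <= e /\ e <= (2 ^+ n)^-1.
  rewrite /n; case: ex_minnP => k k1 kmin; split => //.
  case: k k1 kmin => [|k] k1 kmin; first by rewrite expr0 invr1.
  by rewrite leNgt; apply/negP => h; have := kmin k (ltW h); rewrite ltnn.
have [t /andP[t0 t1] zt] := polar_form z.
have l0 := half_width_gt0 (R := R) n.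
have l20 : 0 < 2 * l n by lra.
pose j := Num.trunc (t / (2 * l n)).
have tl0 : 0 <= t / (2 * l n) by rewrite divr_ge0// mulr_ge0// ltW.
have j1 : j%:R <= t / (2 * l n) by rewrite truncn_le.
have j2 : t / (2 * l n) < j.+1%:R by rewrite truncnS_gt.
exists n, j, t; split => //.
  rewrite -(ltr_nat R) natrX (le_lt_trans j1)// ltr_pdivrMr//.
  by rewrite mulrCA half_width_pow.
rewrite ler_pdivlMr// in j1; rewrite ltr_pdivrMr// in j2.
by apply/andP; split; lra.
Qed.

(** The distance is at most 2 / 2^n radially and 2 * l n <= 8 / 2^n along the
    circle. *)
Lemma near_node (n j : nat) t rho : rho <= 1 ->
  1 - rho <= 2 / 2 ^+ n -> 2 * j%:R * l n <= t < 2 * j.+1%:R * l n ->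
  modulus (rho%:C * expi t - expi (node n j)) <= 10 / 2 ^+ n.
Proof.
move=> rho1 rhon /andP[t1 t2].
have l0 := half_width_gt0 (R := R) n.
have -> : rho%:C * expi t - expi (node n j) =
  (rho - 1)%:C * expi t + (expi t - expi (node n j)).
  by rewrite rmorphB rmorph1; ring.
apply: (le_trans (modulusD _ _)).
have h1 : modulus ((rho - 1)%:C * expi t) <= 2 / 2 ^+ n.
  by rewrite modulusM modulus_expi mulr1 modulus_real distrC ger0_norm ?subr_ge0.
have h2 : `|t - node n j| <= l n.
  by rewrite /node ler_norml; move: t1 t2; rewrite -natr1; lra.
have h3 := modulus_expiB t (node n j).
have h4 : l n <= 4 / 2 ^+ n.
  by rewrite ler_pM2r ?invr_gt0 ?exprn_gt0// ltW// pi_lt4.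
lra.
Qed.

Lemma ancestor_itv (k n j : nat) t : (k <= n)%N ->
  2 * j%:R * l n <= t < 2 * j.+1%:R * l n ->
  2 * (j %/ 2 ^ (n - k))%:R * l k <= t < 2 * (j %/ 2 ^ (n - k)).+1%:R * l k.
Proof.
move=> kn /andP[t1 t2]; set d := (n - k)%N; set i := (j %/ 2 ^ d)%N.
have lk : l k = (2 ^ d)%:R * l n.
  have p0 : 2 ^+ k != 0 :> R by rewrite expf_neq0.
  apply: (mulfI p0); rewrite half_width_pow mulrA natrX -exprD subnKC//.
  by rewrite half_width_pow.
have l0 := half_width_gt0 (R := R) n.
have i1 : (i * 2 ^ d <= j)%N by exact: leq_divM.
have i2 : (j.+1 <= i.+1 * 2 ^ d)%N by rewrite ltn_ceil// expn_gt0.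
rewrite -(ler_nat R) natrM in i1; rewrite -(ler_nat R) natrM in i2.
have l20 : 0 < 2 * l n by lra.
rewrite lk; set q := (2 ^ d)%:R in i1 i2 *; apply/andP; split.
  apply: le_trans t1.
  have -> : 2 * i%:R * (q * l n) = 2 * l n * (i%:R * q) by ring.
  by rewrite [leRHS]mulrAC ler_pM2l.
apply: (lt_le_trans t2).
have -> : 2 * i.+1%:R * (q * l n) = 2 * l n * (i.+1%:R * q) by ring.
by rewrite [leLHS]mulrAC ler_pM2l.
Qed.

Definition square (c : Cplx R) (s : R) : set (measurableTypeR R * measurableTypeR R) :=
  `[complex.Re c - s, complex.Re c + s]%classic `*` `[complex.Im c - s, complex.Im c + s]%classic.

Lemma measurable_square c s : measurable (square c s).
Proof. by apply: measurableX; exact: measurable_itv. Qed.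

Lemma area_square c s : 0 < s ->
  (lebesgue_measure \x lebesgue_measure)%E (square c s) = ((2 * s) ^+ 2)%:E :> \bar R.
Proof.
move=> s0.
have side (x : R) : lebesgue_measure (`[x - s, x + s]%classic : set R) = (2 * s)%:E :> \bar R.
  rewrite lebesgue_measure_itv/= lte_fin.
  have -> : x - s < x + s by lra.
  by rewrite -EFinB; congr EFin; ring.
rewrite [LHS]product_measure1E//; try exact: measurable_itv.
transitivity ((2 * s)%:E * (2 * s)%:E)%E; first by congr (_ * _)%E; exact: side.
by rewrite -EFinM -expr2.
Qed.

Lemma mem_square c s (w : measurableTypeR R * measurableTypeR R) :
  modulus (w.1 +i* w.2 - c : Cplx R) <= s -> square c s w.
Proof.
case: c => p q ws; have h1 := le_trans (ler_Re_modulus _) ws.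
have h2 := le_trans (ler_Im_modulus _) ws.
move: h1 h2; rewrite /= !ler_norml => /andP[h1 h2] /andP[h3 h4].
by split; rewrite /= in_itv/=; apply/andP; split; lra.
Qed.

(** Each box lies in a square of side 20 / 2^n centred at its node, so the
    integrand is below a countable sum of multiples of indicators of squares.
    Squares have an explicit planar measure, which spares polar coordinates. *)
Lemma integral_disc_le (G : measurableTypeR R * measurableTypeR R -> R)
    (c : nat -> nat -> R) (K V : R) (n0 : nat) :
  0 <= K -> (forall n j, 0 <= c n j) -> (forall w, planar_disc R w -> 0 <= G w) ->
  (forall w n j t, located (w.1 +i* w.2) n j t -> (n0 <= n)%N -> G w <= c n j) ->
  (forall w, planar_disc R w -> (2 ^+ n0)^-1 <= 1 - modulus (w.1 +i* w.2 : Cplx R) -> G w <= K) ->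
  (forall N, \sum_(n < N) \sum_(j < 2 ^ n) c n j * 400 / 4 ^+ n <= V) ->
  (\int[lebesgue_measure \x lebesgue_measure]_(w in planar_disc R) (G w)%:E
     <= (4 * K + V)%:E)%E.
Proof.
move=> K0 c0 G0 Gfar Gcore cV.
set nu := (lebesgue_measure \x lebesgue_measure)%E.
pose B n j := square (expi (node n j)) (10 / 2 ^+ n).
have areaE (e : Cplx R) s : 0 < s -> nu (square e s) = ((2 * s) ^+ 2)%:E.
  by move=> s0; exact: area_square.
have mI (A : set (measurableTypeR R * measurableTypeR R)) (x : R) :
    measurable A -> measurable_fun setT (fun w => (x * \1_A w)%:E).
  move=> mA; apply/measurable_EFinP; apply: measurable_funM; first exact: measurable_cst.
  exact: measurable_indic.
have iI (A : set (measurableTypeR R * measurableTypeR R)) (x : R) : measurable A -> 0 <= x ->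
    (\int[nu]_w (x * \1_A w)%:E = x%:E * nu A)%E.
  move=> mA x0; under eq_integral do rewrite EFinM.
  rewrite ge0_integralZl_EFin//; last by apply/measurable_EFinP; exact: measurable_indic.
  by rewrite integral_indic// setIT.
pose f n w := (\sum_(j < 2 ^ n) (c n j * \1_(B n j) w)%:E)%E.
have mf n : measurable_fun setT (f n).
  by apply: emeasurable_sum => j; apply: mI; exact: measurable_square.
have f0 n w : (0 <= f n w)%E.
  by apply: sume_ge0 => j _; rewrite lee_fin mulr_ge0.
have intf n : (\int[nu]_w f n w = (\sum_(j < 2 ^ n) c n j * 400 / 4 ^+ n)%:E)%E.
  rewrite /f ge0_integral_sum//; last 2 first.
  - by move=> j; apply: mI; exact: measurable_square.
  - by move=> j w _; rewrite lee_fin mulr_ge0.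
  rewrite -sumEFin; apply: eq_bigr => j _.
  rewrite iI//; last exact: measurable_square.
  rewrite areaE; last by rewrite divr_gt0// exprn_gt0.
  rewrite -EFinM; congr EFin.
  rewrite (_ : 4 = 2 * 2); last by ring.
  by rewrite !exprMn exprVn; field; rewrite expf_neq0.
pose core w := (K * \1_(square 0 1) w)%:E.
have intcore : (\int[nu]_w core w = (4 * K)%:E)%E.
  rewrite /core iI//; last exact: measurable_square.
  by rewrite areaE// -EFinM; congr EFin; ring.
have disc1 w : planar_disc R w -> square 0 1 w.
  by rewrite /planar_disc/= => h; apply: mem_square; rewrite subr0 ltW.
rewrite integral_mkcond.
apply: (@le_trans _ _ (\int[nu]_w (core w + \sum_(n <oo) f n w))%E).
  apply: ge0_le_integral_dominated => w _.
    by rewrite patchE; case: ifPn => // /set_mem wD; rewrite lee_fin G0.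
  have S0 : (0 <= \sum_(n <oo) f n w)%E by apply: nneseries_ge0 => n _ _.
  have core0 : (0 <= core w)%E by rewrite lee_fin mulr_ge0.
  rewrite patchE; case: ifPn => [/set_mem wD|_]; last by rewrite adde_ge0.
  have [n [j [t loc]]] := locate (w.1 +i* w.2) wD.
  have [jn zn1 zn2 zt tj] := loc.
  have [n0n|nn0] := leqP n0 n.
    rewrite -[X in (X <= _)%E]add0e; apply: leeD => //.
    apply: le_trans (nneseries_lim_ge n.+1 _); last by move=> *.
    rewrite big_mkord big_ord_recr/=.
    rewrite -[X in (X <= _)%E]add0e; apply: leeD; first by apply: sume_ge0.
    rewrite /f (bigD1 (Ordinal jn))//=.
    rewrite -[X in (X <= _)%E]adde0; apply: leeD; last first.
      by apply: sume_ge0 => i _; rewrite lee_fin mulr_ge0.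
    rewrite lee_fin indicE mem_set ?mulr1; first exact: Gfar loc n0n.
    apply: mem_square; rewrite zt; apply: near_node => //; first exact: ltW.
    by rewrite (le_trans zn2)// -[leLHS]mul1r ler_pM2r ?invr_gt0 ?exprn_gt0// ler1n.
  rewrite -[X in (X <= _)%E]adde0; apply: leeD => //.
  rewrite lee_fin indicE mem_set ?mulr1; last exact: disc1.
  apply: Gcore => //; apply: le_trans zn1; exact: dyadic_pt_le.
rewrite ge0_integralD//; last 4 first.
- by move=> w _; rewrite lee_fin mulr_ge0.
- by apply: mI; exact: measurable_square.
- by move=> w _; apply: nneseries_ge0 => n _ _.
- by apply: ge0_emeasurable_sum => // n; exact: mf.
rewrite intcore integral_nneseries// EFinD leeD2l//.
apply: lime_le; first by apply: is_cvg_nneseries => n _ _; apply: integral_ge0.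
apply: nearW => N; rewrite big_mkord.
under eq_bigr do rewrite intf.
by rewrite sumEFin lee_fin.
Qed.

End Covering.

(** * Analyticity and Taylor polynomials of the Herglotz integral *)

Section HerglotzAnalytic.
Local Open Scope complex_scope.
Context {R : realType}.
Variable mu : {finite_measure set (measurableTypeR R) -> \bar R}.
Notation Re := complex.Re.
Notation Im := complex.Im.
Implicit Types (z w h : Cplx R) (t : R).
Local Notation H := (herglotz mu).
Local Notation dH := (dherglotz mu).
Local Notation cint := (cintegral mu (circle_angles R)).
Local Notation M := (mass mu).

Lemma cintegral_dist_le (f g : R -> Cplx R) (B : R) : bcont f -> bcont g ->
  (forall t, modulus (f t - g t) <= B) ->
  modulus (cint f - cint g) <= 2 * B * M.
Proof.
move=> fb gb fg; have mC := @measurable_circle_angles R.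
rewrite -cintegralB//; apply: modulus_cintegral_le => //.
exact: bcontB.
Qed.

Lemma cintegral_circleZ (f : R -> Cplx R) (c : Cplx R) : bcont f ->
  cint (fun t => c * f t) = c * cint f.
Proof. by move=> fb; apply: cintegralZ => //; exact: measurable_circle_angles. Qed.

Lemma herglotz0 : H 0 = M%:C.
Proof.
rewrite /herglotz; have -> : herglotz_kernel 0 = fun=> (1 : Cplx R).
  by apply/funext => t; rewrite /herglotz_kernel addr0 subr0 divff// expi_neq0.
rewrite cintegral_cst ?mul1r//; exact: measurable_circle_angles.
Qed.

Lemma expi_sub_ge z t (d : R) : modulus z <= 1 - d -> d <= modulus (expi t - z).
Proof. by move=> zd; apply: le_trans (modulus_expi_sub_ge z t); lra. Qed.

Lemma modulus_herglotz_le z (d : R) : 0 < d -> d <= 1 -> modulus z <= 1 - d ->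
  modulus (H z) <= 4 / d * M.
Proof.
move=> d0 d1 zd; have z1 : modulus z < 1 by lra.
have -> : 4 / d * M = 2 * (2 / d) * M by ring.
apply: modulus_cintegral_le; [exact: measurable_circle_angles|exact: bcont_herglotz_kernel|].
move=> t _; rewrite modulusM modulusV; apply: ler_pM; rewrite ?modulus_ge0 ?invr_ge0 ?modulus_ge0//.
  by rewrite (le_trans (modulusD _ _))// modulus_expi; lra.
by rewrite lef_pV2 ?posrE// ?(lt_le_trans d0)// expi_sub_ge.
Qed.

Lemma modulus_dherglotz_crude z (d : R) : 0 < d -> d <= 1 -> modulus z <= 1 - d ->
  modulus (dH z) <= 4 / d ^+ 2 * M.
Proof.
move=> d0 d1 zd; have z1 : modulus z < 1 by lra.
have -> : 4 / d ^+ 2 * M = 2 * (2 / d ^+ 2) * M by ring.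
apply: modulus_cintegral_le; [exact: measurable_circle_angles|exact: bcont_dherglotz_kernel|].
move=> t _; rewrite !modulusM modulusV modulusX modulus_nat modulus_expi mulr1 ler_pM2l//.
have h := expi_sub_ge z t d zd.
rewrite lef_pV2 ?posrE ?exprn_gt0// ?(lt_le_trans d0)//.
by rewrite lerXn2r// ?nnegrE ?modulus_ge0// ltW.
Qed.

Lemma dherglotz_lipschitz z w (d : R) : 0 < d -> modulus z <= 1 - d -> modulus w <= 1 - d ->
  modulus (dH w - dH z) <= 8 / d ^+ 3 * M * modulus (w - z).
Proof.
move=> d0 zd wd; have z1 : modulus z < 1 by lra. have w1 : modulus w < 1 by lra.
have -> : 8 / d ^+ 3 * M * modulus (w - z) = 2 * (4 / d ^+ 3 * modulus (w - z)) * M by ring.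
apply: cintegral_dist_le; [exact: bcont_dherglotz_kernel..|] => t.
set u := expi t - z; set v := expi t - w.
have u0 : u != 0 by exact: expi_sub_neq0.
have v0 : v != 0 by exact: expi_sub_neq0.
have ud : d <= modulus u by exact: expi_sub_ge.
have vd : d <= modulus v by exact: expi_sub_ge.
have -> : dherglotz_kernel w t - dherglotz_kernel z t =
   2 * expi t * (w - z) * ((u ^+ 2 * v)^-1 + (u * v ^+ 2)^-1).
  rewrite /dherglotz_kernel -/u -/v.
  have -> : w - z = u - v by rewrite /u /v; ring.
  by field; rewrite u0 v0.
have mu0 : 0 < modulus u by rewrite (lt_le_trans d0).
have mv0 : 0 < modulus v by rewrite (lt_le_trans d0).
rewrite !modulusM modulus_nat modulus_expi mulr1.
have b1 : modulus (u ^+ 2 * v)^-1 <= (d ^+ 3)^-1.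
  rewrite modulusV modulusM modulusX lef_pV2 ?posrE ?mulr_gt0 ?exprn_gt0// exprSr.
  by rewrite ler_pM ?exprn_ge0 ?(ltW d0)// lerXn2r// ?nnegrE ltW.
have b2 : modulus (u * v ^+ 2)^-1 <= (d ^+ 3)^-1.
  rewrite modulusV modulusM modulusX lef_pV2 ?posrE ?mulr_gt0 ?exprn_gt0// exprS.
  by rewrite ler_pM ?exprn_ge0 ?(ltW d0)// lerXn2r// ?nnegrE ltW.
have -> : 4 / d ^+ 3 * modulus (w - z) = 2 * modulus (w - z) * ((d ^+ 3)^-1 + (d ^+ 3)^-1) by ring.
apply: ler_wpM2l; first by rewrite mulr_ge0 ?modulus_ge0.
by rewrite (le_trans (modulusD _ _))// lerD.
Qed.

Lemma qderiv_herglotz z : modulus z < 1 -> qderiv H z (dH z).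
Proof.
move=> z1.
have [d d0 dE] : exists2 d : R, 0 < d & 2 * d = 1 - modulus z.
  by exists ((1 - modulus z) / 2); lra.
exists d => //; exists (4 / d ^+ 3 * M) => h hd.
have wd : modulus (z + h) <= 1 - d.
  by rewrite (le_trans (modulusD _ _))//; lra.
have zd : modulus z <= 1 - d by lra.
have w1 : modulus (z + h) < 1 by lra.
have bd := bcont_dherglotz_kernel z z1.
have bz := bcont_herglotz_kernel z z1.
have bw := bcont_herglotz_kernel (z + h) w1.
have -> : H (z + h) - H z - dH z * h =
   cint (herglotz_kernel (z + h)) - cint (fun t => herglotz_kernel z t + h * dherglotz_kernel z t).
  rewrite cintegralD//; [|exact: measurable_circle_angles|by apply: bcontM => //; exact: bcont_cst].
  by rewrite cintegral_circleZ// [h * _]mulrC opprD addrA.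
have -> : 4 / d ^+ 3 * M * modulus h ^+ 2 = 2 * (2 * modulus h ^+ 2 / d ^+ 3) * M by ring.
apply: cintegral_dist_le => //.
  by apply: bcontD => //; apply: bcontM => //; exact: bcont_cst.
move=> t; set u := expi t - z; set v := expi t - (z + h).
have u0 : u != 0 by exact: expi_sub_neq0.
have v0 : v != 0 by exact: expi_sub_neq0.
have ud : d <= modulus u by exact: expi_sub_ge.
have vd : d <= modulus v by exact: expi_sub_ge.
have mu0 : 0 < modulus u by rewrite (lt_le_trans d0).
have mv0 : 0 < modulus v by rewrite (lt_le_trans d0).
have -> : herglotz_kernel (z + h) t - (herglotz_kernel z t + h * dherglotz_kernel z t) =
   2 * expi t * h ^+ 2 * (u ^+ 2 * v)^-1.
  rewrite /herglotz_kernel /dherglotz_kernel -/u -/v.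
  have -> : h = u - v by rewrite /u /v; ring.
  have -> : z = expi t - u by rewrite /u; ring.
  by field; rewrite u0 v0.
rewrite modulusM (modulusM (2 * expi t)) (modulusM 2) (modulusX h) modulus_nat modulus_expi mulr1.
apply: ler_wpM2l; first by rewrite mulr_ge0 ?sqr_ge0.
rewrite modulusV modulusM modulusX lef_pV2 ?posrE ?mulr_gt0 ?exprn_gt0// exprSr.
by rewrite ler_pM ?exprn_ge0 ?(ltW d0)// lerXn2r// ?nnegrE ltW.
Qed.

Lemma geometric_sum (v : Cplx R) N :
  (1 - v) * \sum_(k < N) v ^+ k.+1 = v - v ^+ N.+1.
Proof.
elim: N => [|N IH]; first by rewrite big_ord0 mulr0 expr1 subrr.
by rewrite big_ord_recr/= mulrDr IH !exprS; ring.
Qed.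

Lemma geometric_sum_deriv (v : Cplx R) N :
  (1 - v) ^+ 2 * \sum_(k < N) k.+1%:R * v ^+ k = 1 - N.+1%:R * v ^+ N + N%:R * v ^+ N.+1.
Proof.
elim: N => [|N IH]; first by rewrite big_ord0 mulr0 expr0 mul0r addr0 mulr1 subrr.
by rewrite big_ord_recr/= mulrDr IH !exprS -!natr1; ring.
Qed.

(** With s = sqrt r, N * s ^+ N is below the sum of the geometric series of s
    and the remaining factor s ^+ N tends to 0. *)
Lemma exists_small_power (r e : R) : 0 < r -> r < 1 -> 0 < e ->
  exists N : nat, (2 * N%:R + 1) * r ^+ N <= e.
Proof.
move=> r0 r1 e0.
pose s := Num.sqrt r.
have s0 : 0 < s by rewrite sqrtr_gt0.
have s1 : s < 1 by rewrite -(sqrtr1 R) ltr_sqrt.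
have rs : r = s ^+ 2 by rewrite sqr_sqrtr// ltW.
have key N : N%:R * s ^+ N <= (1 - s)^-1.
  apply: le_trans (sum_geometric_le s N s0 s1).
  rewrite mulr_natl -[X in _ *+ X]card_ord -sumr_const; apply: ler_sum => i _.
  by rewrite ler_wiXn2l ?(ltW s0) ?(ltW s1)// ltnW.
have c0 : 0 < 2 / (1 - s) + 1 by rewrite addr_gt0// divr_gt0// subr_gt0.
have [N hN] : exists N, s ^+ N <= e / (2 / (1 - s) + 1).
  have : (fun n => s ^+ n) @ \oo --> (0 : R).
    by apply: cvg_expr; rewrite ger0_norm// ltW.
  move=> /cvgrPdist_le /(_ (e / (2 / (1 - s) + 1))).
  rewrite divr_gt0// => /(_ isT) [N _ hN]; exists N.
  by have := hN N (leqnn N); rewrite /= sub0r normrN ger0_norm// exprn_ge0// ltW.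
exists N; rewrite rs -exprM mulnC mulnS muln1 exprD mulrA.
have sN : 0 <= s ^+ N by rewrite exprn_ge0// ltW.
have sN1 : s ^+ N <= 1 by rewrite exprn_ile1// ltW.
apply: (@le_trans _ _ ((2 / (1 - s) + 1) * s ^+ N)).
  by rewrite ler_wpM2r//; have := key N; lra.
by rewrite mulrC -ler_pdivlMr.
Qed.

(** Taylor polynomials: the kernel at r z is 1 + 2 (v + v^2 + ...) with
    v = r z / exp(i t) and |v| <= r, and the truncation errors of this series and
    of its derivative are explicit and uniform in t. *)
Lemma herglotz_poly (r e : R) : 0 < r -> r < 1 -> 0 < e ->
  exists h : {poly Cplx R}, h.[0] = 0 /\ forall z, modulus z < 1 ->
    modulus (h.[z] - (H (r%:C * z) - M%:C)) <= e /\
    modulus (h^`().[z] - r%:C * dH (r%:C * z)) <= e.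
Proof.
move=> r0 r1 e0.
have M0 : 0 <= M by exact: mass_ge0.
have q0 : 0 < 1 - r by rewrite subr_gt0.
have c0 : 0 < 4 * M / (1 - r) ^+ 2 + 1.
  by rewrite ltr_wpDl// divr_ge0 ?sqr_ge0// mulr_ge0.
have [N hN] := exists_small_power r (e / (4 * M / (1 - r) ^+ 2 + 1)) r0 r1 (divr_gt0 e0 c0).
pose E k t : Cplx R := (expi t)^-1 ^+ k.
have Eb k : bcont (E k).
  apply: bcontX; apply: (bcontV _ 1) => //; first by move=> t; rewrite modulus_expi.
  exact: bcont_expi.
pose c k : Cplx R := 2 * r%:C ^+ k.+1 * cint (E k.+1).
pose h : {poly Cplx R} := \sum_(k < N) c k *: 'X^(k.+1).
have hz z : h.[z] = \sum_(k < N) c k * z ^+ k.+1.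
  by rewrite /h horner_sum; apply: eq_bigr => k _; rewrite hornerZ hornerXn.
have dhz z : h^`().[z] = \sum_(k < N) c k * (k.+1%:R * z ^+ k).
  rewrite /h raddf_sum horner_sum; apply: eq_bigr => k _.
  by rewrite /= derivZ derivXn hornerZ hornerMn hornerXn -mulr_natl.
exists h; split.
  by rewrite hz big1// => k _; rewrite exprS mul0r mulr0.
move=> z z1; set w := r%:C * z.
have wr : modulus w <= r.
  by rewrite modulusM modulus_real gtr0_norm// ler_piMr// ltW.
have w1 : modulus w < 1 by lra.
have mC := @measurable_circle_angles R.
pose v t := w * (expi t)^-1.
have vr t : modulus (v t) <= r by rewrite modulusM modulusV modulus_expi invr1 mulr1.
have v1 t : 1 - r <= modulus (1 - v t).
  have := modulusD (1 - v t) (v t); rewrite subrK modulus1; have := vr t; lra.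
have nv t : 1 - v t != 0 by rewrite -modulus_gt0 (lt_le_trans q0).
have pw t k : modulus (v t ^+ k) <= r ^+ k.
  by rewrite modulusX lerXn2r// ?nnegrE ?modulus_ge0// ltW.
have rN : 0 <= r ^+ N by rewrite exprn_ge0// ltW.
have final : 2 * (2 * (2 * N%:R + 1) * r ^+ N / (1 - r) ^+ 2) * M <= e.
  have -> : 2 * (2 * (2 * N%:R + 1) * r ^+ N / (1 - r) ^+ 2) * M =
     (4 * M / (1 - r) ^+ 2) * ((2 * N%:R + 1) * r ^+ N) by ring.
  have h1 : (2 * N%:R + 1) * r ^+ N * (4 * M / (1 - r) ^+ 2 + 1) <= e by rewrite -ler_pdivlMr.
  apply: le_trans h1; rewrite mulrC ler_wpM2l ?lerDl//.
  by rewrite mulr_ge0// addr_ge0// mulr_ge0.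
have q1 : 1 - r <= 1 by lra.
split.
- have [sb se] := cintegral_sum mu _ N (fun k t => 2 * w ^+ k.+1 * E k.+1 t) mC
    (fun k => bcontM _ _ (bcont_cst _) (Eb k.+1)).
  have -> : h.[z] = cint (fun t => \sum_(k < N) 2 * w ^+ k.+1 * E k.+1 t).
    rewrite se hz; apply: eq_bigr => k _; rewrite cintegral_circleZ// /c /w exprMn.
    by ring.
  have -> : H w - M%:C = cint (fun t => herglotz_kernel w t - 1).
    rewrite cintegralB//; [|exact: bcont_herglotz_kernel|exact: bcont_cst].
    by rewrite cintegral_cst// mul1r.
  apply: le_trans final; apply: cintegral_dist_le => //.
    by apply: bcontB; [exact: bcont_herglotz_kernel|exact: bcont_cst].
  move=> t.
  have -> : \sum_(k < N) 2 * w ^+ k.+1 * E k.+1 t = 2 * \sum_(k < N) v t ^+ k.+1.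
    rewrite big_distrr/=; apply: eq_bigr => k _.
    by rewrite /v /E [(w * _) ^+ _]exprMn; ring.
  have -> : herglotz_kernel w t - 1 = 2 * v t / (1 - v t).
    have e0' := expi_neq0 t; have e1 := expi_sub_neq0 w t w1.
    have -> : 1 - v t = (expi t - w) / expi t by rewrite /v; field.
    by rewrite /herglotz_kernel /v; field; rewrite e0' e1.
  have -> : 2 * (\sum_(k < N) v t ^+ k.+1) - 2 * v t / (1 - v t) = - (2 * v t ^+ N.+1 / (1 - v t)).
    have -> : \sum_(k < N) v t ^+ k.+1 = (v t - v t ^+ N.+1) / (1 - v t).
      by rewrite -geometric_sum mulrAC divff ?mul1r.
    by field.
  rewrite modulusN !modulusM modulus_nat modulusV.
  apply: (@le_trans _ _ (2 * r ^+ N / (1 - r) ^+ 2)).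
    rewrite -!mulrA ler_pM2l//; apply: ler_pM; rewrite ?modulus_ge0 ?invr_ge0 ?modulus_ge0//.
      rewrite (le_trans (pw t N.+1))// exprS ler_piMl// ltW//.
    rewrite lef_pV2 ?posrE ?exprn_gt0 ?(lt_le_trans q0 (v1 t))//.
    by rewrite expr2 (le_trans _ (v1 t))// ler_piMr// ltW.
  rewrite ler_pM2r ?invr_gt0 ?exprn_gt0// ler_wpM2r//.
  by have : 0 <= N%:R :> R by []; lra.
- have [sb se] := cintegral_sum mu _ N (fun k t => 2 * r%:C * k.+1%:R * w ^+ k * E k.+1 t) mC
    (fun k => bcontM _ _ (bcont_cst _) (Eb k.+1)).
  have -> : h^`().[z] = cint (fun t => \sum_(k < N) 2 * r%:C * k.+1%:R * w ^+ k * E k.+1 t).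
    rewrite se dhz; apply: eq_bigr => k _; rewrite cintegral_circleZ// /c /w exprMn exprS.
    by ring.
  rewrite -cintegral_circleZ; last exact: bcont_dherglotz_kernel.
  apply: le_trans final; apply: cintegral_dist_le => //.
    by apply: bcontM; [exact: bcont_cst|exact: bcont_dherglotz_kernel].
  move=> t.
  have e0' := expi_neq0 t; have e1 := expi_sub_neq0 w t w1.
  have -> : \sum_(k < N) 2 * r%:C * k.+1%:R * w ^+ k * E k.+1 t =
     2 * r%:C / expi t * \sum_(k < N) k.+1%:R * v t ^+ k.
    rewrite big_distrr/=; apply: eq_bigr => k _.
    by rewrite /v /E [(w * _) ^+ _]exprMn exprS; ring.
  have -> : r%:C * dherglotz_kernel w t = 2 * r%:C / expi t / (1 - v t) ^+ 2.
    have -> : 1 - v t = (expi t - w) / expi t by rewrite /v; field.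
    by rewrite /dherglotz_kernel; field; rewrite e0' e1.
  have -> : \sum_(k < N) k.+1%:R * v t ^+ k =
      (1 - N.+1%:R * v t ^+ N + N%:R * v t ^+ N.+1) / (1 - v t) ^+ 2.
    by rewrite -geometric_sum_deriv mulrAC divff ?mul1r// expf_neq0.
  set A := 2 * r%:C / expi t; set num := 1 - _ + _.
  have -> : A * (num / (1 - v t) ^+ 2) - A / (1 - v t) ^+ 2 =
      A * (num - 1) * (1 - v t)^-1 ^+ 2 by rewrite exprVn; ring.
  rewrite (modulusM (A * _)) (modulusM A) modulusX modulusV.
  have -> : modulus A = 2 * r.
    rewrite /A (modulusM (2 * _)) (modulusM 2) modulusV modulus_nat modulus_expi modulus_real.
    by rewrite invr1 mulr1 gtr0_norm.
  rewrite /num {A num}.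
  have top : modulus (1 - N.+1%:R * v t ^+ N + N%:R * v t ^+ N.+1 - 1) <= (2 * N%:R + 1) * r ^+ N.
    have -> : 1 - N.+1%:R * v t ^+ N + N%:R * v t ^+ N.+1 - 1 =
       N%:R * v t ^+ N.+1 - N.+1%:R * v t ^+ N by ring.
    apply: (le_trans (modulusB _ _)); rewrite !modulusM !modulus_nat.
    have p1 : modulus (v t ^+ N.+1) <= r ^+ N.
      by rewrite (le_trans (pw t N.+1))// exprS ler_piMl// ltW.
    have -> : (2 * N%:R + 1) * r ^+ N = N%:R * r ^+ N + N.+1%:R * r ^+ N.
      by rewrite -(natr1 N); ring.
    by apply: lerD; rewrite ler_wpM2l.
  have -> : 2 * (2 * N%:R + 1) * r ^+ N / (1 - r) ^+ 2 = 2 * ((2 * N%:R + 1) * r ^+ N) / (1 - r) ^+ 2 by ring.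
  apply: ler_pM.
  - by rewrite !mulr_ge0 ?modulus_ge0// ltW.
  - by rewrite exprn_ge0// invr_ge0 modulus_ge0.
  - apply: ler_pM => //; rewrite ?modulus_ge0// ?mulr_ge0 ?(ltW r0)//.
    by rewrite ler_piMr// ltW.
  - rewrite exprVn lef_pV2 ?posrE ?exprn_gt0 ?(lt_le_trans q0 (v1 t))//.
    by rewrite lerXn2r// ?nnegrE ?modulus_ge0// ltW.
Qed.

End HerglotzAnalytic.

(** * The singular inner function and its approximate inverses *)

Section SingularInner.
Local Open Scope complex_scope.
Context {R : realType}.
Variable mu : {finite_measure set (measurableTypeR R) -> \bar R}.
Variable alpha : {posnum R}.
Notation Re := complex.Re.
Notation Im := complex.Im.
Implicit Types (z w : Cplx R) (t : R).
Local Notation H := (herglotz mu).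
Local Notation dH := (dherglotz mu).
Local Notation M := (mass mu).
Local Notation al := (alpha%:num).
Local Notation S := (singular_inner (mscale alpha%:num%:nng mu)).

Lemma Rintegral_mscale (k : {nonneg R}) (D : set (measurableTypeR R)) (g : R -> R) :
  measurable D -> mu.-integrable D (EFin \o g) ->
  \int[mscale k mu]_(t in D) g t = k%:num * \int[mu]_(t in D) g t.
Proof.
move=> mD ig; have mg := measurable_int _ ig.
have [ip in_] := (integrable_funepos mD ig, integrable_funeneg mD ig).
rewrite /Rintegral integralE [in RHS]integralE.
rewrite !ge0_integral_mscale//; last 2 first.
- exact: measurable_funeneg.
- exact: measurable_funepos.
rewrite -muleBr//.
  by rewrite fineM// fin_numB !integrable_fin_num.
by apply: fin_num_adde_defr; exact: integrable_fin_num.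
Qed.

Lemma singular_innerE z : modulus z < 1 -> S z = cexp (- (al%:C * H z)).
Proof.
move=> z1; rewrite /singular_inner; congr (cexp (- _)).
have mC := @measurable_circle_angles R.
have bk := bcont_herglotz_kernel z z1.
rewrite /H /cintegral !Rintegral_mscale//; last 2 first.
- exact: bcont_integrable_Im.
- exact: bcont_integrable_Re.
by apply/eqP; rewrite eq_complex/= !mul0r subr0 addr0 !eqxx.
Qed.

Lemma qderiv_eq_on_disc (f g : Cplx R -> Cplx R) z (d : Cplx R) : modulus z < 1 ->
  (forall w, modulus w < 1 -> f w = g w) -> qderiv g z d -> qderiv f z d.
Proof.
move=> z1 fg [e e0 [C hC]].
exists (Num.min e (1 - modulus z)); first by rewrite lt_min e0 subr_gt0.
exists C => h; rewrite lt_min => /andP[he hz].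
rewrite !fg//; first exact: hC.
by rewrite (le_lt_trans (modulusD _ _))//; lra.
Qed.

Lemma qderiv_singular_inner z : modulus z < 1 -> qderiv S z (S z * (- (al%:C * dH z))).
Proof.
move=> z1; apply: (qderiv_eq_on_disc _ (fun w => cexp (- al%:C * H w)) z) => //.
  by move=> w w1; rewrite singular_innerE// mulNr.
rewrite singular_innerE// -!mulNr.
apply: (qderiv_comp (fun w => - al%:C * H w)); last exact: qderiv_cexp.
have -> : - al%:C * dH z = 0 * H z + - al%:C * dH z by rewrite mul0r add0r.
by apply: qderivM; [exact: qderiv_cst|exact: qderiv_herglotz].
Qed.

Lemma modulus_singular_inner z : modulus z < 1 -> modulus (S z) = expR (- (al * Re (H z))).
Proof.
by move=> z1; rewrite singular_innerE// modulus_cexp; case: (H z) => p q /=; rewrite mul0r subr0.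
Qed.

Lemma modulus_singular_inner_le1 z : modulus z < 1 -> modulus (S z) <= 1.
Proof.
move=> z1; rewrite modulus_singular_inner// -[leRHS]expR0 ler_expR oppr_le0.
by rewrite mulr_ge0// Re_herglotz_ge0.
Qed.

Lemma singular_inner0 : S 0 = (expR (- (al * M)))%:C.
Proof.
rewrite singular_innerE ?modulus0// herglotz0 -rmorphM -rmorphN /cexp /=.
by rewrite /expi cos0 sin0 mulr1.
Qed.

(** |1 + w|^2 = 1 + 2 Re w + |w|^2 <= exp(2 Re w + |w|^2). *)
Lemma expr_1D_le w (n : nat) :
  modulus (1 + w) ^+ n <= expR (n%:R * Re w + n%:R * modulus w ^+ 2 / 2).
Proof.
have e0 := modulus_ge0 (1 + w).
have h : modulus (1 + w) ^+ 2 <= expR (2 * Re w + modulus w ^+ 2).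
  apply: le_trans (expR_ge1Dx _); rewrite !sqr_modulus; case: w {e0} => p q /=.
  by rewrite add0r; rewrite !expr2; lra.
have h2 : modulus (1 + w) <= expR (Re w + modulus w ^+ 2 / 2).
  rewrite -(@ler_pXn2r _ 2) ?nnegrE ?expR_ge0//; apply: (le_trans h).
  by rewrite -expRM_natl ler_expR; lra.
apply: (@le_trans _ _ (expR (Re w + modulus w ^+ 2 / 2) ^+ n)).
  by rewrite lerXn2r// nnegrE expR_ge0.
by rewrite -expRM_natl ler_expR; lra.
Qed.

(** q = exp(alpha mu(T)) (1 + P / n)^n, with P a Taylor polynomial of
    alpha (H(r z) - H(0)), stands for 1 / f(r z), and the constant makes q f equal
    to 1 at 0. The logarithmic derivative of q is P' / (1 + P / n), close to
    alpha r H'(r z), while |q| <= exp(alpha u(r z) + 2) by [expr_1D_le]; moreover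
    |f| <= 1. *)
Lemma approximate_inverse (r e : R) : 0 < r -> r < 1 -> 0 < e -> e <= 2^-1 ->
  exists q : {poly Cplx R}, q.[0] * S 0 = 1 /\ forall z, modulus z < 1 ->
    modulus (q^`().[z] * S z + q.[z] * (S z * (- (al%:C * dH z)))) <=
    2 * expR 2 * expR (al * Re (H (r%:C * z))) *
      (al * modulus (r%:C * dH (r%:C * z) - dH z) + e * (1 + al * modulus (dH z))).
Proof.
move=> r0 r1 e0 e2.
have M0 := mass_ge0 mu.
have al0 : 0 < al by [].
have [h [h0 hP]] := herglotz_poly mu r (e / al) r0 r1 (divr_gt0 e0 al0).
pose P : {poly Cplx R} := al%:C *: h.
have P0 : P.[0] = 0 by rewrite hornerZ h0 mulr0.
have Pz z : modulus z < 1 -> modulus (P.[z] - al%:C * (H (r%:C * z) - M%:C)) <= e.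
  move=> z1; have [h1 _] := hP z z1.
  rewrite hornerZ -mulrBr modulusM modulus_real gtr0_norm// mulrC.
  by rewrite -ler_pdivlMr.
have dPz z : modulus z < 1 -> modulus (P^`().[z] - al%:C * (r%:C * dH (r%:C * z))) <= e.
  move=> z1; have [_ h1] := hP z z1.
  rewrite derivZ hornerZ -mulrBr modulusM modulus_real gtr0_norm// mulrC.
  by rewrite -ler_pdivlMr.
have rz z : modulus z < 1 -> modulus (r%:C * z) <= 1 - (1 - r).
  by move=> z1; rewrite modulusM modulus_real gtr0_norm// subKr ler_piMr// ltW.
have q0 : 0 < 1 - r by rewrite subr_gt0.
pose B := al * (4 / (1 - r) * M + M) + 1.
have B1 : 1 <= B by rewrite lerDr mulr_ge0 ?addr_ge0 ?mulr_ge0 ?invr_ge0// ltW.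
have PB z : modulus z < 1 -> modulus P.[z] <= B.
  move=> z1; rewrite -(subrK (al%:C * (H (r%:C * z) - M%:C)) P.[z]) addrC.
  apply: (le_trans (modulusD _ _)); apply: lerD; last first.
    by rewrite (le_trans (Pz z z1))//; lra.
  rewrite modulusM modulus_real gtr0_norm// ler_pM2l//.
  apply: (le_trans (modulusB _ _)); rewrite modulus_real (ger0_norm M0) lerD2r.
  by apply: modulus_herglotz_le => //; [lra|exact: rz].
(* n makes both |P| / n and |P|^2 / n at most e. *)
pose n := (Num.trunc (B ^+ 2 / e)).+1.
have nB : B ^+ 2 / e <= n%:R by rewrite ltW// truncnS_gt.
have n0 : 0 < n%:R :> R by rewrite ltr0n.
have nB2 : B ^+ 2 <= e * n%:R by rewrite mulrC -ler_pdivrMr.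
have nB1 : B <= e * n%:R by apply: le_trans nB2; rewrite expr2 ler_peMl//; lra.
have nC : (n%:R : Cplx R) != 0 by rewrite -modulus_gt0 modulus_nat.
pose Q : {poly Cplx R} := 1 + (n%:R^-1 : Cplx R) *: P.
pose E : Cplx R := (expR (al * M))%:C.
exists (E *: Q ^+ n).
have Qz z : Q.[z] = 1 + P.[z] / n%:R by rewrite /Q -polyC1 hornerD hornerC hornerZ mulrC.
have Ez : E * (expR (- (al * M)))%:C = 1.
  by rewrite /E -rmorphM/= -expRD subrr expR0.
split.
  by rewrite hornerZ horner_exp Qz P0 mul0r addr0 expr1n mulr1 singular_inner0.
move=> z z1.
set w := P.[z] / n%:R.
have we : modulus w <= e.
  by rewrite modulusM modulusV modulus_nat ler_pdivrMr// (le_trans (PB z z1)).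
have Qhalf : 2^-1 <= modulus Q.[z].
  rewrite Qz -/w; have := modulusD (1 + w) (- w).
  by rewrite addrK modulus1 modulusN; lra.
have Qn0 : Q.[z] != 0 by rewrite -modulus_gt0; lra.
have -> : (E *: Q ^+ n)^`().[z] = E * (Q.[z] ^+ n / Q.[z]) * P^`().[z].
  rewrite derivZ deriv_exp /n hornerZ -/n hornerMn hornerM horner_exp /=.
  have -> : Q^`() = (n%:R^-1 : Cplx R) *: P^`() by rewrite derivD derivC derivZ add0r.
  rewrite hornerZ [in RHS]exprS -mulr_natl -/n.
  by field; rewrite Qn0.
rewrite hornerZ horner_exp.
set T := E * Q.[z] ^+ n.
have -> : E * (Q.[z] ^+ n / Q.[z]) * P^`().[z] * S z + T * (S z * - (al%:C * dH z)) =
   T / Q.[z] * S z * (P^`().[z] - al%:C * dH z * (1 + w)).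
  by rewrite -Qz /T; field.
have TE : modulus T <= expR 2 * expR (al * Re (H (r%:C * z))).
  rewrite modulusM modulus_real ger0_norm ?expR_ge0// modulusX Qz -/w.
  apply: (@le_trans _ _ (expR (al * M) * expR (n%:R * Re w + n%:R * modulus w ^+ 2 / 2))).
    by rewrite ler_pM2l ?expR_gt0// expr_1D_le.
  rewrite -!expRD ler_expR.
  have h1 : n%:R * Re w = Re P.[z].
    rewrite /w mulrC; have -> : P.[z] / n%:R = P.[z] * ((n%:R : R)^-1)%:C.
      by rewrite fmorphV rmorph_nat.
    by case: (P.[z]) => p q' /=; rewrite mulr0 subr0 mulfVK// gt_eqF.
  have h2 : n%:R * modulus w ^+ 2 / 2 <= 2^-1.
    rewrite modulusM modulusV modulus_nat exprMn exprVn.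
    have -> : n%:R * (modulus P.[z] ^+ 2 / n%:R ^+ 2) / 2 = modulus P.[z] ^+ 2 / n%:R / 2.
      by field; rewrite gt_eqF.
    rewrite ler_piMl// ler_pdivrMr// mul1r.
    apply: (@le_trans _ _ (B ^+ 2)).
      by rewrite lerXn2r// ?nnegrE ?modulus_ge0 ?PB//; lra.
    by rewrite (le_trans nB2)// ler_piMl ?ltW//; lra.
  have h3 : Re P.[z] <= al * (Re (H (r%:C * z)) - M) + e.
    have := le_trans (ler_Re_modulus _) (Pz z z1).
    rewrite raddfB/=; case: (H (r%:C * z)) => p q' /=; rewrite mul0r subr0 ler_norml => /andP[_].
    lra.
  rewrite h1; lra.
rewrite (modulusM (T / Q.[z] * S z)) (modulusM (T / Q.[z])) (modulusM T) modulusV.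
have S1 := modulus_singular_inner_le1 z z1.
have main : modulus (P^`().[z] - al%:C * dH z * (1 + w)) <=
   al * modulus (r%:C * dH (r%:C * z) - dH z) + e * (1 + al * modulus (dH z)).
  have -> : P^`().[z] - al%:C * dH z * (1 + w) =
    (P^`().[z] - al%:C * (r%:C * dH (r%:C * z))) + al%:C * (r%:C * dH (r%:C * z) - dH z)
     - al%:C * dH z * w by ring.
  apply: (le_trans (modulusB _ _)).
  have h1 : modulus (al%:C * dH z * w) <= e * (al * modulus (dH z)).
    rewrite (modulusM (al%:C * dH z)) (modulusM al%:C) modulus_real gtr0_norm// mulrC; apply: ler_wpM2r; last exact: we.
    by apply: mulr_ge0; [exact: ltW|exact: modulus_ge0].
  have h2 : modulus (al%:C * (r%:C * dH (r%:C * z) - dH z)) = al * modulus (r%:C * dH (r%:C * z) - dH z).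
    by rewrite modulusM modulus_real gtr0_norm.
  have h3 := modulusD (P^`().[z] - al%:C * (r%:C * dH (r%:C * z))) (al%:C * (r%:C * dH (r%:C * z) - dH z)).
  rewrite h2 in h3; have := dPz z z1; lra.
have Qi : (modulus Q.[z])^-1 <= 2 by rewrite -[leRHS]invrK lef_pV2 ?posrE//; lra.
have -> : 2 * expR 2 * expR (al * Re (H (r%:C * z))) = expR 2 * expR (al * Re (H (r%:C * z))) * 2 * 1.
  by ring.
apply: ler_pM => //; rewrite ?mulr_ge0 ?modulus_ge0 ?invr_ge0 ?modulus_ge0//.
apply: ler_pM => //; rewrite ?mulr_ge0 ?modulus_ge0 ?invr_ge0 ?modulus_ge0//.
by apply: ler_pM => //; rewrite ?modulus_ge0 ?invr_ge0 ?modulus_ge0.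
Qed.

End SingularInner.

(** * Weighted energy *)

Lemma small_tail (R : realType) (W : nat -> R) (V e : R) : (forall k, 0 <= W k) ->
  (forall n, \sum_(k < n) W k <= V) -> 0 < e ->
  exists n0, forall N, \sum_(k < N) (if (n0 <= k)%N then W k else 0) <= e.
Proof.
move=> W0 WV e0.
pose s n := \sum_(k < n) W k.
have hs : has_sup (range s).
  by split; [exists (s 0%N), 0%N|exists V => _ [n _ <-]; exact: WV].
have [_ [n0 _ <-] sn] := sup_adherent e0 hs.
exists n0 => N.
have [Nn|nN] := leqP N n0.
  rewrite big1 ?ltW// => k _; rewrite ifF// leqNgt.
  by rewrite (leq_trans (ltn_ord k) Nn).
have tail d : s (n0 + d)%N = s n0 + \sum_(k < n0 + d) (if (n0 <= k)%N then W k else 0).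
  elim: d => [|d IH].
    rewrite addn0 [X in _ = _ + X]big1 ?addr0// => k _.
    by rewrite ifF// leqNgt (ltn_ord k).
  rewrite addnS {1}/s big_ord_recr [in RHS]big_ord_recr/= -/(s (n0 + d)%N) IH leq_addr.
  by rewrite addrA.
have := tail (N - n0)%N; rewrite subnKC ?(ltnW nN)// => tN.
have : s N <= sup (range s) by apply: sup_upper_bound => //; exists N.
lra.
Qed.

Section Energy.
Local Open Scope complex_scope.
Context {R : realType}.
Variables (mu : {finite_measure set (measurableTypeR R) -> \bar R}).
Variables (phi : R -> R) (p C eps : R).
Hypothesis phi_pos : forall t : R, 0 < t -> t <= 1 -> 0 < phi t.
Hypothesis p_gt1 : 1 < p.
Hypothesis C_gt0 : 0 < C.
Local Notation a := (dyadic_value phi).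
Hypothesis smooth : dyadic_smooth mu a C.

(** The terms of the series extracted from the integral hypothesis. *)
Definition weight k := a k.+1 `^ p * expR (eps / 2 * bracket_sum phi k).

Lemma weight_ge0 k : 0 <= weight k.
Proof. by rewrite mulr_ge0 ?powR_ge0 ?expR_ge0. Qed.

(** In the boxes of level n the integrand is at most
    A^p (a n)^p 2^n exp(p lam density), on squares of area 400 / 4^n. Summing over
    the arcs with [exp_ancestor_density_sum_le] leaves a multiple of a weight, for
    lam small enough. The level n0 separates these boxes from the core of the
    disc. *)
Lemma energy_le (F : Cplx R -> Cplx R) (A lam K T : R) (k : nat -> nat) (n0 : nat) :
  0 <= A -> 0 <= K -> (forall n, k n <= n)%N -> 2 * (p * lam * C) ^+ 2 <= eps / 2 ->
  (forall z n j t, located z n j t -> (n0 < n)%N -> modulus (F z) <=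
     A * expR (lam * density mu (k n) (j %/ 2 ^ (n - k n))) * (2 ^+ n * a n)) ->
  (forall z, modulus z < 1 -> (2 ^+ n0.+1)^-1 <= 1 - modulus z -> modulus (F z) <= K) ->
  (forall N, \sum_(i < N) (if (n0 <= i)%N then weight i else 0) <= T) ->
  (\int[lebesgue_measure \x lebesgue_measure]_(w in planar_disc R)
      ((1 - modulus (w.1 +i* w.2)) `^ (p - 1) * modulus (F (w.1 +i* w.2)) `^ p)%:E
   <= (4 * K `^ p + 400 * A `^ p * expR (p * lam * mass mu + eps / 2 * a 0%N ^+ 2) * T)%:E)%E.
Proof.
move=> A0 K0 kn lamC far core tail.
have p0 : 0 < p := lt_trans ltr01 p_gt1.
have p1 : 0 <= p - 1 by rewrite subr_ge0 ltW.
have a_gt0 := dyadic_value_gt0 phi phi_pos.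
have Ap : 0 <= 400 * A `^ p := mulr_ge0 (ler0n _ _) (powR_ge0 _ _).
set U := 400 * A `^ p * expR (p * lam * mass mu + eps / 2 * a 0%N ^+ 2).
have U0 : 0 <= U := mulr_ge0 Ap (expR_ge0 _).
(* The levels up to n0 belong to the core. *)
pose c n j := if (n0 < n)%N then
  A `^ p * a n `^ p * 2 ^+ n * expR (p * lam * density mu (k n) (j %/ 2 ^ (n - k n))) else 0.
have c0 n j : 0 <= c n j.
  by rewrite /c; case: ifP => // _; rewrite !mulr_ge0 ?powR_ge0 ?expR_ge0 ?exprn_ge0.
apply: (integral_disc_le _ c _ _ n0.+1) => //.
- exact: powR_ge0.
- by move=> w _; rewrite mulr_ge0 ?powR_ge0.
- move=> w n j t loc n0n; rewrite /c n0n.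
  have [_ z1 z2 _ _] := loc; have := far _ _ _ _ loc n0n.
  set z := w.1 +i* w.2 in loc z1 z2 *; set X := density _ _ _ => Fz.
  have d0 : 0 < 2 ^+ n :> R by rewrite exprn_gt0.
  have e0 : 0 <= 1 - modulus z by apply: le_trans z1; rewrite invr_ge0 exprn_ge0.
  apply: (@le_trans _ _ (((2 ^+ n)^-1) `^ (p - 1) * (A * expR (lam * X) * (2 ^+ n * a n)) `^ p)).
    apply: ler_pM; rewrite ?powR_ge0//.
      by apply: ge0_ler_powR; rewrite ?nnegrE ?invr_ge0 ?(ltW d0).
    apply: ge0_ler_powR; rewrite ?nnegrE ?modulus_ge0// ?(ltW p0)//.
    by rewrite !mulr_ge0 ?expR_ge0// ltW.
  have an := a_gt0 n.
  rewrite !powRM ?mulr_ge0 ?expR_ge0 ?(ltW d0) ?(ltW an)//.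
  have -> : expR (lam * X) `^ p = expR (p * lam * X).
    by rewrite -expRM; congr expR; ring.
  have h2 : ((2 ^+ n)^-1) `^ (p - 1) * (2 ^+ n) `^ p = 2 ^+ n :> R.
    rewrite -[X in X `^ (p - 1)]powR_inv1 ?(ltW d0)// -powRrM -powRD; last first.
      by rewrite (gt_eqF d0) implybT.
    by rewrite (_ : -1 * (p - 1) + p = 1) ?powRr1 ?(ltW d0)//; ring.
  rewrite le_eqVlt; apply/orP; left; apply/eqP.
  set u := (2 ^+ n)^-1 `^ _ in h2 *; set v := (2 ^+ n) `^ p in h2 *.
  by rewrite -h2; ring.
- move=> w wD wn; set z := w.1 +i* w.2 in wn *.
  have Fz := core z wD wn.
  rewrite -[leRHS]mul1r; apply: ler_pM; rewrite ?powR_ge0//.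
    have one : (1 : R) `^ (p - 1) = 1 by rewrite powR1.
    rewrite -[leRHS]one; apply: ge0_ler_powR; rewrite ?nnegrE//.
      by rewrite subr_ge0 ltW.
    by rewrite gerBl modulus_ge0.
  by apply: ge0_ler_powR; rewrite ?nnegrE ?modulus_ge0// ltW.
move=> N.
apply: (@le_trans _ _ (U * \sum_(i < N) (if (n0 <= i)%N then weight i else 0))); last first.
  by rewrite ler_wpM2l.
case: N => [|N]; first by rewrite !big_ord0 mulr0.
rewrite big_ord_recl/= big1 ?add0r; last first.
  by move=> j _; rewrite /c ltn0 !mul0r.
rewrite [in leRHS]big_ord_recr/= mulrDr ler_wpDr//.
  by rewrite mulr_ge0//; case: ifP => // _; exact: weight_ge0.
rewrite big_distrr/=; apply: ler_sum => i _.
rewrite /bump add1n /c ltnS; case: ifP => n0i; last first.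
  by rewrite mulr0 big1// => j _; rewrite !mul0r.
set n := i.+1.
have d0 : 0 < 2 ^+ n :> R by rewrite exprn_gt0.
have E := exp_ancestor_density_sum_le mu a C a_gt0 C_gt0 smooth (p * lam) (k n) n (kn n).
have -> : \sum_(j < 2 ^ n) A `^ p * a n `^ p * 2 ^+ n *
      expR (p * lam * density mu (k n) (j %/ 2 ^ (n - k n))) * 400 / 4 ^+ n =
   400 * A `^ p * a n `^ p / 2 ^+ n *
     \sum_(j < 2 ^ n) expR (p * lam * density mu (k n) (j %/ 2 ^ (n - k n))).
  rewrite big_distrr/=; apply: eq_bigr => j _.
  rewrite (_ : 4 = 2 * 2); last by ring.
  by rewrite exprMn; field; rewrite gt_eqF.
apply: (le_trans (ler_wpM2l _ E)).
  by apply: divr_ge0; [exact: mulr_ge0 Ap (powR_ge0 _ _)|exact: ltW].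
rewrite mulrA (_ : 400 * A `^ p * a n `^ p / 2 ^+ n * 2 ^+ n = 400 * A `^ p * a n `^ p); last first.
  by field; rewrite gt_eqF.
have -> : U * weight i = 400 * A `^ p * a n `^ p *
   expR (p * lam * mass mu + eps / 2 * (a 0%N ^+ 2 + bracket_sum phi i)).
  by rewrite /U /weight -/n mulrDr addrA [in RHS]expRD; ring.
apply: ler_wpM2l; first exact: mulr_ge0 Ap (powR_ge0 _ _).
rewrite ler_expR lerD2l big_ord_recl; apply: ler_wpM2r => //.
by rewrite addr_ge0 ?sqr_ge0// bracket_sum_ge0.
Qed.

End Energy.

(** * Cyclicity *)

Section Cyclicity.
Local Open Scope complex_scope.
Local Open Scope complex_scope.
Context {R : realType}.
Variables (mu : {finite_measure set (measurableTypeR R) -> \bar R}).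
Variables (phi : R -> R) (p C D b eps V : R).
Hypothesis phi_pos : forall t : R, 0 < t -> t <= 1 -> 0 < phi t.
Hypothesis phi_incr : forall x y : R, 0 < x -> x <= y -> y <= 1 -> phi x <= phi y.
Hypothesis p_gt1 : 1 < p.
Hypothesis C_gt0 : 0 < C.
Hypothesis D_gt0 : 0 < D.
Hypothesis b_gt0 : 0 < b.
Hypothesis b_lt1 : b < 1.
Hypothesis eps_gt0 : 0 < eps.
Local Notation a := (dyadic_value phi).
Hypothesis growth : slow_growth a D b.
Hypothesis smooth : dyadic_smooth mu a C.
Hypothesis summable : forall n, \sum_(k < n) weight phi p eps k <= V.
Notation Re := complex.Re.
Implicit Types (z : Cplx R) (t : R).
Local Notation H := (herglotz mu).
Local Notation dH := (dherglotz mu).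
Local Notation M := (mass mu).

Let K1 := 2 * (15 * C * D / (1 - b) * (8 * 21 ^+ 3)).
Let K2 : R := 2 * (20 * 21 ^+ 2).
Let K3 := 4 * (20 * 21 ^+ 2) * C * a 0%N.

Let a_gt0 : forall n, 0 < a n.
Proof. by move=> n; apply: dyadic_value_gt0. Qed.

Let a_le0 : forall n, a n <= a 0%N.
Proof. by move=> n; apply: dyadic_value_le. Qed.

Let K1_gt0 : 0 < K1.
Proof. by rewrite !mulr_gt0// ?invr_gt0 ?subr_gt0// exprn_gt0. Qed.

Let K2_gt0 : 0 < K2.
Proof. by rewrite !mulr_gt0// exprn_gt0. Qed.

Lemma located_dherglotz_le z n j t : located z n j t ->
  modulus (dH z) <= K1 * (2 ^+ n * a n).
Proof.
move=> [jn z1 z2 zt tj].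
apply: (modulus_dherglotz_le mu a C D b _ _ _ _ _ _ _ z (node n j)) => //.
  by have := dyadic_pt_gt0 (R := R) n.+1; lra.
rewrite zt; apply: near_node => //.
  by have := dyadic_pt_gt0 (R := R) n.+1; lra.
by rewrite (le_trans z2)// -[leLHS]mul1r ler_pM2r ?invr_gt0 ?exprn_gt0// ler1n.
Qed.

(** For r = 1 - 2^-N, the point r z is at level min(n, N), in the box of the
    ancestor of the arc of z. *)
Lemma located_dilation z n j t (N : nat) : located z n j t ->
  let r := 1 - (2 ^+ N)^-1 in let k := minn n N in
  modulus (dH (r%:C * z)) <= K1 * (2 ^+ k * a k) /\
  Re (H (r%:C * z)) <= K2 * density mu k (j %/ 2 ^ (n - k)) + K3.
Proof.
move=> [jn z1 z2 zt tj] r k.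
set rho := modulus z in z1 z2 zt.
have rho0 : 0 <= rho by exact: modulus_ge0.
have kn : (k <= n)%N by rewrite geq_minl.
have kN : (k <= N)%N by rewrite geq_minr.
have N0 := dyadic_pt_gt0 (R := R) N; have N1 := dyadic_pt_le1 (R := R) N.
have n0 := dyadic_pt_gt0 (R := R) n.+1.
have r0 : 0 <= r by rewrite subr_ge0.
have r1 : r <= 1 by rewrite gerBl ltW.
have mrz : modulus (r%:C * z) = r * rho by rewrite modulusM modulus_real ger0_norm.
have rr : r * rho <= r by rewrite ler_piMr//; lra.
have rr' : r * rho <= rho by rewrite ler_piMl.
have k1 : (2 ^+ n)^-1 <= (2 ^+ k)^-1 :> R by exact: dyadic_pt_le.
have k2 : (2 ^+ N)^-1 <= (2 ^+ k)^-1 :> R by exact: dyadic_pt_le.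
have far : (2 ^+ k.+1)^-1 <= 1 - r * rho.
  have [nN|Nn] := leqP n N.
    by rewrite /k (minn_idPl nN); lra.
  have -> : k = N by rewrite /k (minn_idPr (ltnW Nn)).
  by have := dyadic_pt_le (R := R) N N.+1 (leqnSn N); rewrite /r in rr *; lra.
have near : modulus (r%:C * z - expi (node k (j %/ 2 ^ (n - k)))) <= 10 / 2 ^+ k.
  have -> : r%:C * z = (r * rho)%:C * expi t by rewrite zt mulrA -rmorphM.
  apply: near_node; [by lra| |exact: ancestor_itv].
  have : (1 - r) * rho <= 1 - r by rewrite ler_piMr//; lra.
  rewrite /r; lra.
have lt1 : modulus (r%:C * z) < 1 by rewrite mrz; lra.
rewrite -mrz in far; split.
  exact: (modulus_dherglotz_le mu a C D b _ _ _ _ _ _ _ _ (node k (j %/ 2 ^ (n - k)))).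
exact: (Re_herglotz_le mu a C _ _ _ _ _ (node k (j %/ 2 ^ (n - k)))).
Qed.

Let p_gt0 : 0 < p.
Proof. exact: lt_trans p_gt1. Qed.

Let growth_le k n : (k <= n)%N -> 2 ^+ k * a k <= D * (2 ^+ n * a n).
Proof.
move=> kn; rewrite mulrC (le_trans (growth _ _ kn))//.
rewrite ler_pM2r ?mulr_gt0 ?exprn_gt0// ler_piMr ?exprn_ile1 ?(ltW D_gt0) ?(ltW b_gt0)//.
exact: ltW.
Qed.

Variable alpha : {posnum R}.
Local Notation al := (alpha%:num).
Local Notation S := (singular_inner (mscale alpha%:num%:nng mu)).
Hypothesis alpha_small : 2 * (p * (al * K2) * C) ^+ 2 <= eps / 2.

Lemma derive1_qderiv (f : Cplx R -> Cplx R) z (d : Cplx R) : qderiv f z d -> derive1 f z = d.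
Proof. by move=> /qderiv_is_derive fd; rewrite derive1E; exact: derive_val. Qed.

(** The case lam = 0 of [energy_le], as |f'| <= alpha |H'|. *)
Lemma singular_inner_in_Dspace : in_Dspace p S.
Proof.
split=> [z z1|].
  by have [] := qderiv_is_derive _ _ _ (qderiv_singular_inner mu alpha z z1).
have d1S z : modulus z < 1 -> modulus (derive1 S z) <= al * modulus (dH z).
  move=> z1; rewrite (derive1_qderiv _ _ _ (qderiv_singular_inner mu alpha z z1)).
  rewrite (modulusM (S z)) modulusN (modulusM al%:C) modulus_real gtr0_norm//.
  by rewrite ler_piMl ?mulr_ge0 ?modulus_ge0// modulus_singular_inner_le1.
rewrite /Dnorm lte_add_pinfty ?ltry// poweR_lty//.
set F := derive1 S in d1S *.
have := @energy_le R mu phi p C eps phi_pos p_gt1 C_gt0 smooth F (al * K1) 0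
  (al * (4 / (2 ^+ 1)^-1 ^+ 2 * M)) V id 0%N.
move=> h; apply: le_lt_trans (h _ _ _ _ _ _ _) _; last exact: ltry.
- by rewrite mulr_ge0// ltW.
- by rewrite !mulr_ge0 ?mass_ge0// invr_ge0 exprn_ge0// invr_ge0 exprn_ge0.
- by [].
- by rewrite mulr0 mul0r expr0n/= mulr0 divr_ge0// ltW.
- move=> z n j t loc _; have [_ z1 _ _ _] := loc.
  have zl1 : modulus z < 1 by have := dyadic_pt_gt0 (R := R) n.+1; lra.
  rewrite mul0r expR0 mulr1 -mulrA (le_trans (d1S z zl1))// ler_pM2l//.
  exact: located_dherglotz_le loc.
- move=> z z1 zd; rewrite (le_trans (d1S z z1))// ler_pM2l//.
  apply: modulus_dherglotz_crude; last by lra.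
    by rewrite invr_gt0 exprn_gt0.
  exact: dyadic_pt_le1.
- move=> N; exact: summable.
Qed.

(** Beyond level n0 the energy of q f is at most a tail of the series of
    weights, uniformly in r, so n0 is chosen first. On the remaining disc H and H'
    are bounded, and (q f)' is at most a multiple of 1 - r. *)
Lemma approximate_cyclic (eta : R) : 0 < eta ->
  exists q : {poly Cplx R}, (Dnorm p (fun z => (q.[z] * S z - 1)%R) <= eta%:E)%E.
Proof.
move=> eta0; set S0 := singular_inner _.
have al0 : 0 < al by [].
have M0 := mass_ge0 mu.
(* The bound of [approximate_inverse] in a box of level n, divided by
   exp(al * K2 * density) * 2 ^+ n * a n. *)
pose A := 2 * expR 2 * expR (al * K3) * (al * (K1 * D + K1) + (D / a 0%N + al * K1)).
have A0 : 0 <= A.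
  have h1 := ltW K1_gt0; have h2 := ltW D_gt0; have h3 := ltW (a_gt0 0).
  apply: mulr_ge0; first by rewrite !mulr_ge0 ?expR_ge0.
  apply: addr_ge0; first by apply: mulr_ge0 => //; apply: addr_ge0 => //; exact: mulr_ge0.
  by apply: addr_ge0; [exact: divr_ge0|exact: mulr_ge0].
pose U := 400 * A `^ p * expR (p * (al * K2) * M + eps / 2 * a 0%N ^+ 2).
have U0 : 0 <= U := mulr_ge0 (mulr_ge0 (ler0n _ _) (powR_ge0 _ _)) (expR_ge0 _).
have etap : 0 < eta `^ p by rewrite powR_gt0.
have T0 : 0 < eta `^ p / (2 * (U + 1)) by rewrite divr_gt0// mulr_gt0// ltr_wpDl.
(* T and K are such that the tail and the core contribute at most half of
   eta ^ p each. *)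
have [n0 tail] := small_tail R _ V _ (weight_ge0 phi p eps) summable T0.
set T := _ / _ in T0 tail.
pose K := (eta `^ p / 8) `^ p^-1.
have K0 : 0 < K by rewrite powR_gt0// divr_gt0.
have Kp : K `^ p = eta `^ p / 8.
  by rewrite -powRrM mulVf ?gt_eqF// powRr1// divr_ge0// ltW.
pose d : R := (2 ^+ n0.+1)^-1.
have d0 : 0 < d := dyadic_pt_gt0 _.
have d1 : d <= 1 := dyadic_pt_le1 _.
(* The same bound on |z| <= 1 - d, divided by 1 - r. *)
pose L := 2 * expR 2 * expR (al * (4 / d * M)) *
  (al * (8 / d ^+ 3 * M + 4 / d ^+ 2 * M) + (1 + al * (4 / d ^+ 2 * M))).
have dM3 : 0 <= 8 / d ^+ 3 * M by rewrite mulr_ge0// divr_ge0// exprn_ge0// ltW.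
have dM2 : 0 <= 4 / d ^+ 2 * M by rewrite mulr_ge0// divr_ge0// exprn_ge0// ltW.
have L0 : 0 <= L by rewrite !mulr_ge0 ?expR_ge0// !addr_ge0// mulr_ge0 ?addr_ge0// ltW.
have [N LN] : exists N, L * (2 ^+ N.+1)^-1 <= K.
  exists (Num.trunc (L / K)); set N := Num.trunc _.
  rewrite ler_pdivrMr ?exprn_gt0// mulrC -ler_pdivrMr//.
  rewrite (le_trans (ltW (truncnS_gt _)))// -natrX ler_nat ltnW// ltn_expl//.
pose e : R := (2 ^+ N.+1)^-1.
have e0 : 0 < e := dyadic_pt_gt0 _.
have e2 : e <= 2^-1 by rewrite -[2 in leRHS]expr1; exact: dyadic_pt_le.
pose r := 1 - e.
have r0 : 0 < r by rewrite /r; lra.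
have r1 : r < 1 by rewrite /r; lra.
have [q [q0 qP]] := approximate_inverse mu alpha r e r0 r1 e0 e2.
exists q.
pose f (z : Cplx R) : Cplx R := q.[z] * S0 z - 1.
have df z : modulus z < 1 ->
    derive1 f z = q^`().[z] * S0 z + q.[z] * (S0 z * (- (al%:C * dH z))).
  move=> z1; apply: derive1_qderiv; rewrite -[X in qderiv _ _ X]addr0.
  apply: (qderivD (fun z => q.[z] * S0 z) (fun=> -1)); last exact: qderiv_cst.
  apply: qderivM; [exact: qderiv_poly|exact: qderiv_singular_inner].
have dfP z : modulus z < 1 -> modulus (derive1 f z) <=
    2 * expR 2 * expR (al * Re (H (r%:C * z))) *
      (al * modulus (r%:C * dH (r%:C * z) - dH z) + e * (1 + al * modulus (dH z))).
  by move=> z1; rewrite df//; exact: qP.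
have key := @energy_le R mu phi p C eps phi_pos p_gt1 C_gt0 smooth (derive1 f) A (al * K2) K T
  (fun n => minn n N.+1) n0.
have bound : (\int[lebesgue_measure \x lebesgue_measure]_(w in planar_disc R)
      ((1 - modulus (w.1 +i* w.2)) `^ (p - 1) * modulus (derive1 f (w.1 +i* w.2)) `^ p)%:E
   <= (eta `^ p)%:E)%E.
  apply: le_trans (key _ _ _ _ _ _ _) _ => //.
  - exact: ltW.
  - by move=> n; rewrite geq_minl.
  - move=> z n j t loc n0n; have [_ z1 _ _ _] := loc.
    have zl1 : modulus z < 1 by have := dyadic_pt_gt0 (R := R) n.+1; lra.
    have [dr ur] := located_dilation z n j t N.+1 loc.
    have dz := located_dherglotz_le z n j t loc.
    rewrite -/e -/r in dr ur.
    set k := minn n N.+1 in dr ur *; set X := density _ _ _ in ur *.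
    set Y := 2 ^+ n * a n in dz *.
    have Y0 : 0 < Y by rewrite mulr_gt0// exprn_gt0.
    have kY : 2 ^+ k * a k <= D * Y by apply: growth_le; rewrite geq_minl.
    have Y1 : 1 <= D / a 0%N * Y.
      have := growth_le 0 n (leq0n n); rewrite expr0 mul1r -/Y.
      by rewrite mulrAC ler_pdivlMr// mul1r.
    apply: (le_trans (dfP z zl1)).
    have -> : A * expR (al * K2 * X) * Y = 2 * expR 2 * expR (al * (K2 * X + K3)) *
       ((al * (K1 * D + K1) + (D / a 0%N + al * K1)) * Y).
      have -> : al * (K2 * X + K3) = al * K2 * X + al * K3 by rewrite mulrDr mulrA.
      by rewrite (expRD (al * K2 * X)) /A; ring.
    apply: ler_pM.
    + by rewrite !mulr_ge0 ?expR_ge0.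
    + by rewrite addr_ge0// mulr_ge0 ?modulus_ge0 ?addr_ge0 ?mulr_ge0 ?modulus_ge0// ltW.
    + by rewrite ler_pM2l ?mulr_gt0 ?expR_gt0// ler_expR ler_pM2l.
    rewrite mulrDl; apply: lerD.
      rewrite -mulrA ler_pM2l// mulrDl; apply: (le_trans (modulusB _ _)).
      apply: lerD => //; rewrite modulusM modulus_real gtr0_norm//.
      apply: (@le_trans _ _ (modulus (dH (r%:C * z)))).
        by rewrite ler_piMl ?modulus_ge0// ltW.
      apply: (le_trans dr); have -> : K1 * D * Y = K1 * (D * Y) by rewrite mulrA.
      by rewrite ler_pM2l.
    apply: (@le_trans _ _ (1 + al * modulus (dH z))).
      rewrite ler_piMl ?addr_ge0 ?mulr_ge0 ?modulus_ge0//; lra.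
    by rewrite mulrDl; apply: lerD => //; rewrite -mulrA ler_pM2l.
  - move=> z z1 zd; apply: (le_trans (dfP z z1)).
    have zd' : modulus z <= 1 - d by rewrite /d; lra.
    have mr : modulus (r%:C * z) = r * modulus z by rewrite modulusM modulus_real gtr0_norm.
    have rzd : modulus (r%:C * z) <= 1 - d.
      by rewrite mr (le_trans _ zd')// ler_piMl ?modulus_ge0// ltW.
    have ur : Re (H (r%:C * z)) <= 4 / d * M.
      apply: le_trans (ler_norm _) (le_trans (ler_Re_modulus _) _).
      exact: modulus_herglotz_le.
    have dz := modulus_dherglotz_crude mu z d d0 d1 zd'.
    have drz := modulus_dherglotz_crude mu (r%:C * z) d d0 d1 rzd.
    have lip := dherglotz_lipschitz mu z (r%:C * z) d d0 zd' rzd.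
    have rz : modulus (r%:C * z - z) <= e.
      have -> : r%:C * z - z = - (e%:C * z) by rewrite /r rmorphB rmorph1; ring.
      by rewrite modulusN modulusM modulus_real gtr0_norm// ler_piMr// ltW.
    have diff : modulus (r%:C * dH (r%:C * z) - dH z) <= (8 / d ^+ 3 * M + 4 / d ^+ 2 * M) * e.
      have -> : r%:C * dH (r%:C * z) - dH z = (dH (r%:C * z) - dH z) - e%:C * dH (r%:C * z).
        by rewrite /r rmorphB rmorph1; ring.
      rewrite mulrDl; apply: (le_trans (modulusB _ _)); apply: lerD.
        by rewrite (le_trans lip)// ler_wpM2l.
      by rewrite modulusM modulus_real gtr0_norm// mulrC ler_pM2r.
    apply: le_trans LN; rewrite -/e /L -[leRHS]mulrA; apply: ler_pM.
    + by rewrite !mulr_ge0 ?expR_ge0.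
    + by rewrite addr_ge0// mulr_ge0 ?modulus_ge0 ?addr_ge0 ?mulr_ge0 ?modulus_ge0// ltW.
    + by rewrite ler_pM2l ?mulr_gt0 ?expR_gt0// ler_expR ler_pM2l.
    rewrite mulrDl; apply: lerD; first by rewrite -[leRHS]mulrA ler_pM2l.
    by rewrite mulrC ler_pM2r// lerD2l ler_pM2l.
  rewrite lee_fin Kp -/U.
  rewrite [leRHS](_ : eta `^ p = 4 * (eta `^ p / 8) + eta `^ p / 2); last by lra.
  rewrite lerD2l /T.
  have -> : U * (eta `^ p / (2 * (U + 1))) = U / (U + 1) * (eta `^ p / 2).
    by field; rewrite gt_eqF// ltr_wpDl.
  rewrite ler_piMl//; first by rewrite divr_ge0// ltW.
  by rewrite ler_pdivrMr ?ltr_wpDl// mul1r lerDl.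
rewrite /Dnorm q0 subrr modulus0 add0e.
have -> : eta%:E = ((eta `^ p)%:E `^ p^-1)%E.
  by rewrite poweR_EFin -powRrM mulfV ?gt_eqF// powRr1// ltW.
apply: gt0_ler_poweR => //.
- by rewrite invr_ge0 ltW.
- rewrite in_itv/= leey andbT; apply: integral_ge0 => w _.
  by rewrite lee_fin mulr_ge0 ?powR_ge0.
- by rewrite in_itv/= leey andbT lee_fin ltW.
Qed.

Lemma singular_inner_cyclic : cyclic_in_D p S.
Proof.
split; first exact: singular_inner_in_Dspace.
have /choice[q qP] : forall n : nat, exists q : {poly Cplx R},
    (Dnorm p (fun z => (q.[z] * S z - 1)%R) <= (n.+1%:R^-1)%:E)%E.
  by move=> n; apply: approximate_cyclic; rewrite invr_gt0.
exists q; apply: (@squeeze_cvge _ _ _ _ (fun=> 0%E) _ (fun n => (n.+1%:R^-1)%:E)).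
- apply: nearW => n; rewrite qP andbT /Dnorm adde_ge0 ?lee_fin ?modulus_ge0//.
  exact: poweR_ge0.
- exact: cvg_cst.
- by apply: cvg_EFin; [exact: nearW|exact: cvg_harmonic].
Qed.

End Cyclicity.

Theorem theorem4p1 (R : realType) (p : R) (hp : 2 < p)
  (phi : R -> R)
  (phi_pos : forall t : R, 0 < t -> t <= 1 -> 0 < phi t)
  (phi_cont : {within `]0, 1], continuous phi})
  (phi_incr : forall x y : R, 0 < x -> x <= y -> y <= 1 -> phi x <= phi y)
  (phi_dec : exists beta : R, 0 < beta < 1 /\
     almost_decreasing (fun t : R => phi t / t `^ beta))
  (mu : {finite_measure set (measurableTypeR R) -> \bar R})
  (mu_circle : on_circle mu)
  (mu_sing : mutually_singular mu lebesgue_measure)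
  (mu_smooth : smooth_measure phi mu)
  (hint : exists epsilon : R, 0 < epsilon /\
     (\int[lebesgue_measure]_(t in `]0%R, 1%R])
        (phi t `^ p / t * bracket phi t *
         expR (epsilon * bracket phi t ^+ 2))%:E < +oo)%E) :
  exists alpha : {posnum R},
    cyclic_in_D p (singular_inner (mscale alpha%:num%:nng mu)).
Proof.
have [D [b [D0 b0 b1 growth]]] := slow_growth_dyadic_value phi phi_pos phi_dec.
have [C C0 smooth] := dyadic_smooth_of_smooth phi phi_pos phi_incr mu D b D0 b0 b1 growth mu_smooth.
have [eps [eps0 fin]] := hint.
have p0 : 0 < p by lra.
have [V summable] := summable_of_integral phi phi_pos phi_incr p eps p0 eps0 fin.
pose K2 : R := 2 * (20 * 21 ^+ 2).
have K20 : 0 < K2 by rewrite !mulr_gt0// exprn_gt0.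
have s0 : 0 < Num.sqrt eps by rewrite sqrtr_gt0.
(* With this alpha, 2 (p alpha K2 C)^2 is eps / 2, the rate of the exponent in
   the weights. *)
have al0 : 0 < Num.sqrt eps / (2 * p * K2 * C) by rewrite divr_gt0// !mulr_gt0.
exists (PosNum al0).
apply: (singular_inner_cyclic mu phi p C D b eps V) => //; first by lra.
rewrite /=.
have -> : p * (Num.sqrt eps / (2 * p * K2 * C) * K2) * C = Num.sqrt eps / 2.
  by field; rewrite !gt_eqF.
have -> : (Num.sqrt eps / 2) ^+ 2 = eps / 4 by rewrite exprMn sqr_sqrtr ?ltW//; field.
by lra.
Qed.
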